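(* Let $p>0$ and $\beta>-1$, and suppose that the function $x\mapsto \mathcal{D}_{\beta}^{[p]}(1:x)$ is integrable on $\mathbb{R}^{2}$. Then for all $s>0$ and $x\in\mathbb{R}^{2}$, \[ D_{\beta}^{[p]}(s:x)-\mathcal{D}_{\beta}^{[p]}(s:x)=s^{\beta+\frac{2}{p}}\,p^{\beta+1}\,\Gamma^{2}\!\left(\tfrac{1}{p}\right)\sum_{n\in\mathbb{Z}^{2}\setminus\{0\}}\frac{J_{\beta+1}^{[p]}\bigl(2\pi\sqrt[p]{s}\,(x-n)\bigr)}{\bigl(2\pi\sqrt[p]{s}\,|x-n|_{p}\bigr)^{\beta+1}}. \] Moreover, under this assumption, the series on the right-hand side converges absolutely for $x\in(-\tfrac12,\tfrac12]^{2}$.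
   Context: For $p>0$ and $\xi=(\xi_1,\xi_2)\in\mathbb{R}^2$, $|\xi|_{p}:=(|\xi_{1}|^{p}+|\xi_{2}|^{p})^{1/p}$. For $\beta>-1$, $s>0$, $x\in\mathbb{R}^{2}$ define \[ D_{\beta}^{[p]}(s:x):=\frac{1}{\Gamma(\beta+1)}\sum_{m\in\mathbb{Z}^2,\ |m|_{p}^{p}<s}(s-|m|_{p}^{p})^{\beta}e^{2\pi i x\cdot m},\qquad \mathcal{D}_{\beta}^{[p]}(s:x):=\frac{1}{\Gamma(\beta+1)}\int_{|\xi|_{p}^{p}<s}(s-|\xi|_{p}^{p})^{\beta}e^{2\pi i x\cdot \xi}\,d\xi . \] For $\eta\in\mathbb{R}^2$ define \[ J_{0}^{[p]}(\eta):=\frac{1}{\Gamma^{2}(\frac{1}{p})}\left(\frac{2}{p}\right)^{2}\int_{0}^{1}\cos(\eta_{1}t^{1/p})\cos(\eta_{2}(1-t)^{1/p})\,t^{\frac{1}{p}-1}(1-t)^{\frac{1}{p}-1}\,dt, \] and for $\omega>0$ \[ J_{\omega}^{[p]}(\eta):=\frac{|\eta|_{p}^{\omega}}{p^{\omega-1}\Gamma(\omega)}\int_{0}^{1}J_{0}^{[p]}(\tau\eta)\,\tau(1-\tau^{p})^{\omega-1}\,d\tau . \] The quotient $J_{\omega}^{[p]}(\eta)/|\eta|_p^{\omega}$ is understood at $\eta=0$ as its continuous extension, i.e. $\frac{1}{p^{\omega-1}\Gamma(\omega)}\int_0^1 J_0^{[p]}(0)\tau(1-\tau^p)^{\omega-1}d\tau$.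 *)

(* Defs.v *)
From HB Require Import structures.
From mathcomp Require Import all_boot all_order all_algebra.
From mathcomp Require Import complex.
From mathcomp Require Import all_classical all_reals all_analysis.

Set Implicit Arguments.
Unset Strict Implicit.
Unset Printing Implicit Defensive.

Import Order.TTheory GRing.Theory Num.Theory.
Import numFieldNormedType.Exports.

Local Open Scope classical_set_scope.
Local Open Scope ring_scope.

Section definitions.
Context {R : realType}.
Implicit Types (p b s w : R) (x xi eta : R * R) (m n : int * int).

Definition Gamma (a : R) : R :=
  \int[lebesgue_measure]_(t in `]0, +oo[) (t `^ (a - 1) * expR (- t)).

Local Notation leb2 := (@lebesgue_measure R \x @lebesgue_measure R)%E.

(* The complex number exp(i t). *)
Definition expi (t : R) : R[i] := (cos t +i* sin t)%C.

Definition Cintegral (D : set (R * R)) (f : R * R -> R[i]) : R[i] :=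
  ((\int[leb2]_(xi in D) complex.Re (f xi))
    +i* (\int[leb2]_(xi in D) complex.Im (f xi)))%C.

Definition Cintegrable (D : set (R * R)) (f : R * R -> R[i]) : Prop :=
  leb2.-integrable D (fun xi => (complex.Re (f xi))%:E) /\
  leb2.-integrable D (fun xi => (complex.Im (f xi))%:E).

(* Unconditional convergence: the net of finite partial sums tends to l. *)
Definition has_sum (T : choiceType) (A : set T) (f : T -> R) (l : R) : Prop :=
  forall e : R, 0 < e ->
  exists F0 : set T, [/\ finite_set F0, F0 `<=` A &
    forall F : set T, finite_set F -> F0 `<=` F -> F `<=` A ->
      `| (\sum_(n \in F) f n) - l | < e].

Definition lattice_pt (m : int * int) : R * R := (m.1%:~R, m.2%:~R).

Definition dot x xi : R := x.1 * xi.1 + x.2 * xi.2.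

Definition pnorm p xi : R := (`|xi.1| `^ p + `|xi.2| `^ p) `^ p^-1.

(* The index set is finite when 0 < p, so the finitely supported sum is the
   intended one. *)
Definition Dsum p b s x : R[i] :=
  ((Gamma (b + 1))^-1)%:C%C *
  \sum_(m \in [set m : int * int | pnorm p (lattice_pt m) `^ p < s])
    (((s - pnorm p (lattice_pt m) `^ p) `^ b)%:C%C
     * expi (2 * pi * dot x (lattice_pt m))).

Definition Dint p b s x : R[i] :=
  ((Gamma (b + 1))^-1)%:C%C *
  Cintegral [set xi : R * R | pnorm p xi `^ p < s]
    (fun xi => ((s - pnorm p xi `^ p) `^ b)%:C%C * expi (2 * pi * dot x xi)).

Definition J0 p eta : R :=
  (Gamma p^-1 ^+ 2)^-1 * (2 / p) ^+ 2 *
  \int[lebesgue_measure]_(t in `[0, 1])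
    (cos (eta.1 * t `^ p^-1) * cos (eta.2 * (1 - t) `^ p^-1)
     * t `^ (p^-1 - 1) * (1 - t) `^ (p^-1 - 1)).

Definition J p w eta : R :=
  pnorm p eta `^ w / (p `^ (w - 1) * Gamma w) *
  \int[lebesgue_measure]_(t in `[0, 1])
    (J0 p (t *: eta) * t * (1 - t `^ p) `^ (w - 1)).

(* The value at eta = 0 of the continuous extension of
   eta |-> J p w eta / pnorm p eta `^ w. *)
Definition Jquot0 p w : R :=
  (p `^ (w - 1) * Gamma w)^-1 *
  \int[lebesgue_measure]_(t in `[0, 1])
    (J0 p 0 * t * (1 - t `^ p) `^ (w - 1)).

(* J p (b + 1) (2 pi s^(1/p) (x - n)) / (2 pi s^(1/p) |x - n|_p)^(b + 1), with
   the quotient read as its continuous extension when x = n. *)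
Definition Jterm p b s x n : R :=
  let y := x - lattice_pt n in
  let c := 2 * pi * s `^ p^-1 in
  if y == 0 then Jquot0 p (b + 1)
  else J p (b + 1) (c *: y) / (c * pnorm p y) `^ (b + 1).

End definitions.

(* Main.v *)
From HB Require Import structures.
Require Import Defs.
From mathcomp Require Import all_boot all_order all_algebra.
From mathcomp Require Import complex finmap.
From mathcomp Require Import all_classical all_reals all_analysis.
From mathcomp Require Import measurable_realfun ring lra zify.

(** Let [w] be the function [(1 - |xi|_p^p)^b] on the unit p-ball, extended by
    [0], and [g] its Fourier transform, an even function of each coordinate.
    Polar coordinates for the p-norm identify the Bessel quotients with the
    values of [g] on a shifted lattice, and the Dirichlet integral with a
    rescaled value of [g], so the theorem is Poisson's summation formula for
    [w], at the points of a lattice and with a pole or a jump of [w] on the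
    sphere.

    Since [w] is compactly supported, [g] is reproduced by convolution with a
    kernel of de la Vallee Poussin, whose decay is quadratic; hence an
    integrable [g] is absolutely summable on every lattice (Plancherel-Polya).
    Placing the ball in a box whose half-side is a half-integer multiple of the
    lattice mesh, the values of [g] on a finer lattice are the Fourier cosine
    coefficients of [w] times a product of cosines. The resulting series
    converges uniformly, and it represents this function wherever the function
    is continuous: powers of a trigonometric polynomial peaking at a point show
    that a function orthogonal to all cosines vanishes at its points of
    continuity. Every lattice point is a limit of such points along the outward
    diagonal. Summing over the lattice points of the box, orthogonality of the
    characters of a finite cyclic group leaves exactly the coarse lattice. *)

Set Implicit Arguments.
Unset Strict Implicit.
Unset Printing Implicit Defensive.

Import Order.TTheory GRing.Theory Num.Theory.
Import numFieldNormedType.Exports.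

Local Open Scope classical_set_scope.
Local Open Scope ring_scope.

(** * Substitution and polar coordinates *)

Section integral_substitution.
Context {R : realType}.
Local Notation mu := (@lebesgue_measure R).
Local Open Scope ereal_scope.

(** Lattice points may lie exactly on the p-sphere, where [w] can jump or blow up and where the
    strict inequalities assign the value 0. An identity almost everywhere is therefore of no use:
    the series has to be evaluated at prescribed points. The outward side is the right one because
    [w] vanishes identically there, so its limit is this same value 0 for every [b > -1] and no case
    distinction on [b] arises. Everything is kept real. As [w] is even in each coordinate, the
    exponential at a lattice point may be replaced by a product of two cosines. Multiplying [w] by
    such a product, instead of translating the lattice of the transform, preserves the evenness on
    which the cosine series rests. The constants come from the box. With [lam = s ^ (1/p)] and an
    odd [K], its half-side is [L = K / (2 lam)], so the normalisation [1 / (4 L ^ 2)] of the cosine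
    series is [lam ^ 2 / K ^ 2]; and [K ^ 2] is the number of lattice points in the box, which is
    what the orthogonality of characters returns. The remaining [lam ^ 2], times the [s ^ b] from
    rescaling [w], is [s ^ (b + 2/p)]. *)

Lemma ge0_integral_shift (c : R) (F : R -> \bar R) :
  measurable_fun [set: R] F -> (forall x, 0 <= F x) ->
  \int[mu]_x F (x + c)%R = \int[mu]_x F x.
Proof.
move=> mF F0.
have mc : measurable_fun [set: measurableTypeR R]
   ((fun x => x + c)%R : _ -> measurableTypeR R) by exact: measurable_funD.
have -> : \int[mu]_x F (x + c)%R =
   \int[pushforward mu ((fun x => x + c)%R : _ -> measurableTypeR R)]_x F x.
  by rewrite ge0_integral_pushforward.
apply: eq_measure_integral => A mA _.
apply/esym/lebesgue_measure_unique => // _ [[a b]] _ <-.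
rewrite [RHS](_ : _ = mu `](a - c)%R, (b - c)%R]).
  rewrite !lebesgue_measure_itv/= !lte_fin ltrD2r.
  by case: ifP => // _; rewrite -!EFinD; congr EFin; lra.
rewrite /= /pushforward; congr lebesgue_measure.
by apply/seteqP; split => x /=; rewrite !in_itv/= ltrBlDr lerBrDr.
Qed.

Lemma ge0_integral_scale (a : R) (F : R -> \bar R) : a != 0%R ->
  measurable_fun [set: R] F -> (forall x, 0 <= F x) ->
  \int[mu]_x F (a * x)%R = `|a|^-1%:E * \int[mu]_x F x.
Proof.
move=> a0 mF F0.
have mc : measurable_fun [set: measurableTypeR R]
   ((fun x => a * x)%R : _ -> measurableTypeR R) by exact: measurable_funM.
have aE : (0 <= `|a|^-1)%R by [].
have a1 : (0 <= `|a|)%R by [].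
have -> : \int[mu]_x F (a * x)%R =
   \int[pushforward mu ((fun x => a * x)%R : _ -> measurableTypeR R)]_x F x.
  by rewrite ge0_integral_pushforward.
suff key : \int[mu]_x F x = `|a|%:E *
  \int[pushforward mu ((fun x => a * x)%R : _ -> measurableTypeR R)]_x F x.
  by rewrite key muleA -EFinM mulVf ?normr_eq0// mul1e.
rewrite -(@ge0_integral_mscale _ _ _ _ _ measurableT (NngNum a1))//.
apply: eq_measure_integral => A mA _.
apply: lebesgue_measure_unique => // _ [[u v]] _ <-.
(* A negative factor reverses the interval and exchanges its open and closed ends, hence the two
   shapes of preimage. *)
have [ap|an|/eqP] := ltgtP a 0%R; last by rewrite (negbTE a0).
- rewrite [RHS](_ : _ = `|a|%:E * mu `[(v / a)%R, (u / a)%R[).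
    rewrite !lebesgue_measure_itv/= !lte_fin ltr_ndivrMr// mulrVK ?unitfE//.
    case: ifP => // _; last by rewrite mule0.
    by rewrite -!EFinD -EFinM ltr0_norm//; congr EFin; field.
  rewrite /mscale /= /pushforward; congr (_ * lebesgue_measure _).
  apply/seteqP; split => x /=; rewrite !in_itv/= => /andP[h1 h2];
    apply/andP; split.
  + by rewrite ler_ndivrMr// mulrC.
  + by rewrite ltr_ndivlMr// mulrC.
  + by rewrite mulrC -ltr_ndivlMr.
  + by rewrite mulrC -ler_ndivrMr.
- rewrite [RHS](_ : _ = `|a|%:E * mu `](u / a)%R, (v / a)%R]).
    rewrite !lebesgue_measure_itv/= !lte_fin ltr_pM2r ?invr_gt0//.
    case: ifP => // _; last by rewrite mule0.
    by rewrite -!EFinD -EFinM gtr0_norm//; congr EFin; field.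
  rewrite /mscale /= /pushforward; congr (_ * lebesgue_measure _).
  by apply/seteqP; split => x /=; rewrite !in_itv/= ltr_pdivrMr// ler_pdivlMr// mulrC.
Qed.

Lemma ge0_integral_mrestr d (T : measurableType d)
    (m : {measure set T -> \bar R}) (D : set T) (mD : measurable D)
    (f : T -> \bar R) : measurable_fun [set: T] f ->
  (forall x, 0 <= f x) -> \int[mrestr m mD]_x f x = \int[m]_(x in D) f x.
Proof.
move=> mf f0; rewrite -(setUv D) ge0_integral_setU//; last 3 first.
- exact: measurableC.
- by rewrite setUv.
- exact/disj_setPCl.
rewrite [X in _ + X]null_set_integral ?adde0.
- by apply: eq_measure_integral => A mA AD; rewrite /= /mrestr setIidl.
- exact: measurableC.
- exact: measurable_funS mf.
- by rewrite /= /mrestr setICl measure0.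
Qed.

(** This is the check on intervals that the image of the density [expR (- x)] under
    [x -> expR (- x)] is Lebesgue measure on the positive half-line. *)
Lemma integral_expRN_itv (a b : R) : (0 <= a < b)%R ->
  \int[mu]_x (\1_`]a, b] (expR (- x)) * expR (- x))%:E = (b - a)%:E.
Proof.
move=> /andP[a0 ab]; have b0 : (0 < b)%R by exact: le_lt_trans ab.
have dE (x : R) : is_derive x 1%R (fun x : R => - expR (- x) : R)%R (expR (- x)).
  by apply: is_derive_eq; rewrite /GRing.scale/= mulrN1 opprK.
have cE : continuous (fun x : R => expR (- x) : R)%R.
  by move=> x; apply: continuous_comp; [exact: opp_continuous|exact: continuous_expR].
have cNE : continuous (fun x : R => - expR (- x) : R)%R.
  by move=> x; apply: cvgN; exact: cE.
have indE (I : interval R) : (forall x, (expR (- x) \in `]a, b]) = (x \in I)) ->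
  \int[mu]_x (\1_`]a, b] (expR (- x)) * expR (- x))%:E =
  \int[mu]_(x in [set` I]) (expR (- x))%:E.
  move=> h; rewrite [RHS]integral_mkcond; apply: eq_integral => x _.
  rewrite patchE indicE/=.
  rewrite (_ : (expR (- x) \in `]a, b]%classic) = (x \in [set` I])); last first.
    by apply/idP/idP; rewrite !inE/= h.
  by case: ifP => _; rewrite ?mul1r ?mul0r.
(* Since [expR (- x)] never reaches 0, the end [a = 0] pulls back to an unbounded interval and needs
   the improper form of the fundamental theorem. *)
move: a0; rewrite le_eqVlt => /predU1P[a0|a0].
- rewrite -a0 in ab indE *; rewrite (indE `[(- ln b)%R, +oo[); last first.
    by move=> x; rewrite !in_itv/= expR_gt0 andbT/= -{1}(lnK b0) ler_expR lerNl.
  rewrite (@ge0_continuous_FTC2y _ _ (fun x : R => - expR (- x) : R)%R _ 0%R).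
  + by rewrite opprK lnK// sub0e -EFinN opprK subr0.
  + by move=> x _; exact: expR_ge0.
  + by apply: continuous_subspaceT.
  + by rewrite -oppr0; apply: cvgN; exact: cvgr_expR.
  + by move=> x _; exact: ex_derive.
  + by apply: cvg_at_right_filter; exact: cNE.
  + by move=> x _; rewrite derive1E; exact: derive_val.
- have lab : (- ln b < - ln a)%R by rewrite ltrN2 ltr_ln.
  rewrite (indE `[(- ln b)%R, (- ln a)%R[); last first.
    move=> x; rewrite !in_itv/= andbC; congr andb.
      by rewrite -{1}(lnK b0) ler_expR lerNl.
    by rewrite -{1}(lnK a0) ltr_expR ltrNr.
  rewrite integral_itv_bndo_bndc; last first.
    by apply/measurable_EFinP/measurable_funTS; exact: continuous_measurable_fun.
  rewrite (@continuous_FTC2 _ _ (fun x : R => - expR (- x) : R)%R)//.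
  + by rewrite !opprK !lnK// -EFinN opprK -EFinD addrC.
  + by apply: continuous_subspaceT.
  + split; first by move=> x _; exact: ex_derive.
      by apply: cvg_at_right_filter; exact: cNE.
    by apply: cvg_at_left_filter; exact: cNE.
  + by move=> x _; rewrite derive1E; exact: derive_val.
Qed.

End integral_substitution.

(** * Polar coordinates adapted to the p-norm *)

Section polar_coordinates.
Context {R : realType}.
Local Notation mu := (@lebesgue_measure R).
Local Notation leb2 := (@lebesgue_measure R \x @lebesgue_measure R)%E.
Local Open Scope ereal_scope.

Lemma measurable_set_ltr d (T : measurableType d) (f g : T -> R) :
  measurable_fun [set: T] f -> measurable_fun [set: T] g ->
  measurable [set z | (f z < g z)%R].
Proof.
move=> mf mg; have := measurable_fun_ltr mf mg.
by move=> /(_ measurableT [set true]); rewrite setTI; apply.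
Qed.

(** The density [expR (- x)] is encoded as the area under its graph: plane measure restricted to
    [S], pushed forward along the first coordinate and the exponential. Uniqueness of Lebesgue
    measure speaks of measures on the whole line, so the restriction of [mu] to the nonpositive
    half-line is added before comparing on intervals. *)
Lemma ge0_integral_expRN (F : R -> \bar R) :
  measurable_fun [set: R] F -> (forall x, 0 <= F x) ->
  \int[mu]_(x in `]0%R, +oo[) F x = \int[mu]_x (F (expR (- x)) * (expR (- x))%:E).
Proof.
move=> mF F0.
pose S := [set z : measurableTypeR R * measurableTypeR R | (0 < z.2 < expR (- z.1))%R].
have mexp : measurable_fun [set: R] (fun x : R => expR (- x)).
  by apply: measurableT_comp => //; exact: measurable_expR.
have mexp1 : measurable_fun [set: measurableTypeR R * measurableTypeR R]
    (fun z => expR (- z.1) : measurableTypeR R)%R.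
  exact: (measurableT_comp mexp measurable_fst).
have mS : measurable S.
  have -> : S = [set z | (0 < z.2)%R] `&` [set z | (z.2 < expR (- z.1))%R].
    by apply/seteqP; split => z; rewrite /S/= => /andP.
  by apply: measurableI; apply: measurable_set_ltr.
pose kap : {measure set (measurableTypeR R) -> \bar R} :=
  measure_function_pushforward__canonical__measure_function_Measure
    (mrestr leb2 mS) mexp1.
have mN : measurable (`]-oo, 0%R] : set (measurableTypeR R)) by [].
have SE (G : R -> \bar R) : measurable_fun [set: R] G -> (forall x, 0 <= G x) ->
   \int[mrestr leb2 mS]_z G (expR (- z.1)) = \int[mu]_x (G (expR (- x)) * (expR (- x))%:E).
  move=> mG G0; rewrite ge0_integral_mrestr//; last exact: measurableT_comp.
  rewrite integral_mkcond fubini_tonelli1/=; last 2 first.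
  - apply/(measurable_restrictT _ _).1 => //.
    by apply/measurable_funTS/measurableT_comp.
  - by move=> z; rewrite patchE; case: ifP.
  apply: eq_integral => x _; rewrite /fubini_F.
  transitivity (\int[mu]_(y in `]0%R, expR (- x)[) G (expR (- x))).
    rewrite [RHS]integral_mkcond; apply: eq_integral => y _.
    rewrite !patchE (_ : ((x, y) \in S) = (y \in `]0%R, expR (- x)[%classic))//.
  rewrite integral_cst//= lebesgue_measure_itv/= lte_fin expR_gt0.
  by rewrite -EFinB subr0.
transitivity (\int[measure_add kap (mrestr mu mN)]_(x in `]0%R, +oo[) F x).
  apply: eq_measure_integral => A mA _.
  apply: lebesgue_measure_unique => // _ [[a b]] _ <-.
  rewrite -[RHS]/(measure_add kap (mrestr mu mN) `]a, b]%classic) measure_addE.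
  have -> : kap `]a, b]%classic =
      \int[mu]_x (\1_`]a, b] (expR (- x)) * expR (- x))%:E.
    pose G := fun y : R => (\1_(`]a, b]%classic : set R) y : R)%:E.
    have m1 : measurable_fun [set: R] G.
      by apply/measurable_EFinP; exact: measurable_indic.
    have G0 x : 0 <= G x by rewrite lee_fin.
    under eq_integral do rewrite EFinM.
    rewrite -(SE G)//.
    rewrite -[RHS](@ge0_integral_pushforward _ _ _ _ _ _ mexp1 _ setT G)//.
    by rewrite [RHS]integral_indic// setIT.
  rewrite [X in _ + X](_ : _ = mu `]a, Num.min b 0%R]); last first.
    rewrite /= /mrestr; congr lebesgue_measure.
    apply/seteqP; split => x /=; rewrite !in_itv/= le_min.
      by move=> [/andP[-> ->]].
    by move=> /and3P[-> -> ->].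
  have -> : \int[mu]_x (\1_`]a, b] (expR (- x)) * expR (- x))%:E =
      \int[mu]_x (\1_`](Num.max a 0%R), b] (expR (- x)) * expR (- x))%:E.
    apply: eq_integral => x _; rewrite !indicE; congr (_ %:R * _)%:E.
    congr nat_of_bool; apply/idP/idP; rewrite !inE/= !in_itv/= gt_max expR_gt0 andbT//.
  have [ab|ba] := ltP (Num.max a 0%R) b.
    rewrite integral_expRN_itv; last by rewrite le_max lexx orbT.
    move: ab; rewrite gt_max !lebesgue_measure_itv/= !lte_fin => /andP[ab b0].
    rewrite ab (min_r (ltW b0)); case: (leP a 0%R) => a0; last first.
      by rewrite ltNge (ltW a0)/= adde0.
    case: ltP => a0'; first by rewrite -!EFinD; congr EFin; lra.
    by rewrite adde0 -EFinD; congr EFin; lra.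
  rewrite integral0_eq ?add0e; last first.
    move=> x _; rewrite indicE memNset ?mul0r//= in_itv/= => /andP[h1 h2].
    by have := lt_le_trans h1 h2; rewrite ltNge ba.
  move: ba; rewrite le_max => /orP[ba|b0]; last by rewrite min_l.
  rewrite !set_itv_ge ?measure0//= bnd_simp -leNgt//.
  by rewrite (le_trans _ ba)// ge_min lexx.
rewrite ge0_integral_measure_add//; last exact: measurable_funTS.
rewrite [X in _ + X](_ : _ = 0) ?adde0; last first.
  apply: null_set_integral => //; first exact: measurable_funTS.
  rewrite /= /mrestr (_ : _ `&` _ = set0) ?measure0//.
  apply/seteqP; split => x //=; rewrite !in_itv/= andbT => -[x0].
  by rewrite leNgt x0.
rewrite -SE//.
transitivity (\int[pushforward (mrestr leb2 mS) (fun z => expR (- z.1) : measurableTypeR R)%R]_(x in `]0%R, +oo[) F x); first by [].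
rewrite ge0_integral_pushforward//; last exact: measurable_funTS.
rewrite (_ : _ @^-1` _ = setT)//.
by apply/seteqP; split => z //= _; rewrite in_itv/= andbT expR_gt0.
Qed.
Lemma powR_expR (x r : R) : (expR x `^ r = expR (r * x))%R.
Proof. by rewrite /powR gt_eqF ?expR_gt0// expRK. Qed.

(** In the logarithmic coordinate [x = expR (- y)] a power substitution is the dilation
    [y -> r * y]. *)
Lemma ge0_integral_powR (r : R) (F : R -> \bar R) : (0 < r)%R ->
  measurable_fun [set: R] F -> (forall x, 0 <= F x) ->
  \int[mu]_(x in `]0%R, +oo[) F x =
  \int[mu]_(x in `]0%R, +oo[) (F (x `^ r)%R * (r * x `^ (r - 1))%:E).
Proof.
move=> r0 mF F0.
have mP s : measurable_fun [set: R] (fun x : R => x `^ s)%R by exact: measurable_powR.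
have mE : measurable_fun [set: R] (fun x : R => expR (- x)).
  by apply: measurableT_comp => //; exact: measurable_expR.
rewrite ge0_integral_expRN// ge0_integral_expRN; last 2 first.
- apply: emeasurable_funM; first exact: measurableT_comp.
  by apply/measurable_EFinP; exact: measurable_funM.
- by move=> x; rewrite mule_ge0// lee_fin mulr_ge0 ?powR_ge0 ?ltW.
pose G x := F (expR (- x)) * (expR (- x))%:E.
have mG : measurable_fun [set: R] G.
  apply: emeasurable_funM; first exact: measurableT_comp.
  exact/measurable_EFinP.
have G0 x : 0 <= G x by rewrite mule_ge0// lee_fin expR_ge0.
transitivity (r%:E * \int[mu]_x G (r * x)%R).
  rewrite ge0_integral_scale ?gt_eqF// gtr0_norm// muleA -EFinM.
  by rewrite mulfV ?gt_eqF// mul1e.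
rewrite -ge0_integralZl//; last 2 first.
- exact: measurableT_comp.
- by rewrite lee_fin ltW.
apply: eq_integral => x _; rewrite /G !powR_expR mulrN -[RHS]muleA [LHS]muleCA.
congr (_ * _); rewrite -!EFinM; congr EFin.
by rewrite -mulrA -expRD; congr (_ * expR _)%R; lra.
Qed.
Lemma ge0_integral_half (F : R -> \bar R) :
  measurable_fun [set: R] F -> (forall x, 0 <= F x) ->
  \int[mu]_x F x = \int[mu]_(x in `]0%R, +oo[) (F x + F (- x)%R).
Proof.
move=> mF F0.
have mN : measurable_fun [set: R] (fun x => F (- x)%R) by exact: measurableT_comp.
rewrite ge0_integralD//; [|exact: measurable_funTS..].
rewrite -(setUv (`]0%R, +oo[ : set R)) ge0_integral_setU//; last 3 first.
- exact: measurableC.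
- by rewrite setUv.
- exact/disj_setPCl.
congr (_ + _); rewrite setCitvr.
rewrite integral_itv_obnd_cbnd; last exact: measurable_funTS.
rewrite ge0_integration_by_substitution0//.
by under [RHS]eq_integral do rewrite opprK.
Qed.
(** The change [u = r t], [v = r (1 - t)] splits into one-dimensional moves: the shear [v = r - u],
    an exchange of the integrals, and the dilation [u = r t], which produces the factor [r]. *)
Lemma ge0_integral_simplex (G : R * R -> \bar R) :
  measurable_fun [set: R * R] G -> (forall x, 0 <= G x) ->
  \int[mu]_(u in `]0%R, +oo[) \int[mu]_(v in `]0%R, +oo[) G (u, v) =
  \int[mu]_(r in `]0%R, +oo[) \int[mu]_(t in `]0%R, 1%R[)
    (G (r * t, r * (1 - t))%R * r%:E).
Proof.
move=> mG G0.
pose Q : set (R * R) := `]0%R, +oo[ `*` `]0%R, +oo[.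
pose H := G \_ Q.
have mQ : measurable Q by exact: measurableX.
have mH : measurable_fun [set: R * R] H.
  by apply/(measurable_restrictT _ _).1 => //; exact: measurable_funTS.
have H0 z : 0 <= H z by rewrite /H patchE; case: ifP.
have HE u v : H (u, v) = if ((0 < u) && (0 < v))%R then G (u, v) else 0.
  rewrite /H patchE; congr (if _ then _ else _).
  by apply/idP/idP; rewrite inE/= /Q/= !in_itv/= !andbT => /andP.
transitivity (\int[mu]_u \int[mu]_v H (u, v)).
  rewrite integral_mkcond; apply: eq_integral => u _; rewrite patchE.
  case: ifPn => [|]; rewrite ?notin_setE ?inE/= in_itv/= andbT => u0.
    rewrite integral_mkcond; apply: eq_integral => v _; rewrite patchE HE u0/=.
    congr (if _ then _ else _).
    by apply/idP/idP; rewrite inE/= in_itv/= andbT.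
  by rewrite integral0_eq// => v _; rewrite HE; case: ifP => // /andP[].
transitivity (\int[mu]_u \int[mu]_r H (u, r - u)%R).
  apply: eq_integral => u _.
  by rewrite -(@ge0_integral_shift _ (- u)%R (fun v => H (u, v)))//; exact: measurableT_comp.
have mS : measurable_fun [set: R * R] (fun z : R * R => (z.1, z.2 - z.1)%R).
  by apply: measurable_fun_pair => //; exact: measurable_funB.
transitivity (\int[mu]_r \int[mu]_u H (u, r - u)%R).
  apply: (@fubini_tonelli _ _ _ _ _ mu mu (fun z : R * R => H (z.1, z.2 - z.1)%R)) => //.
  exact: measurableT_comp mH mS.
rewrite [RHS]integral_mkcond; apply: eq_integral => r _; rewrite patchE.
case: ifPn => [|]; rewrite ?notin_setE ?inE/= in_itv/= andbT => r0; last first.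
  rewrite integral0_eq// => u _; rewrite HE; case: ifP => // /andP[u0 v0].
  by exfalso; apply: r0; lra.
have mK : measurable_fun [set: R] (fun u => H (u, r - u)%R).
  apply: (measurableT_comp mH); apply: measurable_fun_pair => //.
  exact: measurable_funB.
transitivity (r%:E * \int[mu]_t H (r * t, r - r * t)%R).
  rewrite (@ge0_integral_scale _ r (fun u => H (u, r - u)%R))// ?gt_eqF//.
  by rewrite gtr0_norm// muleA -EFinM mulfV ?mul1e// gt_eqF.
have mM : measurable_fun [set: R] (fun t : R => r * t)%R by exact: measurable_funM.
rewrite -ge0_integralZl//; last 2 first.
- exact: (measurableT_comp mK mM).
- by rewrite lee_fin ltW.
rewrite [RHS]integral_mkcond; apply: eq_integral => t _; rewrite patchE HE.
rewrite (_ : (t \in _) = ((0 < r * t) && (0 < r - r * t))%R).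
  by case: ifP => _; rewrite ?mule0// muleC mulrBr mulr1.
have -> : (r - r * t = r * (1 - t))%R by rewrite mulrBr mulr1.
rewrite !pmulr_rgt0// subr_gt0.
by apply/idP/idP; rewrite inE/= in_itv/=.
Qed.
Lemma measurable_fun_partial_integral (D : set R) (F : R * R -> \bar R) :
  measurable D -> measurable_fun [set: R * R] F -> (forall x, 0 <= F x) ->
  measurable_fun [set: R] (fun x => \int[mu]_(v in D) F (x, v)).
Proof.
move=> mD mF F0.
pose H := F \_ (setT `*` D).
have mH : measurable_fun [set: R * R] H.
  apply/(measurable_restrictT _ _).1; first exact: measurableX.
  exact: measurable_funTS.
have H0 z : 0 <= H z by rewrite /H patchE; case: ifP.
rewrite (_ : (fun x => _) = fubini_F mu H).
  exact: measurable_fun_fubini_tonelli_F.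
apply/funext => x; rewrite integral_mkcond; apply: eq_integral => v _.
rewrite /H !patchE; congr (if _ then _ else _).
by apply/idP/idP; rewrite !inE/= => // -[].
Qed.

(** In the variables [u ^ p] and [v ^ p] the p-circles become the segments on which the sum is
    constant. Power substitutions in both coordinates thus reduce to the simplex, and a last one
    turns the p-th power of the radius back into the radius. *)
Lemma ge0_integral_polar (p : R) (F : R * R -> \bar R) : (0 < p)%R ->
  measurable_fun [set: R * R] F -> (forall x, 0 <= F x) ->
  \int[mu]_(u in `]0%R, +oo[) \int[mu]_(v in `]0%R, +oo[) F (u, v) =
  \int[mu]_(r in `]0%R, +oo[) \int[mu]_(t in `]0%R, 1%R[)
    (F (r * t `^ p^-1, r * (1 - t) `^ p^-1)%R *
     (p^-1 * r * (t `^ (p^-1 - 1) * (1 - t) `^ (p^-1 - 1)))%:E).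
Proof.
move=> p0 mF F0; set q := (p^-1)%R.
have q0 : (0 < q)%R by rewrite invr_gt0.
have mP s : measurable_fun [set: R] (fun x : R => x `^ s)%R by exact: measurable_powR.
pose C (x : R) := (q * x `^ (q - 1))%R.
have C0 x : (0 <= C x)%R by rewrite mulr_ge0 ?powR_ge0// ltW.
have mC : measurable_fun [set: R] C by exact: measurable_funM.
pose G (z : R * R) := F (z.1 `^ q, z.2 `^ q)%R * (C z.1 * C z.2)%:E.
have mG : measurable_fun [set: R * R] G.
  apply: emeasurable_funM.
    apply: (measurableT_comp mF); apply: measurable_fun_pair.
      exact: (measurableT_comp (mP q) measurable_fst).
    exact: (measurableT_comp (mP q) measurable_snd).
  apply/measurable_EFinP; apply: measurable_funM.
    exact: (measurableT_comp mC measurable_fst).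
  exact: (measurableT_comp mC measurable_snd).
have G0 z : 0 <= G z by rewrite mule_ge0// lee_fin mulr_ge0.
transitivity (\int[mu]_(u in `]0%R, +oo[) \int[mu]_(v in `]0%R, +oo[) G (u, v)).
  pose I (x : R) : \bar R := \int[mu]_(v in `]0%R, +oo[) F (x, v).
  have mI : measurable_fun [set: R] I.
    exact: measurable_fun_partial_integral.
  have I0 x : 0 <= I x by apply: integral_ge0.
  transitivity (\int[mu]_(u in `]0%R, +oo[) (I (u `^ q)%R * (C u)%:E)).
    exact: ge0_integral_powR.
  apply: eq_integral => u _.
  pose Fu v := F ((u `^ q)%R, v).
  have mFu : measurable_fun [set: R] Fu by exact: measurableT_comp.
  rewrite (_ : I _ = \int[mu]_(v in `]0%R, +oo[) Fu v)//.
  have Fu0 v : 0 <= Fu v by exact: F0.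
  rewrite (ge0_integral_powR q0 mFu)// muleC -ge0_integralZl//.
  - by apply: eq_integral => v _; rewrite /G EFinM muleCA.
  - apply: measurable_funTS; apply: emeasurable_funM.
      exact: (measurableT_comp mFu (mP q)).
    exact/measurable_EFinP.
  - by move=> v _; rewrite mule_ge0// lee_fin C0.
  - by rewrite lee_fin.
etransitivity; first exact: (ge0_integral_simplex mG G0).
pose K (z : R * R) := G (z.1 * z.2, z.1 * (1 - z.2))%R * `|z.1|%:E.
have mK : measurable_fun [set: R * R] K.
  apply: emeasurable_funM.
    apply: (measurableT_comp mG); apply: measurable_fun_pair.
      exact: measurable_funM.
    by apply: measurable_funM => //; exact: measurable_funB.
  by apply/measurable_EFinP; exact: measurableT_comp.
have K0 z : 0 <= K z by rewrite mule_ge0// lee_fin.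
transitivity (\int[mu]_(r in `]0%R, +oo[) \int[mu]_(t in `]0%R, 1%R[) K (r, t)).
  apply: eq_integral => r; rewrite inE/= in_itv/= andbT => r0.
  by apply: eq_integral => t _; rewrite /K/= gtr0_norm.
rewrite (ge0_integral_powR p0); last 2 first.
- exact: measurable_fun_partial_integral.
- by move=> r; exact: integral_ge0.
apply: eq_integral => r; rewrite inE/= in_itv/= andbT => r0.
rewrite muleC -ge0_integralZl//.
- apply: eq_integral => t; rewrite inE/= in_itv/= => /andP[t0 t1].
  have t1' : (0 < 1 - t)%R by rewrite subr_gt0.
  rewrite /K /G /C /= muleC -2!muleA.
  rewrite !powRM ?powR_ge0 ?ltW// -!powRrM mulfV ?gt_eqF// powRr1 ?ltW//.
  congr (_ * _); rewrite -!EFinM; congr EFin.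
  rewrite gtr0_norm ?powR_gt0//.
  have pq : (p * q = 1)%R by rewrite mulfV// gt_eqF.
  (* Each one-variable density contributes [r ^ (1 - p)]; the simplex factor [r ^ p] and the last
     substitution contribute [r ^ (p - 1)] each, up to one factor [r]. The powers cancel in
     pairs. *)
  have -> : (r `^ p = r `^ (p - 1) * r)%R by rewrite mulrC mulr_powRB1 ?ltW.
  have -> : (p * (q - 1) = 1 - p)%R by rewrite mulrBr pq mulr1.
  have AB : (r `^ (1 - p) * r `^ (p - 1) = 1)%R.
    by rewrite -powRD ?(gt_eqF r0) ?implybT// (_ : 1 - p + (p - 1) = 0)%R ?powRr0//; ring.
  move: (r `^ (1 - p))%R (r `^ (p - 1))%R (t `^ (q - 1))%R ((1 - t) `^ (q - 1))%R AB.
  move=> A B T U AB.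
  transitivity ((p * q) * (A * B) ^+ 2 * (q * r * (T * U)))%R; first by ring.
  by rewrite pq AB expr1n !mul1r.
- apply: measurable_funTS; exact: measurableT_comp.
- by rewrite lee_fin mulr_ge0 ?powR_ge0 ?ltW.
Qed.

Lemma ge0_integral_even2 (F : R * R -> \bar R) :
  measurable_fun [set: R * R] F -> (forall x, 0 <= F x) ->
  (forall u v, F (- u, v)%R = F (u, v)) -> (forall u v, F (u, - v)%R = F (u, v)) ->
  \int[leb2]_z F z =
  4%:E * \int[mu]_(u in `]0%R, +oo[) \int[mu]_(v in `]0%R, +oo[) F (u, v).
Proof.
move=> mF F0 e1 e2.
have mI D : measurable D ->
    measurable_fun [set: R] (fun x => \int[mu]_(v in D) F (x, v)).
  by move=> mD; exact: measurable_fun_partial_integral.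
transitivity (\int[mu]_u \int[mu]_v F (u, v)).
  exact: (@fubini_tonelli1 _ _ _ _ _ mu mu F).
have mFu u : measurable_fun [set: R] (fun v => F (u, v)) by exact: measurableT_comp.
have twice (G : R -> \bar R) : measurable_fun [set: R] G -> (forall x, 0 <= G x) ->
    (forall x, G (- x)%R = G x) ->
    \int[mu]_x G x = 2%:E * \int[mu]_(x in `]0%R, +oo[) G x.
  move=> mG G0 eG; rewrite ge0_integral_half// -ge0_integralZl//.
    by apply: eq_integral => x _; rewrite eG mule_natl mule2n.
  exact: measurable_funTS.
under eq_integral do rewrite twice//.
rewrite twice; last 3 first.
- by apply: measurable_funeM; exact: mI.
- by move=> x; rewrite mule_ge0// integral_ge0.
- by move=> x; congr (_ * _); apply: eq_integral => v _; rewrite e1.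
rewrite ge0_integralZl//; last 2 first.
- by apply: measurable_funTS; exact: mI.
- by move=> x _; exact: integral_ge0.
by rewrite muleA -EFinM; congr (_%:E * _); ring.
Qed.

End polar_coordinates.

(** * Gamma and Beta integrals *)

Section gamma_function.
Context {R : realType}.
Local Notation mu := (@lebesgue_measure R).
Local Open Scope ereal_scope.
Lemma ge0_integral_onem (F : R -> \bar R) :
  measurable_fun [set: R] F -> (forall x, 0 <= F x) ->
  \int[mu]_x F (1 - x)%R = \int[mu]_x F x.
Proof.
move=> mF F0.
rewrite -(@ge0_integral_shift _ 1%R F mF F0).
have mG : measurable_fun [set: R] (fun x => F (x + 1)%R).
  by apply: measurableT_comp => //; exact: measurable_funD.
transitivity (\int[mu]_x (fun x => F (x + 1)%R) (-1 * x)%R).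
  by apply: eq_integral => x _; rewrite mulN1r addrC.
have n1 : (-1 : R)%R != 0%R by rewrite oppr_eq0 oner_eq0.
rewrite [LHS](ge0_integral_scale n1 mG)// normrN1 invr1.
exact: mul1e.
Qed.

(** The absolute value of the exponent treats both signs at once. The bounds control a power factor
    on the half of the unit interval that is away from its singularity. *)
Lemma powR_half_bounds (x e : R) : (2^-1 <= x <= 1)%R ->
  (2 `^ (- `|e|) <= x `^ e <= 2 `^ `|e|)%R.
Proof.
move=> /andP[x2 x1]; have x0 : (0 < x)%R by apply: lt_le_trans x2.
rewrite /powR !gt_eqF// !ler_expR mulNr -ler_norml normrM ler_wpM2l//.
rewrite ler0_norm ?ln_le0// -lnV ?posrE// ler_ln ?posrE// ?invr_gt0//.
by rewrite invf_ple ?posrE.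
Qed.

Lemma powR_lt1 (x a : R) : (0 < a)%R -> (0 <= x)%R ->
  (x `^ a < 1)%R = (x < 1)%R.
Proof.
move=> a0 x0; have E1 : (1 `^ a = 1 :> R)%R by rewrite powR1.
apply/idP/idP => h; last by rewrite -E1 gt0_ltr_powR// nnegrE.
rewrite ltNge; apply/negP => h1; move: h.
rewrite ltNge => /negP; apply.
by rewrite -E1 (ge0_ler_powR (ltW a0))// nnegrE.
Qed.

Lemma ge0_integral_powR01 (a : R) : (0 < a)%R ->
  \int[mu]_(t in `]0%R, 1%R[) (t `^ (a - 1))%:E = (a^-1)%:E.
Proof.
move=> a0.
have mP s : measurable_fun [set: R] (fun x : R => x `^ s)%R by exact: measurable_powR.
have m1 : measurable_fun [set: R] (EFin \o (\1_(`]0%R, 1%R[%classic : set R) : R -> R)).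
  by apply/measurable_EFinP; exact: measurable_indic.
have I0 (x : R) : 0 <= (EFin \o (\1_(`]0%R, 1%R[%classic : set R) : R -> R)) x by rewrite lee_fin.
have := ge0_integral_powR a0 m1 I0.
rewrite integral_indic// setIidl; last first.
  by move=> x /=; rewrite !in_itv/= andbT => /andP[].
rewrite [X in X = _]lebesgue_measure_itv/= lte_fin ltr01 sube0 => E.
transitivity ((a^-1)%:E * (a%:E * \int[mu]_(t in `]0%R, 1%R[) (t `^ (a - 1))%:E)).
  by rewrite muleA -EFinM mulVf ?mul1e// gt_eqF.
rewrite -[RHS]mule1; congr (_ * _); rewrite E.
rewrite -ge0_integralZl//; last 3 first.
- by apply/measurable_funTS/measurable_EFinP.
- by move=> x _; rewrite lee_fin powR_ge0.
- by rewrite lee_fin ltW.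
rewrite integral_mkcond [RHS]integral_mkcond; apply: eq_integral => x _.
rewrite !patchE.
have [x0|x0] := ltP 0%R x; last first.
  by rewrite !memNset//= in_itv/= ltNge x0.
rewrite [in RHS]mem_set/=; last by rewrite in_itv/= x0.
rewrite indicE EFinM -EFinM.
rewrite (_ : (x `^ a \in _)%R = (x \in `]0%R, 1%R[%classic)); last first.
  apply/idP/idP; rewrite !inE/= !in_itv/= x0 powR_gt0//=.
    by rewrite powR_lt1// ltW.
  by rewrite powR_lt1// ltW.
by case: ifP => _; rewrite ?mul1e ?mul0e.
Qed.

Lemma beta_integral_lty (a c : R) : (0 < a)%R -> (0 < c)%R ->
  \int[mu]_(t in `]0%R, 1%R[) (t `^ (a - 1) * (1 - t) `^ (c - 1))%:E < +oo.
Proof.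
move=> a0 c0.
have mP s : measurable_fun [set: R] (fun x : R => x `^ s)%R by exact: measurable_powR.
have m1 s : measurable_fun [set: R] (fun x : R => (1 - x) `^ s)%R.
  by apply: (measurableT_comp (mP s)); exact: measurable_funB.
have pos1 (s x : R) : 0 <= (x `^ s)%:E by rewrite lee_fin powR_ge0.
have onem (F : R -> \bar R) : measurable_fun [set: R] F -> (forall x, 0 <= F x) ->
    \int[mu]_(t in `]0%R, 1%R[) F (1 - t)%R = \int[mu]_(t in `]0%R, 1%R[) F t.
  move=> mF F0; rewrite [RHS]integral_mkcond -ge0_integral_onem; last 2 first.
  - by apply/(measurable_restrictT _ _).1 => //; exact: measurable_funTS.
  - by move=> x; rewrite patchE; case: ifP.
  rewrite integral_mkcond; apply: eq_integral => t _; rewrite !patchE.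
  congr (if _ then _ else _); apply/idP/idP; rewrite !inE/= !in_itv/=; lra.
(* On either half of []0, 1[] only one factor can be singular; [K] bounds the other one on both
   halves. *)
pose K := (2 `^ `|a - 1| + 2 `^ `|c - 1| : R)%R.
have K0 : (0 <= K)%R by rewrite addr_ge0 ?powR_ge0.
have mF1 s : measurable_fun (`]0%R, 1%R[ : set R) (fun t => (t `^ s)%:E).
  by apply: measurable_funTS; exact/measurable_EFinP.
have mF2 s : measurable_fun (`]0%R, 1%R[ : set R) (fun t => ((1 - t) `^ s)%:E).
  by apply: measurable_funTS; exact/measurable_EFinP.
have mS : measurable_fun (`]0%R, 1%R[ : set R)
    (fun t => (t `^ (a - 1))%:E + ((1 - t) `^ (c - 1))%:E).
  exact: emeasurable_funD.
have mF : measurable_fun [set: R] (fun t => (t `^ (a - 1) * (1 - t) `^ (c - 1))%:E).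
  by apply/measurable_EFinP; exact: measurable_funM.
apply: (@le_lt_trans _ _ (\int[mu]_(t in `]0%R, 1%R[)
    (K%:E * ((t `^ (a - 1))%:E + ((1 - t) `^ (c - 1))%:E)))).
  apply: ge0_le_integral => //.
  - by move=> x _; rewrite lee_fin mulr_ge0 ?powR_ge0.
  - exact: measurable_funTS.
  - exact: measurable_funeM.
  move=> t /=; rewrite in_itv/= => /andP[t0 t1].
  rewrite -EFinD -EFinM lee_fin mulrDr.
  have [t2|t2] := leP (t : R) ((2 : R)^-1)%R.
    apply: (@le_trans _ _ (K * t `^ (a - 1))%R); last by rewrite lerDl mulr_ge0// powR_ge0.
    rewrite mulrC ler_wpM2r ?powR_ge0//.
    have h : (2^-1 <= 1 - t <= 1)%R by lra.
    by have /andP[_ h2] := powR_half_bounds (c - 1) h; rewrite (le_trans h2)// lerDr powR_ge0.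
  apply: (@le_trans _ _ (K * (1 - t) `^ (c - 1))%R); last by rewrite lerDr mulr_ge0// powR_ge0.
  rewrite ler_wpM2r ?powR_ge0//.
  have h : (2^-1 <= t <= 1)%R by rewrite !ltW.
  by have /andP[_ h2] := powR_half_bounds (a - 1) h; rewrite (le_trans h2)// lerDl powR_ge0.
rewrite ge0_integralZl//; last by move=> x _; rewrite adde_ge0.
rewrite ge0_integralD//; [|exact: mF1|exact: mF2].
rewrite ge0_integral_powR01// (onem (fun t => (t `^ (c - 1))%:E))//; last exact/measurable_EFinP.
by rewrite ge0_integral_powR01// -EFinD -EFinM ltry.
Qed.

Lemma Gamma_integral_lty (a : R) : (0 < a)%R ->
  \int[mu]_(t in `]0%R, +oo[) (t `^ (a - 1) * expR (- t))%:E < +oo.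
Proof.
move=> a0.
have mP s : measurable_fun [set: R] (fun x : R => x `^ s)%R by exact: measurable_powR.
have mE : measurable_fun [set: R] (fun x : R => expR (- x)).
  by apply: measurableT_comp => //; exact: measurable_expR.
have mF : measurable_fun [set: R] (fun t : R => (t `^ (a - 1) * expR (- t))%:E).
  by apply/measurable_EFinP/measurable_funM.
have F0 (t : R) : 0 <= (t `^ (a - 1) * expR (- t))%:E.
  by rewrite lee_fin mulr_ge0 ?powR_ge0 ?expR_ge0.
have sE : `]0%R, +oo[%classic = `]0%R, 1%R[%classic `|` `[1%R, +oo[%classic :> set R.
  apply/seteqP; split => x /=; rewrite !in_itv/= !andbT.
    by move=> x0; rewrite x0/=; case: ltP => h; [left|right].
  by case=> [/andP[]//|]; exact: lt_le_trans.
rewrite sE ge0_integral_setU//; last 2 first.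
- exact: measurable_funTS.
- apply/disj_setPS => x/= []; rewrite !in_itv/= !andbT => /andP[_ h1] h2.
  by move: h1; rewrite ltNge h2.
apply: lte_add_pinfty.
  apply: (@le_lt_trans _ _ (\int[mu]_(t in `]0%R, 1%R[) (t `^ (a - 1))%:E)); last first.
    by rewrite ge0_integral_powR01// ltry.
  apply: ge0_le_integral => //.
  - exact: measurable_funTS.
  - by apply: measurable_funTS; exact/measurable_EFinP.
  move=> t /=; rewrite in_itv/= => /andP[t0 _].
  rewrite lee_fin ler_piMr ?powR_ge0// -expR0 ler_expR; lra.
(* The function [t ^ (a + 1) * expR (- t)] peaks at [t = a + 1], where it is at most
   [(a + 1) ^ (a + 1)]; the factor 2 comes from [1 + t ^ 2 <= 2 * t ^ 2] for [t >= 1]. *)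
pose K : R := (2 * (a + 1) `^ (a + 1))%R.
have K0 : (0 <= K)%R by rewrite mulr_ge0 ?powR_ge0.
have m1 : measurable_fun [set: R] (fun t : R => ((oneDsqr t)^-1)%:E).
  apply/measurable_EFinP.
  exact: (continuous_measurable_fun (@continuous_oneDsqrV R)).
have mK : measurable_fun [set: R] (fun t : R => K%:E * ((oneDsqr t)^-1)%:E).
  exact: measurable_funeM.
apply: (@le_lt_trans _ _ (\int[mu]_(t in `[1%R, +oo[) (K%:E * ((oneDsqr t)^-1)%:E))).
  apply: ge0_le_integral => //.
  - exact: measurable_funTS.
  - exact: measurable_funTS.
  move=> t /=; rewrite in_itv/= andbT => t1.
  have t0 : (0 < t)%R by apply: lt_le_trans t1.
  rewrite -EFinM lee_fin ler_pdivlMr ?oneDsqr_gt0//.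
  have step : (t `^ (a + 1) * expR (- t) <= (a + 1) `^ (a + 1))%R.
    rewrite /powR !gt_eqF ?addr_gt0// -expRD ler_expR.
    have a1 : (0 < a + 1)%R by rewrite addr_gt0.
    have /le_ln1Dx : (-1 < t / (a + 1) - 1)%R by rewrite ltrBrDr addNr divr_gt0.
    rewrite addrC subrK ln_div ?posrE// => h.
    have := ler_wpM2l (ltW a1) h; rewrite !mulrBr [(_ * (t / _))%R]mulrC.
    rewrite divfK ?gt_eqF// mulr1; lra.
  apply: (@le_trans _ _ (t `^ (a - 1) * expR (- t) * (2 * t ^+ 2))%R).
    rewrite ler_wpM2l ?mulr_ge0 ?powR_ge0 ?expR_ge0// /oneDsqr.
    have : (1 <= t ^+ 2)%R by rewrite exprn_ege1.
    lra.
  rewrite /K (_ : _ * _ = 2 * (t `^ (a + 1) * expR (- t)))%R ?ler_pM2l//.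
  have -> : (a + 1 = (a - 1) + 2)%R by ring.
  rewrite [in RHS]powRD ?(gt_eqF t0) ?implybT//.
  rewrite (powR_mulrn 2 (ltW t0)); ring.
rewrite ge0_integralZl//; last exact: measurable_funTS.
rewrite lte_mul_pinfty ?lee_fin//.
apply: (@le_lt_trans _ _ (\int[mu]_(t in `[0%R, +oo[) ((oneDsqr t)^-1)%:E)); last first.
  by rewrite integral0y_oneDsqr ltry.
apply: ge0_subset_integral => //.
  exact: measurable_funTS.
by move=> x /=; rewrite !in_itv/= !andbT; exact: le_trans.
Qed.

(** [Gamma] is the [fine] of an extended integral, which would be 0 if the integral diverged.
    Positivity therefore uses finiteness as well as a lower bound on []1/2, 1[]. *)
Lemma Gamma_gt0 (a : R) : (0 < a)%R -> (0 < Gamma a)%R.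
Proof.
move=> a0; rewrite /Gamma /Rintegral; apply: fine_gt0; rewrite Gamma_integral_lty// andbT.
pose c : R := (2 `^ (- `|a - 1|) * expR (- 1))%R.
have c0 : (0 < c)%R by rewrite mulr_gt0 ?powR_gt0 ?expR_gt0.
have mF : measurable_fun [set: R] (fun t : R => (t `^ (a - 1) * expR (- t))%:E).
  apply/measurable_EFinP/measurable_funM; first exact: measurable_powR.
  by apply: measurableT_comp => //; exact: measurable_expR.
apply: (@lt_le_trans _ _ (\int[mu]_(t in `]2^-1%R, 1%R[) (c%:E))).
  rewrite integral_cst//= lebesgue_measure_itv/= lte_fin.
  rewrite (_ : (2^-1 < 1)%R = true) -?EFinD -?EFinM ?lte_fin; last by lra.
  by rewrite mulr_gt0//; lra.
apply: (@le_trans _ _ (\int[mu]_(t in `]2^-1%R, 1%R[) (t `^ (a - 1) * expR (- t))%:E)).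
  apply: ge0_le_integral => //.
  - by move=> x _; rewrite lee_fin ltW.
  - exact: measurable_funTS.
  move=> t /=; rewrite in_itv/= => /andP[t0 t1].
  have h : (2^-1 <= t <= 1)%R by rewrite !ltW.
  have /andP[h1 _] := powR_half_bounds (a - 1) h.
  by rewrite lee_fin ler_pM ?powR_ge0 ?expR_ge0// ler_expR lerN2 ltW.
apply: ge0_subset_integral => //.
- exact: measurable_funTS.
- by move=> x _; rewrite lee_fin mulr_ge0 ?powR_ge0 ?expR_ge0.
- by move=> x /=; rewrite !in_itv/= andbT => /andP[h _]; apply: lt_trans h.
Qed.

End gamma_function.

(** * Unconditional sums *)

Section summation.
Context {R : realType}.

Section sums.
Context {T : choiceType}.
Implicit Types (F : set T) (f g u : T -> R).

Lemma ler_fsum F f g : finite_set F -> (forall x, F x -> f x <= g x) ->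
  \sum_(x \in F) f x <= \sum_(x \in F) g x.
Proof.
move=> finF fg; rewrite !fsbig_finite//= big_seq [leRHS]big_seq.
by apply: ler_sum => x; rewrite in_fset_set// inE => /fg.
Qed.

Lemma ler_norm_fsum F f : finite_set F ->
  `|\sum_(x \in F) f x| <= \sum_(x \in F) `|f x|.
Proof. by move=> finF; rewrite !fsbig_finite//=; exact: ler_norm_sum. Qed.

Lemma fsum_setDl F0 F f : finite_set F -> F0 `<=` F ->
  \sum_(x \in F) f x = \sum_(x \in F0) f x + \sum_(x \in F `\` F0) f x.
Proof.
move=> finF sub; rewrite -fsbigU//=.
- by rewrite setDUK.
- exact: sub_finite_set sub finF.
- exact: finite_setD.
- by move=> x [h1 [_ h2]].
Qed.

Lemma ler_fsum_sub F0 F f : finite_set F -> F0 `<=` F -> (forall x, 0 <= f x) ->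
  \sum_(x \in F0) f x <= \sum_(x \in F) f x.
Proof.
by move=> finF sub f0; rewrite (fsum_setDl f finF sub) lerDl fsumr_ge0.
Qed.

Lemma has_sum_unique (A : set T) f l1 l2 :
  has_sum A f l1 -> has_sum A f l2 -> l1 = l2.
Proof.
move=> h1 h2; apply/eqP; rewrite -subr_eq0 -normr_le0; apply/ler_addgt0Pr => e e0.
have e2 : 0 < e / 2 by rewrite divr_gt0.
have [F1 [fin1 s1 H1]] := h1 _ e2; have [F2 [fin2 s2 H2]] := h2 _ e2.
have finU : finite_set (F1 `|` F2) by rewrite finite_setU.
have sU : F1 `|` F2 `<=` A by move=> x [/s1|/s2].
have {}H1 := H1 _ finU (@subsetUl _ _ _) sU.
have {}H2 := H2 _ finU (@subsetUr _ _ _) sU.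
rewrite add0r; set s := \sum_(n \in _) _ in H1 H2.
have -> : l1 - l2 = (s - l2) - (s - l1) by ring.
apply: (le_trans (ler_normB _ _)); lra.
Qed.

Lemma has_sumD (A : set T) f g l1 l2 :
  has_sum A f l1 -> has_sum A g l2 -> has_sum A (fun x => f x + g x) (l1 + l2).
Proof.
move=> h1 h2 e e0.
have e2 : 0 < e / 2 by rewrite divr_gt0.
have [F1 [fin1 s1 H1]] := h1 _ e2; have [F2 [fin2 s2 H2]] := h2 _ e2.
exists (F1 `|` F2); split; first by rewrite finite_setU.
  by move=> x [/s1|/s2].
move=> F finF sF FA.
have -> : \sum_(x \in F) (f x + g x) = \sum_(x \in F) f x + \sum_(x \in F) g x.
  by rewrite !fsbig_finite//= big_split.
have {}H1 := H1 _ finF (subset_trans (@subsetUl _ _ _) sF) FA.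
have {}H2 := H2 _ finF (subset_trans (@subsetUr _ _ _) sF) FA.
rewrite opprD addrACA; apply: (le_lt_trans (ler_normD _ _)); lra.
Qed.

Lemma has_sumZ (A : set T) f l (c : R) :
  has_sum A f l -> has_sum A (fun x => c * f x) (c * l).
Proof.
move=> h e e0.
have c1 : 0 < `|c| + 1 by rewrite ltr_wpDl.
have [F0 [fin0 s0 H0]] := h (e / (`|c| + 1)) (divr_gt0 e0 c1).
exists F0; split => // F finF sF FA; rewrite -mulr_fsumr -mulrBr normrM.
have {}H0 := H0 F finF sF FA.
apply: (@le_lt_trans _ _ ((`|c| + 1) * `|\sum_(n \in F) f n - l|)).
  by rewrite ler_wpM2r// lerDl.
by rewrite mulrC -ltr_pdivlMr.
Qed.

Lemma eq_has_sum (A : set T) f g l : (forall x, A x -> f x = g x) ->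
  has_sum A f l -> has_sum A g l.
Proof.
move=> fg h e /h[F0 [fin0 s0 H0]]; exists F0; split => // F finF sF FA.
rewrite (_ : \sum_(n \in F) g n = \sum_(n \in F) f n); first exact: H0.
by apply: eq_fsbigr => x; rewrite inE => /FA/fg.
Qed.

Lemma has_sum_ge0 u (C : R) : (forall x, 0 <= u x) ->
  (forall F, finite_set F -> \sum_(x \in F) u x <= C) ->
  exists l, has_sum setT u l /\ (forall F, finite_set F -> \sum_(x \in F) u x <= l).
Proof.
move=> u0 uC; pose E := [set \sum_(x \in F) u x | F in [set F : set T | finite_set F]].
have hE : has_sup E.
  split; first by exists (\sum_(x \in set0) u x); exists set0 => //; exact: finite_set0.
  by exists C => _ [F finF <-]; exact: uC.
exists (sup E); have ubE F : finite_set F -> \sum_(x \in F) u x <= sup E.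
  by move=> finF; apply: ub_le_sup; [exact: hE.2|exists F].
split=> // e e0; have [_ [F0 fin0 <-] h] := sup_adherent e0 hE.
exists F0; split => // F finF sF _.
have h1 := ubE _ finF; have h2 := ler_fsum_sub finF sF u0.
rewrite ler0_norm ?subr_le0// opprB; lra.
Qed.

Lemma has_sum_abs u (C : R) :
  (forall F, finite_set F -> \sum_(x \in F) `|u x| <= C) -> exists l, has_sum setT u l.
Proof.
move=> uC.
pose up x := (`|u x| + u x) / 2; pose um x := (`|u x| - u x) / 2.
have upos x : 0 <= up x.
  by rewrite divr_ge0//; have := ler_norm (- u x); rewrite normrN; lra.
have umos x : 0 <= um x.
  by rewrite divr_ge0// subr_ge0 ler_norm.
have bnd v : (forall x, 0 <= v x <= `|u x|) ->
    forall F, finite_set F -> \sum_(x \in F) v x <= C.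
  move=> v0 F finF; apply: le_trans (uC F finF).
  by apply: ler_fsum => // x _; have /andP[] := v0 x.
have [l1 [h1 _]] : exists l, has_sum setT up l /\ (forall F, finite_set F -> \sum_(x \in F) up x <= l).
  apply: (@has_sum_ge0 _ C) => //; apply: bnd => x; rewrite upos /up/=.
  have := ler_norm (u x); lra.
have [l2 [h2 _]] : exists l, has_sum setT um l /\ (forall F, finite_set F -> \sum_(x \in F) um x <= l).
  apply: (@has_sum_ge0 _ C) => //; apply: bnd => x; rewrite umos /um/=.
  have := ler_norm (- u x); rewrite normrN; lra.
exists (l1 + (-1) * l2).
apply: eq_has_sum (has_sumD h1 (has_sumZ (-1) h2)) => x _.
rewrite /up /um; lra.
Qed.

(** A finite set whose sum is within [e] of the supremum leaves less than [e] to any set disjoint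
    from it. *)
Lemma summable_tail u (C e : R) : 0 < e ->
  (forall F, finite_set F -> \sum_(x \in F) `|u x| <= C) ->
  exists F0, finite_set F0 /\ forall F, finite_set F -> F0 `&` F = set0 ->
    \sum_(x \in F) `|u x| < e.
Proof.
move=> e0 uC; have [l [h ubl]] := has_sum_ge0 (fun x => normr_ge0 (u x)) uC.
have [F0 [fin0 _ H0]] := h _ e0; exists F0; split => // F finF disj.
have := H0 F0 fin0 (@subset_refl _ _) (@subsetT _ _).
have finU : finite_set (F0 `|` F) by rewrite finite_setU.
have := ubl _ finU.
rewrite (fsum_setDl _ finU (@subsetUl _ _ _)) setDUl setDv set0U.
have -> : F `\` F0 = F by apply/setDidPl; rewrite setIC.
rewrite ltr_norml; lra.
Qed.

(** This is Weierstrass's test for unconditional sums: [F0] is chosen from the tail of [u] alone,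
    hence serves all points [x] at once. *)
Lemma has_sum_uniform (X : Type) u (c : T -> X -> R) (H : X -> R) (C : R) :
  (forall F, finite_set F -> \sum_(x \in F) `|u x| <= C) ->
  (forall t x, `|c t x| <= 1) ->
  (forall x, has_sum setT (fun t => u t * c t x) (H x)) ->
  forall e, 0 < e -> exists F0, finite_set F0 /\
    forall F, finite_set F -> F0 `<=` F -> forall x, `|H x - \sum_(t \in F) u t * c t x| <= e.
Proof.
move=> uC c1 hH e e0; have [F0 [fin0 tail]] := summable_tail e0 uC.
exists F0; split => // F finF sF x; apply/ler_addgt0Pr => d d0.
have [F1 [fin1 _ H1]] := hH x _ d0.
have finU : finite_set (F `|` F1) by rewrite finite_setU.
have := H1 _ finU (@subsetUr _ _ _) (@subsetT _ _).
rewrite (fsum_setDl _ finU (@subsetUl _ _ _)) setDUl setDv set0U.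
set s := \sum_(t \in F) _; set s' := \sum_(t \in _) _ => h.
have h' : `|s'| <= e.
  apply: (le_trans (ler_norm_fsum _ _)); first exact: finite_setD.
  apply: ltW; apply: le_lt_trans (tail (F1 `\` F) _ _).
  - by apply: ler_fsum => [|t _]; [exact: finite_setD|rewrite normrM ler_piMr].
  - exact: finite_setD.
  - by apply/seteqP; split => t // [/sF Ft [_ nF]].
have -> : H x - s = s' - (s + s' - H x) by ring.
apply: (le_trans (ler_normB _ _)); lra.
Qed.

(** The injection need not be onto. It serves to pass from the fine lattice to the sublattice
    carrying the sum, and, when it is an involution, to change signs of indices. *)
Lemma has_sum_inj (T' : choiceType) (h : T' -> T) f l : injective h ->
  (forall x, ~ range h x -> f x = 0) ->
  has_sum setT f l -> has_sum setT (f \o h) l.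
Proof.
move=> hi f0 hs e /hs[F0 [fin0 _ H0]].
exists (h @^-1` F0); split => //.
  by apply: finite_preimage => //; move=> x y _ _; exact: hi.
move=> F finF sF _.
have finI : finite_set (h @` F) by exact: finite_image.
have finU : finite_set (h @` F `|` F0) by rewrite finite_setU.
have := H0 _ finU (@subsetUr _ _ _) (@subsetT _ _).
rewrite (fsum_setDl _ finU (@subsetUl _ _ _)) [\sum_(_ \in _ `\` _) _]fsbig1 ?addr0; last first.
  move=> x [[//|F0x] nF]; apply: f0 => -[y _ yx]; apply: nF.
  by exists y => //; apply: sF; rewrite /= yx.
by rewrite fsbig_image//; move=> x y _ _; exact: hi.
Qed.

(** In the theorem the removed index is [n = 0], whose term accounts for the Dirichlet integral. *)
Lemma has_sum_setD1 f l x0 : has_sum setT f l ->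
  has_sum [set x | x != x0] f (l - f x0).
Proof.
move=> hs e /hs[F0 [fin0 _ H0]].
exists (F0 `\` [set x0]); split; first exact: finite_setD.
  by move=> x [_ /eqP].
move=> F finF sF FA.
have finU : finite_set (x0 |` F) by rewrite finite_setU.
have sU : F0 `<=` x0 |` F.
  move=> x Fx; case: (pselect (x = x0)) => [|n]; first by left.
  by right; apply: sF; split.
have := H0 _ finU sU (@subsetT _ _).
have -> : \sum_(n \in x0 |` F) f n = f x0 + \sum_(n \in F) f n.
  rewrite fsbigU//=.
  - by rewrite fsbig_set1.
  - by move=> x [-> /FA/=]; rewrite eqxx.
by rewrite opprB addrCA addrA.
Qed.

Lemma summable_bounded (A : set T) u (C : R) :
  (forall F, finite_set F -> \sum_(x \in F) `|u x| <= C) ->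
  summable A (fun x => (u x)%:E).
Proof.
move=> uC; rewrite /summable; apply: (@le_lt_trans _ _ C%:E); last exact: ltry.
apply: ub_ereal_sup => _ [F [finF _] <-] /=.
by rewrite (_ : (\sum_(x \in F) _)%E = (\sum_(x \in F) `|u x|)%:E) ?lee_fin ?uC// -fsumEFin.
Qed.

End sums.

End summation.

(** * Band-limited functions *)

Section plancherel_polya.
Context {R : realType}.
Local Notation mu := (@lebesgue_measure R).

Section integrable_helpers.
Context d (T : measurableType d) (m : {measure set T -> \bar R}).
Variables (Q : set T) (mQ : measurable Q).

Lemma EFin_Rintegral (f : T -> R) : m.-integrable Q (EFin \o f) ->
  (\int[m]_(x in Q) f x)%:E = (\int[m]_(x in Q) (f x)%:E)%E.
Proof. by move=> intf; rewrite /Rintegral fineK//; exact: (integrable_fin_num mQ intf). Qed.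

Lemma integrableZl_EFin (c : R) (f : T -> R) : m.-integrable Q (EFin \o f) ->
  m.-integrable Q (EFin \o (fun x => c * f x)).
Proof.
move=> intf; rewrite (_ : _ \o _ = (fun z => c%:E * (EFin \o f) z)%E).
  exact: integrableZl.
by apply/funext => z /=; rewrite EFinM.
Qed.

Lemma integrableD_EFin (f g : T -> R) : m.-integrable Q (EFin \o f) ->
  m.-integrable Q (EFin \o g) -> m.-integrable Q (EFin \o (fun x => f x + g x)).
Proof. by move=> h1 h2; exact: (integrableD _ h1 h2). Qed.

Lemma integrableB_EFin (f g : T -> R) : m.-integrable Q (EFin \o f) ->
  m.-integrable Q (EFin \o g) -> m.-integrable Q (EFin \o (fun x => f x - g x)).
Proof. by move=> h1 h2; exact: (integrableB _ h1 h2). Qed.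

Lemma integrable_mul_bounded (f g : T -> R) (M : R) :
  m.-integrable Q (EFin \o f) -> measurable_fun [set: T] g ->
  (forall z, `|g z| <= M) -> m.-integrable Q (EFin \o (fun z => f z * g z)).
Proof.
move=> intf mg gM.
have mf : measurable_fun Q f by apply/measurable_EFinP; exact: (measurable_int m).
apply: (@le_integrable _ _ _ m Q mQ _ (EFin \o (fun z => M * `|f z|))).
- by apply/measurable_EFinP/measurable_funM => //; exact: measurable_funTS.
- move=> z Qz; rewrite /= lee_fin !normrM normr_id mulrC ler_wpM2r//.
  by rewrite (le_trans (gM z)) ?ler_norm.
- by apply: integrableZl_EFin; exact: (integrable_abse intf).
Qed.

End integrable_helpers.

Lemma sin_norm_le (x : R) : `|sin x| <= `|x|.
Proof.
wlog x0 : x / 0 <= x => [hw|].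
  have [/hw//|xn] := leP 0 x; have := hw (- x).
  by rewrite sinN !normrN; apply; rewrite oppr_ge0 ltW.
rewrite (ger0_norm x0); move: x0; rewrite le_eqVlt => /predU1P[<-|x0].
  by rewrite sin0 normr0.
have dsin z : z \in `]0, x[ -> is_derive z 1 sin (cos z).
  by move=> _; exact: is_derive_sin.
have csin : {within `[0, x], continuous sin}.
  by apply: continuous_subspaceT; exact: continuous_sin.
have [c _] := MVT x0 dsin csin; rewrite sin0 !subr0 => ->.
by rewrite normrM (gtr0_norm x0) ler_piMl ?cos_max// ltW.
Qed.

Lemma onem_cos_le (x : R) : 1 - cos x <= x ^+ 2 / 2.
Proof.
have -> : 1 - cos x = 2 * sin (x / 2) ^+ 2.
  rewrite {1}(_ : x = (x / 2) *+ 2); last by rewrite mulr2n; lra.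
  rewrite cos_mulr2n cos2sin2; ring.
have : `|sin (x / 2)| ^+ 2 <= `|x / 2| ^+ 2 by rewrite ler_pXn2r ?nnegrE// sin_norm_le.
rewrite !real_normK ?num_real//; nra.
Qed.

(** Fejer's kernel up to a constant, with transform a multiple of the triangle of half-width [|a|].
    Division by zero gives it the value 0 at [t = 0], which integrals do not see. *)
Local Notation kap a := (fun t : R => (1 - cos (2 * pi * a * t)) / t ^+ 2).

Lemma kap_ge0 (a t : R) : 0 <= kap a t.
Proof. by rewrite divr_ge0 ?sqr_ge0// subr_ge0 cos_le1. Qed.

Lemma measurable_cosM (a : R) : measurable_fun [set: R] (fun t : R => cos (a * t)).
Proof.
apply: continuous_measurable_fun => t; apply: continuous_comp.
  exact: mulrl_continuous.
exact: continuous_cos.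
Qed.

Lemma measurable_invsqr : measurable_fun [set: R] (fun t : R => (t ^+ 2)^-1).
Proof.
have -> : (fun t : R => (t ^+ 2)^-1) = (fun t => `|t| `^ (- 2%:R)).
  apply/funext => t; rewrite powR_invn// ?exprVn; congr (_^-1).
  by rewrite real_normK// num_real.
apply: (@measurableT_comp _ _ _ _ _ _ (fun x : R => x `^ (- 2%:R))) => //.
Qed.

Lemma measurable_kap (a : R) : measurable_fun [set: R] (kap a).
Proof.
apply: measurable_funM; last exact: measurable_invsqr.
by apply: measurable_funB => //; exact: measurable_cosM.
Qed.

(** The two summands serve the two ranges of [t]. For [t ^ 2 <= 1] the kernel is at most
    [2 * (pi * a) ^ 2] and [1 + t ^ 2 <= 2]; for larger [t] it is at most [2 / t ^ 2] and
    [1 + t ^ 2 <= 2 * t ^ 2]. *)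
Lemma kap_le (a t : R) : kap a t <= (4 * (pi * a) ^+ 2 + 4) / (1 + t ^+ 2).
Proof.
have t2 : 0 < 1 + t ^+ 2 by rewrite ltr_wpDr ?sqr_ge0.
have [->|t0] := eqVneq t 0.
  rewrite expr0n/= invr0 mulr0 addr0 divr1.
  by rewrite addr_ge0// mulr_ge0// sqr_ge0.
have tt : 0 < t ^+ 2 by rewrite exprn_even_gt0.
rewrite ler_pdivlMr// mulrAC ler_pdivrMr//.
have h1 := onem_cos_le (2 * pi * a * t).
have h2 := cos_geN1 (2 * pi * a * t).
have h3 := cos_le1 (2 * pi * a * t).
move: h1 h2 h3.
have -> : (2 * pi * a * t) ^+ 2 / 2 = 2 * (pi * a) ^+ 2 * t ^+ 2 by field. 
set c := cos _; set A := (pi * a) ^+ 2; move=> h1 h2 h3.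
have A0 : 0 <= A by exact: sqr_ge0.
have [t1|t1] := leP (t ^+ 2) 1; nra.
Qed.

Lemma integral_oneDsqr_lty (M : R) : 0 <= M ->
  (\int[mu]_t (M / (1 + t ^+ 2))%:E < +oo)%E.
Proof.
move=> M0.
have m1 : measurable_fun [set: R] (fun t : R => ((1 + t ^+ 2)^-1)%:E).
  apply/measurable_EFinP.
  exact: (continuous_measurable_fun (@continuous_oneDsqrV R)).
have p1 (t : R) : 0 <= (1 + t ^+ 2)^-1 by rewrite invr_ge0 addr_ge0 ?sqr_ge0.
have E1 : (\int[mu]_(t in `]0%R, +oo[) ((1 + t ^+ 2)^-1)%:E = (pi / 2)%:E)%E.
  rewrite integral_itv_obnd_cbnd; first exact: integral0y_oneDsqr.
  exact: measurable_funTS.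
under eq_integral do rewrite EFinM.
rewrite ge0_integralZl//; last by move=> t _; rewrite lee_fin.
rewrite ge0_integral_half//.
under eq_integral do rewrite sqrrN -EFinD -mulr2n -mulr_natl EFinM.
rewrite ge0_integralZl//; last 2 first.
- exact: measurable_funTS.
- by move=> t _; rewrite lee_fin.
by rewrite E1 -!EFinM ltry.
Qed.

Lemma integral_kap_lty (a : R) : (\int[mu]_t (kap a t)%:E < +oo)%E.
Proof.
have M0 : 0 <= 4 * (pi * a) ^+ 2 + 4 by have := sqr_ge0 (pi * a); lra.
apply: le_lt_trans (integral_oneDsqr_lty M0).
have m1 : measurable_fun [set: R] (fun t : R => ((4 * (pi * a) ^+ 2 + 4) / (1 + t ^+ 2))%:E).
  apply/measurable_EFinP/measurable_funM => //.
  exact: (continuous_measurable_fun (@continuous_oneDsqrV R)).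
have m2 : measurable_fun [set: R] (fun t : R => (kap a t)%:E).
  by apply/measurable_EFinP; exact: measurable_kap.
apply: ge0_le_integral => //.
- by move=> t _; rewrite lee_fin kap_ge0.
- by move=> t _; rewrite lee_fin kap_le.
Qed.

Lemma integrable_kap (a : R) : mu.-integrable setT (EFin \o kap a).
Proof.
apply/integrableP; split; first by apply/measurable_EFinP; exact: measurable_kap.
under eq_integral do rewrite /= ger0_norm ?kap_ge0//.
exact: integral_kap_lty.
Qed.

(** The number [2 * pi ^ 2], kept symbolic: it normalises the reproducing kernel and is divided out
    through its positivity. *)
Definition kapint : R := \int[mu]_t kap 1 t.

Lemma integral_kap (a : R) : \int[mu]_t kap a t = `|a| * kapint.
Proof.
have [->|a0] := eqVneq a 0.
  rewrite normr0 mul0r; rewrite /Rintegral integral0_eq// => t _.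
  by rewrite mulr0 mul0r cos0 subrr mul0r.
have m2 : measurable_fun [set: R] (fun t : R => (kap 1 t)%:E).
  by apply/measurable_EFinP; exact: measurable_kap.
have k0 (t : R) : (0 <= (kap 1 t)%:E)%E by rewrite lee_fin kap_ge0.
have E := ge0_integral_scale a0 m2 k0.
have -> : \int[mu]_t kap a t = \int[mu]_t (a ^+ 2 * kap 1 (a * t)).
  apply: eq_Rintegral => t _; rewrite mulr1 [2 * pi * (a * t)]mulrA.
  have [->|t0] := eqVneq t 0; first by rewrite !(mulr0, expr0n)/= invr0 !mulr0.
  by field; rewrite t0 a0.
have ik : mu.-integrable setT (fun t => (kap 1 (a * t))%:E).
  apply/integrableP; split.
    by apply: (@measurableT_comp _ _ _ _ _ _ (fun t => (kap 1 t)%:E)).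
  under eq_integral do rewrite gee0_abs//.
  by rewrite E lte_mul_pinfty ?lee_fin ?invr_ge0// integral_kap_lty.
rewrite RintegralZl//.
have -> : \int[mu]_t kap 1 (a * t) = `|a|^-1 * kapint.
  by rewrite /Rintegral E fineM// ge0_fin_numE ?integral_kap_lty// integral_ge0.
rewrite mulrA; congr (_ * _).
by rewrite -(real_normK (num_real a)) expr2 mulfK// normr_eq0.
Qed.

Lemma kapint_gt0 : 0 < kapint.
Proof.
rewrite /kapint /Rintegral; apply: fine_gt0; rewrite integral_kap_lty andbT.
have m2 : measurable_fun [set: R] (fun t : R => (kap 1 t)%:E).
  by apply/measurable_EFinP; exact: measurable_kap.
(* On []1/4, 1/2[] the cosine is nonpositive and [t ^ 2 < 1], so the kernel is at least 1. *)
apply: (@lt_le_trans _ _ (\int[mu]_(t in `]4^-1%R, 2^-1%R[) 1)%E).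
  rewrite integral_cst//= mul1e lebesgue_measure_itv/= lte_fin.
  rewrite (_ : 4^-1 < 2^-1 :> R); last by lra.
  by rewrite -EFinD lte_fin; lra.
apply: (@le_trans _ _ (\int[mu]_(t in `]4^-1%R, 2^-1%R[) (kap 1 t)%:E)%E).
  apply: ge0_le_integral => //.
  - exact: measurable_funTS.
  - move=> t /=; rewrite in_itv/= => /andP[t0 t1].
    rewrite lee_fin ler_pdivlMr ?exprn_gt0//; last by apply: lt_trans t0; rewrite invr_gt0.
    have pp := @pi_gt0 R.
    have : cos (2 * pi * 1 * t) <= 0.
      rewrite -cos_pihalf ltW// ltr_cos ?in_itv/=; nra.
    nra.
apply: ge0_subset_integral => //.
by move=> t _; rewrite lee_fin kap_ge0.
Qed.

(** De la Vallee Poussin's kernel, a difference of two Fejer kernels. Its transform is a trapezoid,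
    constant on [[-1, 1]] and zero outside [[-2, 2]]. *)
Definition vpk (t : R) : R := (cos (2 * pi * t) - cos (4 * pi * t)) / t ^+ 2.

Lemma vpkE t : vpk t = kap 2 t - kap 1 t.
Proof.
rewrite /vpk -mulrBl; congr (_ / _).
have -> : 4 * pi * t = 2 * pi * 2 * t by ring.
by rewrite mulr1; ring.
Qed.

Lemma vpk_le : exists M : R, 0 <= M /\ forall t, `|vpk t| <= M / (1 + t ^+ 2).
Proof.
exists ((4 * (pi * 2) ^+ 2 + 4) + (4 * (pi * 1) ^+ 2 + 4)); split.
  by have := sqr_ge0 (pi * 2 : R); have := sqr_ge0 (pi * 1 : R); lra.
move=> t; rewrite vpkE [leRHS]mulrDl (le_trans (ler_normB _ _))//.
by rewrite lerD// ger0_norm ?kap_ge0// kap_le.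
Qed.

Lemma integrable_vpk : mu.-integrable setT (EFin \o vpk).
Proof.
rewrite (_ : _ \o _ = (EFin \o kap 2) \- (EFin \o kap 1))%E.
  by apply: integrableB => //; exact: integrable_kap.
by apply/funext => t /=; rewrite vpkE.
Qed.

(** Product-to-sum formulas give four Fejer kernels of half-widths [2 + x], [2 - x], [1 + x],
    [1 - x]. The condition on [x] makes all of these nonnegative, so that [x] cancels: this is the
    flat top of the trapezoid. *)
Lemma integral_vpk (x : R) : `|x| <= 1 ->
  \int[mu]_t (vpk t * cos (2 * pi * x * t)) = kapint.
Proof.
move=> x1.
have E t : vpk t * cos (2 * pi * x * t) =
    (2^-1 * kap (2 + x) t + 2^-1 * kap (2 - x) t) -
    (2^-1 * kap (1 + x) t + 2^-1 * kap (1 - x) t).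
  rewrite /vpk.
  have -> : 2 * pi * (2 + x) * t = 4 * pi * t + 2 * pi * x * t by ring.
  have -> : 2 * pi * (2 - x) * t = 4 * pi * t - 2 * pi * x * t by ring.
  have -> : 2 * pi * (1 + x) * t = 2 * pi * t + 2 * pi * x * t by ring.
  have -> : 2 * pi * (1 - x) * t = 2 * pi * t - 2 * pi * x * t by ring.
  rewrite !cosB !cosD; move: ((t ^+ 2)^-1) => w; by field.
under eq_Rintegral do rewrite E.
have ik a : mu.-integrable setT (EFin \o (fun t => 2^-1 * kap a t)).
  have -> : EFin \o (fun t => 2^-1 * kap a t) = (fun t => (2^-1)%:E * (EFin \o kap a) t)%E.
    by apply/funext => t /=; rewrite EFinM.
  by apply: integrableZl => //; exact: integrable_kap.
have ik2 a c : mu.-integrable setT (EFin \o (fun t => 2^-1 * kap a t + 2^-1 * kap c t)).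
  exact: (integrableD _ (ik a) (ik c)).
have ik1 a := integrable_kap a.
rewrite RintegralB// !RintegralD// !RintegralZl// !integral_kap.
move: x1; rewrite ler_norml => /andP[x1 x2].
rewrite !ger0_norm; lra.
Qed.

(** The mean of [G (y - t)] and [G (y + t)] is what a convolution becomes when characters are
    replaced by cosines. As the majorant [Psi] is even, both halves give the same integral after a
    shift, respectively a reflection and a shift. *)
Lemma reproducing_le (G psi Psi : R -> R) (c y : R) : 0 <= c ->
  measurable_fun [set: R] psi -> measurable_fun [set: R] G ->
  measurable_fun [set: R] Psi -> (forall t, Psi (- t) = Psi t) ->
  (forall t, `|psi t| <= Psi t) ->
  (c * G y)%:E = (\int[mu]_t (psi t * (2^-1 * (G (y - t) + G (y + t))))%:E)%E ->
  ((c * `|G y|)%:E <= \int[mu]_t (Psi (y - t) * `|G t|)%:E)%E.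
Proof.
move=> k0 mpsi mB mPsi ePsi hPsi rep.
have Psi0 t : 0 <= Psi t by apply: le_trans (hPsi t).
have mN : measurable_fun [set: R] (fun t => `|G t|) by exact: measurableT_comp.
pose F t := (Psi (y - t) * `|G t|)%:E.
have mF : measurable_fun [set: R] F.
  apply/measurable_EFinP/measurable_funM => //.
  by apply: measurableT_comp => //; exact: measurable_funB.
have F0 t : (0 <= F t)%E by rewrite lee_fin mulr_ge0.
have mFp : measurable_fun [set: R] (fun t => F (t + y)%R).
  by apply: measurableT_comp => //; exact: measurable_funD.
have S1 : (\int[mu]_t F (t + y)%R = \int[mu]_t F t)%E by exact: ge0_integral_shift.
have n1 : (-1 : R) != 0 by rewrite oppr_eq0 oner_eq0.
have S2 : (\int[mu]_t F (-1 * t + y)%R = \int[mu]_t F t)%E.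
  rewrite (ge0_integral_scale n1 mFp) => [|t]; last exact: F0.
  by rewrite normrN1 invr1 mul1e S1.
have mFm : measurable_fun [set: R] (fun t => F (-1 * t + y)%R).
  by apply: (measurableT_comp mFp); exact: measurable_funM.
have -> : (c * `|G y|)%:E = `|(c * G y)%:E|%E.
  by rewrite /= normrM (ger0_norm k0).
rewrite rep.
have mH : measurable_fun [set: R] (fun t => (psi t * (2^-1 * (G (y - t) + G (y + t))))%:E).
  apply/measurable_EFinP/measurable_funM => //; apply: measurable_funM => //.
  apply: measurable_funD; apply: (measurableT_comp mB); [exact: measurable_funB|exact: measurable_funD].
apply: le_trans; first exact: (le_abse_integral mu measurableT mH).
have -> : (\int[mu]_t F t = \int[mu]_t (2^-1%:E * F (-1 * t + y)%R + 2^-1%:E * F (t + y)%R))%E.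
  rewrite ge0_integralD//; last 4 first.
  - by move=> t _; rewrite mule_ge0// lee_fin.
  - exact: measurable_funeM.
  - by move=> t _; rewrite mule_ge0// lee_fin.
  - exact: measurable_funeM.
  rewrite !ge0_integralZl// S1 S2 -ge0_muleDl ?lee_fin//.
  by rewrite -EFinD (_ : 2^-1 + 2^-1 = 1) ?mul1e//; lra.
apply: ge0_le_integral => //.
- exact: measurableT_comp.
- by apply: emeasurable_funD; exact: measurable_funeM.
move=> t _; rewrite /F /= -!EFinM -EFinD lee_fin.
have -> : y - (-1 * t + y) = t by ring.
have -> : y - (t + y) = - t by ring.
have -> : -1 * t + y = y - t by ring.
rewrite ePsi (addrC t y) -mulrDr -mulrDr mulrCA !normrM.
rewrite (ger0_norm (_ : 0 <= 2^-1)) ?invr_ge0//.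
by rewrite ler_wpM2l ?invr_ge0// ler_pM// ler_normD.
Qed.

(** * Reproducing formula for transforms with support in a strip *)

Section band_limited.
Context d (T : measurableType d) (m : {sigma_finite_measure set T -> \bar R}).
Variables (W : T -> R) (pr : T -> R).
Hypotheses (intW : m.-integrable setT (EFin \o W)) (mpr : measurable_fun [set: T] pr).
Hypothesis (suppW : forall z, W z != 0 -> `|pr z| <= 1).

(** The coordinate [pr] on a general space [T] lets one formula serve both variables of a planar
    transform, the cosine in the other variable being absorbed into [W]. *)
Definition bandf (y : R) : R := \int[m]_z (W z * cos (2 * pi * y * pr z)).

Let mW : measurable_fun [set: T] W.
Proof. by apply/measurable_EFinP; exact: (measurable_int m). Qed.

Let mvpk : measurable_fun [set: R] vpk.
Proof. by apply/measurable_EFinP; exact: (measurable_int mu integrable_vpk). Qed.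

Let Wcos (g : T -> R) : measurable_fun [set: T] g -> (forall z, `|g z| <= 1) ->
  m.-integrable setT (EFin \o (fun z => W z * g z)).
Proof.
move=> mg g1; apply: (le_integrable measurableT _ _ intW).
  by apply/measurable_EFinP; exact: measurable_funM.
by move=> z _ /=; rewrite lee_fin normrM ler_piMr.
Qed.

Let mcospr (y : R) : measurable_fun [set: T] (fun z => cos (2 * pi * y * pr z)).
Proof. exact: (measurableT_comp (measurable_cosM (2 * pi * y)) mpr). Qed.

Let mcosT : measurable_fun [set: R * T] (fun z : R * T => cos (2 * pi * z.1 * pr z.2)).
Proof.
apply: (measurableT_comp (f := @cos R)).
  exact: (continuous_measurable_fun (@continuous_cos R)).
apply: measurable_funM; first exact: measurable_funM.
exact: (measurableT_comp mpr measurable_snd).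
Qed.

Let K (y : R) (z : R * T) : R :=
  vpk z.1 * (W z.2 * (cos (2 * pi * z.1 * pr z.2) * cos (2 * pi * y * pr z.2))).

Let mK y : measurable_fun [set: R * T] (fun z => (K y z)%:E).
Proof.
apply/measurable_EFinP/measurable_funM.
  exact: (measurableT_comp mvpk measurable_fst).
apply: measurable_funM; first exact: (measurableT_comp mW measurable_snd).
apply: measurable_funM; first exact: mcosT.
exact: (measurableT_comp (mcospr y) measurable_snd).
Qed.

Let intK y : (mu \x m)%E.-integrable setT (fun z => (K y z)%:E).
Proof.
apply: (proj2 (@integrable12ltyP _ _ _ _ _ mu m _ (mK y))).
have [_ lW] := integrableP _ _ _ intW; have [_ lv] := integrableP _ _ _ integrable_vpk.
have mv : measurable_fun [set: R] (fun t => `|(vpk t)%:E|)%E.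
  by apply/measurable_EFinP; exact: measurableT_comp.
have mWa : measurable_fun [set: T] (fun t => `|(W t)%:E|)%E.
  by apply/measurable_EFinP; exact: measurableT_comp.
apply: (@le_lt_trans _ _ (\int[mu]_t (`|(vpk t)%:E| * \int[m]_z `|(W z)%:E|))%E).
  apply: ge0_le_integral => //.
  - by move=> t _; exact: integral_ge0.
  - apply: (@measurable_fun_fubini_tonelli_F _ _ _ _ _ m (fun z => `|(K y z)%:E|)%E) => //.
    by apply: measurableT_comp => //; exact: mK.
  - by apply: emeasurable_funM.
  move=> t _; rewrite -ge0_integralZl//.
  apply: ge0_le_integral => //.
  - have mKt : measurable_fun [set: T] (fun z => (K y (t, z))%:E).
      exact: (measurableT_comp (mK y) (measurable_pair1 t)).
    exact: measurableT_comp.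
  - exact: measurable_funeM.
  move=> z _; rewrite /K /= -EFinM lee_fin normrM ler_wpM2l// normrM ler_piMr//.
  by rewrite normrM -(mulr1 1) ler_pM// cos_max.
have fW : (\int[m]_z `|(W z)%:E|)%E \is a fin_num by rewrite ge0_fin_numE// integral_ge0.
rewrite ge0_integralZr//; last exact: integral_ge0.
have fv : (\int[mu]_t `|(vpk t)%:E|)%E \is a fin_num by rewrite ge0_fin_numE// integral_ge0.
by rewrite -(fineK fv) -(fineK fW) -EFinM ltry.
Qed.

(** Both sides are iterated integrals of [K y]. Integrating over [z] first yields the mean of
    [bandf] at [y - t] and [y + t]; integrating over [t] first yields [kapint], since [|pr z| <= 1]
    wherever [W] is nonzero. *)
Lemma bandf_reproducing y : (kapint * bandf y)%:E =
  (\int[mu]_t (vpk t * (2^-1 * (bandf (y - t) + bandf (y + t))))%:E)%E.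
Proof.
have E1 : (\int[mu]_t \int[m]_z (K y (t, z))%:E = \int[m]_z \int[mu]_t (K y (t, z))%:E)%E.
  exact: Fubini (intK y).
have L t : (\int[m]_z (K y (t, z))%:E = (vpk t * (2^-1 * (bandf (y - t) + bandf (y + t))))%:E)%E.
  have i1 s := Wcos (mcospr s) (fun z => cos_max _).
  pose f z := W z * (cos (2 * pi * t * pr z) * cos (2 * pi * y * pr z)).
  have i2 : m.-integrable setT (EFin \o f).
    apply: Wcos; first by apply: measurable_funM; exact: mcospr.
    by move=> z; rewrite normrM -(mulr1 1) ler_pM// cos_max.
  have -> : 2^-1 * (bandf (y - t) + bandf (y + t)) = \int[m]_z f z.
    rewrite /bandf -RintegralD// -RintegralZl//; last exact: integrableD_EFin.
    apply: eq_Rintegral => z _; rewrite /f.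
    have -> : 2 * pi * (y - t) * pr z = 2 * pi * y * pr z - 2 * pi * t * pr z by ring.
    have -> : 2 * pi * (y + t) * pr z = 2 * pi * y * pr z + 2 * pi * t * pr z by ring.
    by rewrite cosB cosD; field.
  by rewrite -RintegralZl// EFin_Rintegral//; exact: integrableZl_EFin.
under eq_integral do rewrite -L.
rewrite E1.
have Rr z : (\int[mu]_t (K y (t, z))%:E = (kapint * (W z * cos (2 * pi * y * pr z)))%:E)%E.
  have [W0|W0] := eqVneq (W z) 0.
    by rewrite W0 mul0r mulr0 integral0_eq// => t _; rewrite /K/= W0 mul0r mulr0.
  have iv : mu.-integrable setT (EFin \o (fun t => vpk t * cos (2 * pi * pr z * t))).
    apply: (le_integrable measurableT _ _ integrable_vpk).
      by apply/measurable_EFinP; apply: measurable_funM => //; exact: measurable_cosM.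
    by move=> t _ /=; rewrite lee_fin normrM ler_piMr// cos_max.
  rewrite -(integral_vpk (suppW W0)) mulrC -RintegralZl// EFin_Rintegral//; last exact: integrableZl_EFin.
  apply: eq_integral => t _; rewrite /K/=; congr EFin.
  have -> : 2 * pi * pr z * t = 2 * pi * t * pr z by ring.
  by ring.
under [RHS]eq_integral do rewrite Rr.
have i1 := Wcos (mcospr y) (fun z => cos_max _).
by rewrite /bandf -RintegralZl// EFin_Rintegral//; exact: integrableZl_EFin.
Qed.

Lemma bandf_le (Psi : R -> R) y : measurable_fun [set: R] bandf ->
  measurable_fun [set: R] Psi -> (forall t, Psi (- t) = Psi t) ->
  (forall t, `|vpk t| <= Psi t) ->
  ((kapint * `|bandf y|)%:E <= \int[mu]_t (Psi (y - t) * `|bandf t|)%:E)%E.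
Proof.
move=> mB mP eP hP; apply: (reproducing_le _ mvpk mB mP eP hP).
  exact: ltW kapint_gt0.
exact: bandf_reproducing.
Qed.

End band_limited.

End plancherel_polya.

(** * Summability on lattices *)

Section lattice.
Context {R : realType}.
Local Notation mu := (@lebesgue_measure R).
Local Notation leb2 := (@lebesgue_measure R \x @lebesgue_measure R)%E.

Lemma leb2_rect (a b c d : R) : a <= b -> c <= d ->
  leb2 (`[a, b] `*` `[c, d] : set (R * R)) = ((b - a) * (d - c))%:E.
Proof.
move=> ab cd; rewrite product_measure1E//.
have itvE (x y : R) : x <= y -> mu `[x, y] = (y - x)%:E.
  move=> xy; rewrite lebesgue_measure_itv/= lte_fin; case: ltP => h.
    by rewrite EFinB.
  by congr EFin; lra.
transitivity (mu `[a, b] * mu `[c, d])%E; first by [].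
by rewrite !itvE// -EFinM.
Qed.

Lemma sigma_finite_leb2 : sigma_finite [set: R * R] leb2.
Proof.
exists (fun n : nat => `[- n%:R, n%:R] `*` `[- n%:R, n%:R]).
  rewrite predeqE => -[x y]; split => // _.
  have := truncnS_gt (`|x| + `|y|); set n := (Num.trunc _).+1 => h.
  have x0 := normr_ge0 x; have y0 := normr_ge0 y.
  by exists n => //=; split; rewrite /= in_itv/= -ler_norml; lra.
move=> n; split; first by apply: measurableX; exact: measurable_itv.
by rewrite leb2_rect ?ltry// ge0_cp.
Qed.

(* A copy of the product measure on which the sigma-finite instance is found:
   the library declares it on products of subprobabilities first. *)
Definition plane_measure : set (measurableTypeR R * measurableTypeR R) -> \bar R := leb2.
HB.instance Definition _ := Measure.copy plane_measure leb2.
HB.instance Definition _ := Measure_isSigmaFinite.Build _ _ _ plane_measure sigma_finite_leb2.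

(** Each term is compared with an increment of [atan] over a step of length [lam], and these
    telescope; hence a bound independent of [u] and [n]. The increment is [lam / (1 + c ^ 2)] with
    [c] within [lam] of [x], and [1 + c ^ 2 <= 2 * (1 + lam ^ 2) * (1 + x ^ 2)] explains the
    constant [K]. *)
Lemma sum_oneDsqr_le (lam : R) : 0 < lam -> exists2 C : R, 0 <= C &
  forall (u : R) (n : nat), \sum_(0 <= k < n) (1 + (u - lam * k%:R) ^+ 2)^-1 <= C.
Proof.
move=> lam0; pose K : R := 2 * (1 + lam ^+ 2) / lam.
have K0 : 0 <= K by rewrite divr_ge0 ?mulr_ge0 ?addr_ge0 ?sqr_ge0 ?ltW.
exists (K * pi); first by rewrite mulr_ge0// ltW// pi_gt0.
have step (x : R) : (1 + x ^+ 2)^-1 <= K * (atan x - atan (x - lam)).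
  have xl : x - lam < x by rewrite gtrBl.
  have dat z : z \in `]x - lam, x[ -> is_derive z 1 (@atan R) (1 + z ^+ 2)^-1.
    by move=> _; exact: is_derive1_atan.
  have cat : {within `[x - lam, x], continuous (@atan R)}.
    by apply: continuous_subspaceT; exact: continuous_atan.
  have [c cx ->] := MVT xl dat cat.
  move: cx; rewrite in_itv/= => /andP[c1 c2].
  have p1 : 0 < 1 + x ^+ 2 by rewrite ltr_pwDl// sqr_ge0.
  have p2 : 0 < 1 + c ^+ 2 by rewrite ltr_pwDl// sqr_ge0.
  have -> : K * ((1 + c ^+ 2)^-1 * (x - (x - lam))) = 2 * (1 + lam ^+ 2) / (1 + c ^+ 2).
    by rewrite /K; field; rewrite (gt_eqF lam0) (gt_eqF p2).
  rewrite ler_pdivlMr// mulrC ler_pdivrMr//.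
  pose d := x - c.
  have -> : c = x - d by rewrite /d; ring.
  have d0 : 0 <= d by rewrite /d; lra.
  have dl : d <= lam by rewrite /d; lra.
  have dd : d ^+ 2 <= lam ^+ 2 by rewrite lerXn2r ?nnegrE// ltW.
  have : 0 <= (x + d) ^+ 2 by exact: sqr_ge0.
  have : 0 <= lam ^+ 2 * x ^+ 2 by rewrite mulr_ge0 ?sqr_ge0.
  lra.
move=> u n.
suff h : \sum_(0 <= k < n) (1 + (u - lam * k%:R) ^+ 2)^-1 <= K * (atan u - atan (u - lam * n%:R)).
  apply: (le_trans h); rewrite ler_wpM2l//.
  have := atan_ltpi2 u; have := atan_gtNpi2 (u - lam * n%:R); lra.
elim: n => [|n ih]; first by rewrite big_geq// mulr0 subr0 subrr mulr0.
rewrite big_nat_recr//=; have := step (u - lam * n%:R).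
have -> : u - lam * n%:R - lam = u - lam * n.+1%:R by rewrite -natr1; ring.
move: ih; lra.
Qed.

Section grid.

(** Being centred, it is stable under sign changes of a coordinate; having odd side, it is a
    complete residue system modulo [M.*2.+1] in each coordinate. *)
Definition grid (M : nat) : seq (int * int) :=
  [seq (i%:Z - M%:Z, j%:Z - M%:Z) | i <- iota 0 M.*2.+1, j <- iota 0 M.*2.+1].

Lemma grid_uniq M : uniq (grid M).
Proof.
apply: allpairs_uniq; [exact: iota_uniq|exact: iota_uniq|].
by move=> [i j] [i' j'] _ _ /= [] h1 h2; congr pair; lia.
Qed.

Lemma mem_grid M n : (n \in grid M) = (`|n.1| <= M)%N && (`|n.2| <= M)%N.
Proof.
apply/allpairsP/idP => [[[i j] [h1 h2 ->]]|].
  by move: h1 h2; rewrite !mem_iota/=; lia.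
case: n => n1 n2 h; exists (absz (n1 + M%:Z), absz (n2 + M%:Z)).
by split; rewrite ?mem_iota; move: h => /=; [lia|lia|move=> h; congr pair; lia].
Qed.

Lemma big_grid M (f : int * int -> R) : \sum_(n <- grid M) f n =
  \sum_(0 <= i < M.*2.+1) \sum_(0 <= j < M.*2.+1) f (i%:Z - M%:Z, j%:Z - M%:Z).
Proof. by rewrite /grid big_allpairs_dep /index_iota subn0. Qed.

Lemma fsum_grid M (f : int * int -> R) :
  \sum_(n \in [set` grid M]) f n = \sum_(n <- grid M) f n.
Proof. by rewrite -fsbig_seq// grid_uniq. Qed.

Lemma finite_grid (F : set (int * int)) : finite_set F -> exists M, F `<=` [set` grid M].
Proof.
move=> finF; exists (\sum_(n <- fset_set F) (`|n.1| + `|n.2|))%N => n Fn /=.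
have nF : n \in fset_set F by rewrite in_fset_set// inE.
rewrite mem_grid (big_fsetD1 n nF)/=; lia.
Qed.

Lemma fsum_grid_le (f : int * int -> R) (C : R) : (forall n, 0 <= f n) ->
  (forall M, \sum_(n <- grid M) f n <= C) ->
  forall F, finite_set F -> \sum_(n \in F) f n <= C.
Proof.
move=> f0 fC F finF; have [M FM] := finite_grid finF.
apply: le_trans (fC M); rewrite -fsum_grid; apply: ler_fsum_sub => //.
exact: finite_seq.
Qed.

End grid.

(** * From an integrable transform to summability on a planar lattice *)

Section lattice_sum.
Variables (w : R * R -> R) (intw : leb2.-integrable setT (EFin \o w)).
Hypothesis (suppw : forall z, w z != 0 -> `|z.1| <= 1 /\ `|z.2| <= 1).

(** For [w] even in each coordinate this is the Fourier transform of [w]. *)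
Definition cosft (y : R * R) : R :=
  \int[leb2]_z (w z * (cos (2 * pi * y.1 * z.1) * cos (2 * pi * y.2 * z.2))).

Hypothesis (intg : leb2.-integrable setT (EFin \o cosft)).

Let mg : measurable_fun [set: R * R] cosft.
Proof. by apply/measurable_EFinP; exact: (measurable_int leb2). Qed.

Let mg1 (v : R) : measurable_fun [set: R] (fun t => cosft (t, v)).
Proof. exact: (measurableT_comp mg (measurable_pair2 v)). Qed.

Let mg2 (u : R) : measurable_fun [set: R] (fun t => cosft (u, t)).
Proof. exact: (measurableT_comp mg (measurable_pair1 u)). Qed.

Let mc1 (c : R) : measurable_fun [set: R * R] (fun z : R * R => cos (c * z.1)).
Proof. exact: (measurableT_comp (measurable_cosM c) measurable_fst). Qed.

Let mc2 (c : R) : measurable_fun [set: R * R] (fun z : R * R => cos (c * z.2)).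
Proof. exact: (measurableT_comp (measurable_cosM c) measurable_snd). Qed.

Section kernel.
Variable Psi : R -> R.
Hypotheses (mP : measurable_fun [set: R] Psi) (eP : forall t, Psi (- t) = Psi t)
  (hP : forall t, `|vpk t| <= Psi t).

Lemma cosft_le1 y1 y2 :
  ((kapint * `|cosft (y1, y2)|)%:E <= \int[mu]_t (Psi (y1 - t) * `|cosft (t, y2)|)%:E)%E.
Proof.
pose W (z : R * R) := w z * cos (2 * pi * y2 * z.2).
have iW : leb2.-integrable setT (EFin \o W).
  exact: (integrable_mul_bounded measurableT intw (mc2 _) (fun z => cos_max _)).
have sW z : W z != 0 -> `|z.1| <= 1.
  by rewrite /W mulf_eq0 negb_or => /andP[/suppw[]].
have := @bandf_le R _ _ plane_measure W fst iW measurable_fst sW Psi y1.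
rewrite (_ : bandf _ _ _ = (fun t => cosft (t, y2))); first by apply.
by apply/funext => t; apply: eq_Rintegral => z _; rewrite /W/=; ring.
Qed.

Lemma cosft_le2 y1 y2 :
  ((kapint * `|cosft (y1, y2)|)%:E <= \int[mu]_t (Psi (y2 - t) * `|cosft (y1, t)|)%:E)%E.
Proof.
pose W (z : R * R) := w z * cos (2 * pi * y1 * z.1).
have iW : leb2.-integrable setT (EFin \o W).
  exact: (integrable_mul_bounded measurableT intw (mc1 _) (fun z => cos_max _)).
have sW z : W z != 0 -> `|z.2| <= 1.
  by rewrite /W mulf_eq0 negb_or => /andP[/suppw[]].
have := @bandf_le R _ _ plane_measure W snd iW measurable_snd sW Psi y2.
rewrite (_ : bandf _ _ _ = (fun t => cosft (y1, t))); first by apply.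
by apply/funext => t; apply: eq_Rintegral => z _; rewrite /W/=; ring.
Qed.

Variables (lam C : R) (C0 : 0 <= C).
Hypotheses (P0 : forall t, 0 <= Psi t)
  (PC : forall (u : R) (n : nat), \sum_(0 <= k < n) Psi (u - lam * k%:R) <= C).

Let sum_conv (h : R -> R) u n : measurable_fun [set: R] h ->
  (\sum_(0 <= k < n) \int[mu]_t (Psi (u - lam * k%:R - t) * `|h t|)%:E <=
   C%:E * \int[mu]_t `|h t|%:E)%E.
Proof.
move=> mh.
have mPh k : measurable_fun [set: R] (fun t => (Psi (u - lam * k%:R - t) * `|h t|)%:E).
  apply/measurable_EFinP/measurable_funM; last exact: measurableT_comp.
  by apply: (measurableT_comp mP); exact: measurable_funB.
have mha : measurable_fun [set: R] (fun t => `|h t|%:E).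
  by apply/measurable_EFinP; exact: measurableT_comp.
rewrite -ge0_integral_sum//; last by move=> k t _; rewrite lee_fin mulr_ge0.
rewrite -ge0_integralZl//.
apply: ge0_le_integral => //.
- by move=> t _; apply: sume_ge0 => k _; rewrite lee_fin mulr_ge0.
- exact: emeasurable_sum.
- exact: measurable_funeM.
move=> t _; rewrite sumEFin -EFinM lee_fin -mulr_suml ler_wpM2r//.
apply: le_trans (PC (u - t) n); rewrite le_eqVlt; apply/orP; left; apply/eqP.
by apply: eq_bigr => k _; congr Psi; ring.
Qed.

(** Extended values are essential: the integral along a single line could a priori be infinite, and
    only the sums over parallel lines are controlled by the planar integral. *)
Let H (v : R) : \bar R := (\int[mu]_t `|cosft (t, v)|%:E)%E.

Let sum1 u v n :
  ((kapint * \sum_(0 <= k < n) `|cosft (u - lam * k%:R, v)|)%:E <= C%:E * H v)%E.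
Proof.
apply: le_trans (sum_conv u n (mg1 v)).
rewrite mulr_sumr -sumEFin; apply: lee_sum => k _; exact: cosft_le1.
Qed.

Let kap0 : 0 <= kapint :> R. Proof. exact: ltW kapint_gt0. Qed.

Let sum2 v n : (kapint%:E * \sum_(0 <= k < n) H (v - lam * k%:R) <=
  C%:E * \int[leb2]_z `|cosft z|%:E)%E.
Proof.
have mha z : measurable_fun [set: R] (fun t => `|cosft (t, z)|%:E).
  by apply/measurable_EFinP; exact: measurableT_comp.
have mga : measurable_fun [set: R * R] (fun z => `|cosft z|%:E).
  by apply/measurable_EFinP; exact: measurableT_comp.
pose G (t : R) : \bar R := (\int[mu]_s `|cosft (t, s)|%:E)%E.
have mG : measurable_fun [set: R] G.
  exact: (@measurable_fun_partial_integral _ setT (fun z => `|cosft z|%:E)%E).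
have -> : (\int[leb2]_z `|cosft z|%:E = \int[mu]_t G t)%E.
  exact: (@fubini_tonelli1 _ _ _ _ _ mu mu (fun z => `|cosft z|%:E)).
have ms : measurable_fun [set: R] (fun t => \sum_(0 <= k < n) `|cosft (t, v - lam * k%:R)|%:E)%E.
  exact: emeasurable_sum.
have -> : (\sum_(0 <= k < n) H (v - lam * k%:R) =
    \int[mu]_t \sum_(0 <= k < n) `|cosft (t, v - lam * k%:R)|%:E)%E.
  transitivity (\sum_(0 <= k < n) \int[mu]_t `|cosft (t, v - lam * k%:R)|%:E)%E; first by [].
  by rewrite -ge0_integral_sum// => k; exact: mha.
rewrite -ge0_integralZl//; last by move=> t _; exact: sume_ge0.
rewrite -ge0_integralZl//; last by move=> t _; exact: integral_ge0.
apply: ge0_le_integral => //.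
- by move=> t _; rewrite mule_ge0 ?lee_fin// sume_ge0.
- exact: measurable_funeM.
- exact: measurable_funeM.
move=> t _; apply: le_trans (sum_conv v n (mg2 t)).
rewrite ge0_sume_distrr//; apply: lee_sum => k _; rewrite -EFinM; exact: cosft_le2.
Qed.

(** The kernel acts on one variable at a time: sums along rows are bounded by line integrals, and
    the sum of these by the planar integral. Each variable costs one factor [C] and one factor
    [kapint]. *)
Lemma lattice_sum_le u v n : kapint ^+ 2 *
  \sum_(0 <= i < n) \sum_(0 <= j < n) `|cosft (u - lam * i%:R, v - lam * j%:R)| <=
  C ^+ 2 * \int[leb2]_z `|cosft z|.
Proof.
have ia : leb2.-integrable setT (EFin \o (fun z => `|cosft z|)) by exact: (integrable_abse intg).
have H0 s : (0 <= H s)%E by exact: integral_ge0.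
rewrite -lee_fin EFinM [leRHS]EFinM EFin_Rintegral// exchange_big/= expr2 EFinM -muleA.
apply: (@le_trans _ _ (kapint%:E * \sum_(0 <= k < n) (C%:E * H (v - lam * k%:R)))%E).
  rewrite lee_wpmul2l ?lee_fin// -EFinM mulr_sumr -sumEFin.
  by apply: lee_sum => k _; exact: sum1.
rewrite -ge0_sume_distrr// muleCA expr2 EFinM -muleA.
by apply: lee_wpmul2l; [rewrite lee_fin|exact: sum2].
Qed.

End kernel.

(* Plancherel-Polya: [cosft] is reproduced by an integrable kernel. *)
Lemma cosft_lattice_summable (lam : R) (x : R * R) : 0 < lam -> exists C : R,
  forall F : set (int * int), finite_set F ->
  \sum_(n \in F) `|cosft (x.1 - lam * n.1%:~R, x.2 - lam * n.2%:~R)| <= C.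
Proof.
move=> lam0; have [M [M0 hM]] := @vpk_le R; have [C C0 hC] := sum_oneDsqr_le lam0.
pose Psi (t : R) : R := M / (1 + t ^+ 2).
have mPsi : measurable_fun [set: R] Psi.
  apply: measurable_funM => //.
  exact: (continuous_measurable_fun (@continuous_oneDsqrV R)).
have Psi0 t : 0 <= Psi t by rewrite divr_ge0// addr_ge0// sqr_ge0.
have PC (u : R) (n : nat) : \sum_(0 <= k < n) Psi (u - lam * k%:R) <= M * C.
  by rewrite /Psi -mulr_sumr ler_wpM2l.
have PsiN t : Psi (- t) = Psi t by rewrite /Psi sqrrN.
have k0 : 0 < kapint ^+ 2 :> R by rewrite exprn_gt0// kapint_gt0.
exists ((kapint ^+ 2)^-1 * ((M * C) ^+ 2 * \int[leb2]_z `|cosft z|)).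
apply: fsum_grid_le => // N; rewrite ler_pdivlMl// big_grid.
(* Starting at [x + lam * N] makes the naturals up to [2 * N] run over the centred indices of the
   grid. *)
have := lattice_sum_le mPsi PsiN hM (mulr_ge0 M0 C0) Psi0 PC
  (x.1 + lam * N%:R) (x.2 + lam * N%:R) N.*2.+1.
apply: le_trans; rewrite ler_pM2l// le_eqVlt; apply/orP; left; apply/eqP.
have E (c : R) (k : nat) : c + lam * N%:R - lam * k%:R = c - lam * (k%:Z - N%:Z)%:~R.
  by rewrite intrB -!pmulrn; ring.
by apply: eq_bigr => i _; apply: eq_bigr => j _; rewrite !E.
Qed.

End lattice_sum.

End lattice.

(** * Fourier cosine series in two variables *)

Section cosine_expansion.
Context {R : realType}.
Local Notation mu := (@lebesgue_measure R).
Local Notation leb2 := (@lebesgue_measure R \x @lebesgue_measure R)%E.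

Lemma cos_lip (x y : R) : `|cos x - cos y| <= `|x - y|.
Proof.
have E : cos x - cos y = - (2 * sin ((x + y) / 2) * sin ((x - y) / 2)).
  rewrite {1}(_ : x = (x + y) / 2 + (x - y) / 2); last by field.
  rewrite {3}(_ : y = (x + y) / 2 - (x - y) / 2); last by field.
  rewrite cosD cosB; ring.
rewrite E normrN !normrM (ger0_norm (_ : 0 <= 2))//.
have h1 := sin_max ((x + y) / 2); have h2 := sin_norm_le ((x - y) / 2).
rewrite normrM (ger0_norm (_ : 0 <= 2^-1)) ?invr_ge0// in h2.
have h3 := normr_ge0 (sin ((x - y) / 2)); have h4 := ler_piMl h3 h1.
rewrite -mulrA; lra.
Qed.

Lemma sin_intpi (n : int) : sin (n%:~R * pi) = 0 :> R.
Proof.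
have nat k : sin (k%:R * pi) = 0 :> R.
  elim: k => [|k ih]; first by rewrite mul0r sin0.
  by rewrite -natr1 mulrDl mul1r sinDpi ih oppr0.
case: (intP n) => [|k|k]; first by rewrite mul0r sin0.
- by rewrite -pmulrn nat.
- by rewrite mulrNz -pmulrn mulNr sinN nat oppr0.
Qed.

Lemma Rintegral_prodM (f g : R -> R) : mu.-integrable setT (EFin \o f) ->
  mu.-integrable setT (EFin \o g) ->
  leb2.-integrable setT (EFin \o (fun z => f z.1 * g z.2)) /\
  \int[leb2]_z (f z.1 * g z.2) = (\int[mu]_x f x) * (\int[mu]_x g x).
Proof.
move=> intf intg.
have mf : measurable_fun [set: R] f by apply/measurable_EFinP; exact: (measurable_int mu).
have mg : measurable_fun [set: R] g by apply/measurable_EFinP; exact: (measurable_int mu).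
have mfg : measurable_fun [set: R * R] (fun z => (f z.1 * g z.2)%:E).
  apply/measurable_EFinP/measurable_funM.
    exact: (measurableT_comp mf measurable_fst).
  exact: (measurableT_comp mg measurable_snd).
have finf : (\int[mu]_x (f x)%:E)%E \is a fin_num by exact: (integrable_fin_num _ intf).
have fing : (\int[mu]_x (g x)%:E)%E \is a fin_num by exact: (integrable_fin_num _ intg).
have maf : measurable_fun [set: R] (fun x => `|(f x)%:E|)%E.
  by apply/measurable_EFinP; exact: measurableT_comp.
have mag : measurable_fun [set: R] (fun x => `|(g x)%:E|)%E.
  by apply/measurable_EFinP; exact: measurableT_comp.
have int2 : leb2.-integrable setT (fun z => (f z.1 * g z.2)%:E).
  apply: (proj2 (@integrable12ltyP _ _ _ _ _ mu mu _ mfg)).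
  have [_ lf] := integrableP _ _ _ intf; have [_ lg] := integrableP _ _ _ intg.
  rewrite (_ : (\int[mu]_x _)%E = (\int[mu]_x (`|(f x)%:E| * \int[mu]_y `|(g y)%:E|))%E).
    rewrite ge0_integralZr//; last exact: integral_ge0.
    by rewrite lte_mul_pinfty// ?integral_ge0// ge0_fin_numE// integral_ge0.
  apply: eq_integral => x _; rewrite -ge0_integralZl//.
  by apply: eq_integral => y _; rewrite /= normrM EFinM.
split; first exact: int2.
rewrite /Rintegral -(integral12_prod_meas1 int2) -fineM//; congr fine.
rewrite -[in RHS](fineK fing) -integralZr//; apply: eq_integral => x _.
rewrite fineK// /fubini_F /= -integralZl//.
Qed.

Lemma Rintegral_seq_sum d (T : measurableType d) (m : {measure set T -> \bar R})
    (Q : set T) (I : Type) (r : seq I) (f : I -> T -> R) : measurable Q ->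
  (forall i, m.-integrable Q (EFin \o f i)) ->
  m.-integrable Q (EFin \o (fun z => \sum_(i <- r) f i z)) /\
  \int[m]_(z in Q) (\sum_(i <- r) f i z) = \sum_(i <- r) \int[m]_(z in Q) f i z.
Proof.
move=> mQ intf; elim: r => [|i r [ih1 ih2]].
  have -> : (fun z => \sum_(i <- [::]) f i z) = cst 0.
    by apply/funext => z; rewrite big_nil.
  rewrite big_nil; split; first exact: integrable0.
  by rewrite /Rintegral integral0.
have -> : (fun z => \sum_(j <- i :: r) f j z) = (fun z => f i z + \sum_(j <- r) f j z).
  by apply/funext => z; rewrite big_cons.
rewrite big_cons; split; first exact: (integrableD _ (intf i) ih1).
by rewrite RintegralD// ih2.
Qed.

(** * Functions on a square orthogonal to all cosines *)

Section cosine_uniqueness.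
Variables (a : R) (a0 : 0 < a).
Let L : R := pi / a.
Let I : set R := `[- L, L].
Let Q : set (R * R) := I `*` I.

Let mI : measurable I. Proof. exact: measurable_itv. Qed.
Let mQ : measurable Q. Proof. exact: measurableX. Qed.

(** Integer indices let multiplication by [cos (a * z.1)] shift [j] by one in both directions
    without a boundary case at 0. The price is that a function may be listed four times. *)
Definition cos2 (j k : int) (z : R * R) : R :=
  cos (j%:~R * a * z.1) * cos (k%:~R * a * z.2).

Lemma measurable_cosM1 (c : R) : measurable_fun [set: R * R] (fun z : R * R => cos (c * z.1)).
Proof. exact: (measurableT_comp (measurable_cosM c) measurable_fst). Qed.

Lemma measurable_cosM2 (c : R) : measurable_fun [set: R * R] (fun z : R * R => cos (c * z.2)).
Proof. exact: (measurableT_comp (measurable_cosM c) measurable_snd). Qed.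

Lemma measurable_cos2 j k : measurable_fun [set: R * R] (cos2 j k).
Proof. by apply: measurable_funM; [exact: measurable_cosM1|exact: measurable_cosM2]. Qed.

Lemma cos2_max j k z : `|cos2 j k z| <= 1.
Proof. by rewrite /cos2 normrM -(mulr1 1) ler_pM// cos_max. Qed.

Let muQ : (leb2 Q < +oo)%E.
Proof.
have L0 : 0 < L by rewrite divr_gt0 ?pi_gt0.
by rewrite /Q /I leb2_rect ?ltry//; lra.
Qed.

Let intQM (f g : R * R -> R) (M : R) : leb2.-integrable Q (EFin \o f) ->
  measurable_fun [set: R * R] g -> (forall z, `|g z| <= M) ->
  leb2.-integrable Q (EFin \o (fun z => f z * g z)).
Proof. by move=> fi mg gM; apply: (@integrable_mul_bounded _ _ _ _ _ _ _ _ M). Qed.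

Let intQB (f g : R * R -> R) : leb2.-integrable Q (EFin \o f) ->
  leb2.-integrable Q (EFin \o g) -> leb2.-integrable Q (EFin \o (fun z => f z - g z)).
Proof. by move=> fi gi; exact: integrableB_EFin. Qed.

Let intc (g : R * R -> R) (M : R) : measurable_fun [set: R * R] g ->
  (forall z, `|g z| <= M) -> leb2.-integrable Q (EFin \o g).
Proof.
move=> mg gM; have i1 : leb2.-integrable Q (EFin \o cst (1 : R)).
  apply/integrableP; split; first by apply/measurable_EFinP; exact: measurable_cst.
  rewrite (_ : (\int[leb2]_(x in Q) _)%E = (\int[leb2]_(x in Q) 1%:E)%E); last first.
    by apply: eq_integral => z _ /=; rewrite normr1.
  by rewrite integral_cst// mul1e.
have := intQM i1 mg gM.
by congr (leb2.-integrable Q _); apply/funext => z /=; rewrite mul1r.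
Qed.

Section ortho.
Variables (D : R * R -> R) (intD : leb2.-integrable Q (EFin \o D)).

(** Orthogonality of [D * phi] to the whole family, rather than of [D] to [phi], is the form that
    survives multiplication of [phi] by a cosine. *)
Definition orth (phi : R * R -> R) :=
  [/\ measurable_fun [set: R * R] phi, exists M : R, forall z, `|phi z| <= M &
      forall j k, \int[leb2]_(z in Q) (D z * (phi z * cos2 j k z)) = 0].

Lemma orth_integrable (phi : R * R -> R) j k : measurable_fun [set: R * R] phi ->
  (exists M : R, forall z, `|phi z| <= M) ->
  leb2.-integrable Q (EFin \o (fun z => D z * (phi z * cos2 j k z))).
Proof.
move=> mphi [M hM]; apply: (@integrable_mul_bounded _ _ _ _ _ _ _ _ M) => //.
  by apply: measurable_funM => //; exact: measurable_cos2.
by move=> z; rewrite normrM (le_trans _ (hM z))// ler_piMr// cos2_max.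
Qed.

Lemma orth_lin (al be : R) phi psi : orth phi -> orth psi ->
  orth (fun z => al * phi z + be * psi z).
Proof.
move=> [m1 b1 h1] [m2 b2 h2]; split.
- by apply: measurable_funD; exact: measurable_funM.
- case: b1 b2 => [M1 b1] [M2 b2]; exists (`|al| * M1 + `|be| * M2) => z.
  by rewrite (le_trans (ler_normD _ _))// !normrM lerD// ler_wpM2l.
- move=> j k.
  have i1 := orth_integrable j k m1 b1; have i2 := orth_integrable j k m2 b2.
  under eq_Rintegral => z _.
    rewrite (_ : _ * _ = al * (D z * (phi z * cos2 j k z)) + be * (D z * (psi z * cos2 j k z))); last by ring.
    over.
  rewrite RintegralD//; [|exact: integrableZl_EFin|exact: integrableZl_EFin].
  by rewrite !RintegralZl// h1 h2 !mulr0 addr0.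
Qed.

Lemma orth_cos1 phi : orth phi -> orth (fun z => cos (a * z.1) * phi z).
Proof.
move=> [m1 [M b1] h1]; split.
- by apply: measurable_funM => //; exact: measurable_cosM1.
- by exists M => z; rewrite normrM (le_trans _ (b1 z))// ler_piMl// cos_max.
- move=> j k.
  have bb : exists M : R, forall z, `|phi z| <= M by exists M.
  have i1 := orth_integrable (j + 1) k m1 bb; have i2 := orth_integrable (j - 1) k m1 bb.
  have E z : D z * (cos (a * z.1) * phi z * cos2 j k z) =
    2^-1 * (D z * (phi z * cos2 (j + 1) k z) + D z * (phi z * cos2 (j - 1) k z)).
    rewrite /cos2 intrD intrB.
    have -> : (j%:~R + 1%:~R) * a * z.1 = j%:~R * a * z.1 + a * z.1 by ring.
    have -> : (j%:~R - 1%:~R) * a * z.1 = j%:~R * a * z.1 - a * z.1 by ring.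
    by rewrite cosD cosB; field.
  under eq_Rintegral do rewrite E.
  rewrite RintegralZl//; last exact: (integrableD _ i1 i2).
  by rewrite RintegralD// !h1 addr0 mulr0.
Qed.

Lemma orth_cos2 phi : orth phi -> orth (fun z => cos (a * z.2) * phi z).
Proof.
move=> [m1 [M b1] h1]; split.
- by apply: measurable_funM => //; exact: measurable_cosM2.
- by exists M => z; rewrite normrM (le_trans _ (b1 z))// ler_piMl// cos_max.
- move=> j k.
  have bb : exists M : R, forall z, `|phi z| <= M by exists M.
  have i1 := orth_integrable j (k + 1) m1 bb; have i2 := orth_integrable j (k - 1) m1 bb.
  have E z : D z * (cos (a * z.2) * phi z * cos2 j k z) =
    2^-1 * (D z * (phi z * cos2 j (k + 1) z) + D z * (phi z * cos2 j (k - 1) z)).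
    rewrite /cos2 intrD intrB.
    have -> : (k%:~R + 1%:~R) * a * z.2 = k%:~R * a * z.2 + a * z.2 by ring.
    have -> : (k%:~R - 1%:~R) * a * z.2 = k%:~R * a * z.2 - a * z.2 by ring.
    by rewrite cosD cosB; field.
  under eq_Rintegral do rewrite E.
  rewrite RintegralZl//; last exact: (integrableD _ i1 i2).
  by rewrite RintegralD// !h1 addr0 mulr0.
Qed.

Variables (z0 : R * R).
(** On the square the maximum 1 is attained only at the points that agree with [z0] up to the signs
    of coordinates. Each squared difference is at most 4, so the factor 1/8 keeps the values in
    [[0, 1]]. *)
Definition peak (z : R * R) : R :=
  1 - (cos (a * z.1) - cos (a * z0.1)) ^+ 2 / 8 - (cos (a * z.2) - cos (a * z0.2)) ^+ 2 / 8.

Lemma orth_peak phi : orth phi -> orth (fun z => peak z * phi z).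
Proof.
move=> o; have o1 := orth_cos1 o; have o2 := orth_cos2 o.
have o11 := orth_cos1 o1; have o22 := orth_cos2 o2.
set u := cos (a * z0.1); set v := cos (a * z0.2).
have := orth_lin (1 - u ^+ 2 / 8 - v ^+ 2 / 8) 1 o
  (orth_lin (u / 4) 1 o1 (orth_lin (v / 4) 1 o2 (orth_lin (- 8^-1) (- 8^-1) o11 o22))).
congr orth; apply/funext => z; by rewrite /peak -/u -/v; field.
Qed.

Lemma orth_peakX N : (forall j k, \int[leb2]_(z in Q) (D z * cos2 j k z) = 0) ->
  orth (fun z => peak z ^+ N).
Proof.
move=> h; elim: N => [|N ih].
  split; first by under eq_fun do rewrite expr0; exact: measurable_cst.
    by exists 1 => z; rewrite expr0 normr1.
  by move=> j k; under eq_Rintegral do rewrite expr0 mul1r.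
by under eq_fun do rewrite exprS; exact: orth_peak.
Qed.

Lemma peak_ge0 z : 0 <= peak z.
Proof.
have h (c d : R) : -1 <= c -> c <= 1 -> -1 <= d -> d <= 1 -> (c - d) ^+ 2 <= 4.
  move=> *; have : 0 <= (2 - (c - d)) * (2 + (c - d)) by apply: mulr_ge0; lra.
  lra.
have h1 := h _ _ (cos_geN1 (a * z.1)) (cos_le1 _) (cos_geN1 (a * z0.1)) (cos_le1 _).
have h2 := h _ _ (cos_geN1 (a * z.2)) (cos_le1 _) (cos_geN1 (a * z0.2)) (cos_le1 _).
rewrite /peak; lra.
Qed.

(** A cosine determines [u] only up to sign, hence the inner absolute value. On [[0, L]] it
    decreases strictly, so [r] can be read off at [u0 - d] and [u0 + d], where [d] is small enough
    for both to stay in that interval. *)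
Lemma cos_near (u0 del : R) : 0 < u0 < L -> 0 < del ->
  exists2 r : R, 0 < r & forall u : R, `|u| <= L -> `|cos (a * u) - cos (a * u0)| < r ->
    `| `|u| - u0| < del.
Proof.
move=> /andP[u00 u0L] del0.
pose d := Num.min del (Num.min u0 (L - u0)).
have d0 : 0 < d by rewrite !lt_min del0 u00 subr_gt0.
have dd : d <= del by rewrite ge_min lexx.
have du : d <= u0 by rewrite !ge_min lexx !orbT.
have dL : d <= L - u0 by rewrite !ge_min lexx !orbT.
have aL : a * L = pi by rewrite /L mulrC divfK// gt_eqF.
have inI x : 0 <= x <= L -> a * x \in `[0, pi].
  by move=> /andP[x0 xL]; rewrite in_itv/= (mulr_ge0 (ltW a0) x0)/= -aL ler_pM2l.
have mono x y : 0 <= x <= L -> 0 <= y <= L -> (cos (a * x) < cos (a * y)) = (y < x).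
  by move=> hx hy; rewrite ltr_cos ?inI// ltr_pM2l.
have i1 : 0 <= u0 - d <= L by lra.
have i2 : 0 <= u0 + d <= L by lra.
have i3 : 0 <= u0 <= L by lra.
pose r := Num.min (cos (a * (u0 - d)) - cos (a * u0)) (cos (a * u0) - cos (a * (u0 + d))).
exists r.
  by rewrite lt_min !subr_gt0 !mono//; lra.
move=> u uL h.
have i4 : 0 <= `|u| <= L by rewrite normr_ge0.
have E : cos (a * `|u|) = cos (a * u) by rewrite -[in LHS](gtr0_norm a0) -normrM cos_norm.
move: h; rewrite ltr_norml -E => /andP[h1 h2].
have r1 : r <= cos (a * (u0 - d)) - cos (a * u0) by rewrite ge_min lexx.
have r2 : r <= cos (a * u0) - cos (a * (u0 + d)) by rewrite ge_min lexx orbT.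
have : cos (a * (u0 + d)) < cos (a * `|u|) by lra.
have : cos (a * `|u|) < cos (a * (u0 - d)) by lra.
rewrite !mono// => g1 g2; rewrite ltr_norml; lra.
Qed.

Hypothesis (D_orth : forall j k, \int[leb2]_(z in Q) (D z * cos2 j k z) = 0).
Hypotheses (D_even1 : forall u v, D (- u, v) = D (u, v))
  (D_even2 : forall u v, D (u, - v) = D (u, v)).
Hypotheses (z01 : 0 < z0.1 < L) (z02 : 0 < z0.2 < L).
Hypothesis D_cont : forall e : R, 0 < e -> exists2 del : R, 0 < del &
  forall z : R * R, `|z.1 - z0.1| < del -> `|z.2 - z0.2| < del -> `|D z - D z0| < e.

Let D_abs z : D z = D (`|z.1|, `|z.2|).
Proof.
by case: z => u v /=; case: (ger0P u) => _; case: (ger0P v) => _; rewrite ?D_even1 ?D_even2.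
Qed.

(** If [D z0] were positive, [D] would exceed [e] wherever the peak is close to 1, by evenness also
    at the mirror images of [z0]. In the vanishing integral of [D * peak ^ n], the negative part is
    then at most of order [q1 ^ n], against a positive part at least of order [q2 ^ n]. *)
Lemma orth_le0 : D z0 <= 0.
Proof.
rewrite leNgt; apply/negP => Dz0.
have e0 : 0 < D z0 / 2 by rewrite divr_gt0.
set e := D z0 / 2 in e0.
have [del del0 hD] := D_cont e0.
have near_pos z : `|z.1 - z0.1| < del -> `|z.2 - z0.2| < del -> e < D z.
  by move=> h1 h2; have := hD z h1 h2; rewrite ltr_norml /e; lra.
have [r1 r10 h1] := cos_near z01 del0; have [r2 r20 h2] := cos_near z02 del0.
pose r := Num.min 1 (Num.min r1 r2).
have r0 : 0 < r by rewrite !lt_min ltr01 r10.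
have rr1 : r <= r1 by rewrite !ge_min lexx !orbT.
have rr2 : r <= r2 by rewrite !ge_min lexx !orbT.
have rle1 : r <= 1 by rewrite ge_min lexx.
(* If [peak z > 1 - eta], each squared difference of cosines is below [8 * eta = r ^ 2], so
   [cos_near] applies in both coordinates. *)
pose eta := r ^+ 2 / 8.
have eta0 : 0 < eta by rewrite divr_gt0// exprn_gt0.
have eta1 : eta < 1.
  have : r ^+ 2 <= 1 by rewrite exprn_ile1// ltW.
  rewrite /eta; lra.
have Upos z : Q z -> 1 - eta < peak z -> e < D z.
  case: z => u v [/=]; rewrite /I/= !in_itv/= -!ler_norml => uL vL hp.
  have sq x : x ^+ 2 / 8 < eta -> `|x| < r.
    rewrite /eta ltr_pM2r ?invr_gt0// -(real_normK (num_real x)) => hx.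
    by move: hx; rewrite ltr_pXn2r// nnegrE ltW.
  have s1 := sqr_ge0 (cos (a * u) - cos (a * z0.1)).
  have s2 := sqr_ge0 (cos (a * v) - cos (a * z0.2)).
  move: hp; rewrite /peak/= => hp.
  rewrite D_abs; apply: near_pos => /=.
    by apply: h1 => //; apply: lt_le_trans rr1; apply: sq; lra.
  by apply: h2 => //; apply: lt_le_trans rr2; apply: sq; lra.
(* The first four terms keep the box inside the square and [del / 2] keeps it near [z0]. With
   [eta / a] the cosines vary by at most [eta < 1], so the peak is at least [1 - eta / 4] on the
   box. *)
pose ep := Num.min (Num.min (z0.1) (L - z0.1)) (Num.min (Num.min (z0.2) (L - z0.2))
   (Num.min (del / 2) (eta / a))).
have ep0 : 0 < ep.
  case/andP: z01 => A1 A2; case/andP: z02 => A3 A4.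
  have d1 : 0 < del / 2 by rewrite divr_gt0.
  have d2 : 0 < eta / a by rewrite divr_gt0.
  by rewrite !lt_min !subr_gt0 A1 A2 A3 A4 d1 d2.
have ep1 : ep <= z0.1 by rewrite !ge_min lexx.
have ep2 : ep <= L - z0.1 by rewrite !ge_min lexx !orbT.
have ep3 : ep <= z0.2 by rewrite !ge_min lexx !orbT.
have ep4 : ep <= L - z0.2 by rewrite !ge_min lexx !orbT.
have ep5 : ep <= del / 2 by rewrite !ge_min lexx !orbT.
have ep6 : ep <= eta / a by rewrite !ge_min lexx !orbT.
pose B : set (R * R) := `[z0.1 - ep, z0.1 + ep] `*` `[z0.2 - ep, z0.2 + ep].
have mB : measurable B by apply: measurableX; exact: measurable_itv.
have BP z : B z -> [/\ Q z, 1 - eta / 2 < peak z & e < D z].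
  case: z => u v [/=]; rewrite !in_itv/= => hu hv; split.
  - by split; rewrite /I/= in_itv/=; lra.
  - have lip x x0 : x0 - ep <= x <= x0 + ep -> (cos (a * x) - cos (a * x0)) ^+ 2 <= eta.
      move=> hx; rewrite -(real_normK (num_real _)).
      have h : `|cos (a * x) - cos (a * x0)| <= eta.
        apply: (le_trans (cos_lip _ _)); rewrite -mulrBr normrM gtr0_norm//.
        rewrite mulrC -ler_pdivlMr//; apply: le_trans ep6.
        by rewrite ler_norml; lra.
      rewrite expr2; apply: le_trans (ler_pM _ _ h h) _ => //.
      by rewrite ler_piMl ?ltW.
    have := lip _ _ hu; have := lip _ _ hv; rewrite /peak/=; lra.
  - by apply: near_pos => /=; rewrite ltr_norml; lra.
have muB : leb2 B = ((2 * ep) ^+ 2)%:E.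
  rewrite /B leb2_rect; [congr EFin; ring|lra|lra].
(* [q2] bounds the peak from below on the box [B], and [q1] bounds it from above wherever [D] can be
   negative; the gap decides for large powers. *)
pose q1 := 1 - eta; pose q2 := 1 - eta / 2.
have q10 : 0 < q1 by rewrite subr_gt0.
have q20 : 0 < q2 by rewrite /q2; lra.
have q12 : q1 < q2 by rewrite /q1 /q2; lra.
pose M := \int[leb2]_(z in Q) `|D z|.
have intaD : leb2.-integrable Q (EFin \o (fun z => `|D z|)).
  exact: (integrable_abse intD).
have i1B : leb2.-integrable Q (EFin \o \1_B).
  apply: (@intc _ 1); first exact: measurable_indic.
  by move=> z; rewrite indicE; case: (z \in B); rewrite ?normr1 ?normr0.
have key n : e * q2 ^+ n * (2 * ep) ^+ 2 <= q1 ^+ n * M.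
  have [mP bP hP] := orth_peakX n D_orth.
  have i0 := orth_integrable 0 0 mP bP.
  have E0 : cos2 0 0 = cst 1 by apply/funext => z; rewrite /cos2 !mul0r cos0 mulr1.
  have i1 : leb2.-integrable Q (EFin \o (fun z => (e * q2 ^+ n) * \1_B z)).
    exact: integrableZl_EFin.
  have i2 : leb2.-integrable Q (EFin \o (fun z => q1 ^+ n * `|D z|)).
    exact: integrableZl_EFin.
  have : \int[leb2]_(z in Q) (e * q2 ^+ n * \1_B z - q1 ^+ n * `|D z|) <=
         \int[leb2]_(z in Q) (D z * (peak z ^+ n * cos2 0 0 z)).
    apply: le_Rintegral => //; first exact: (integrableB _ i1 i2).
    move=> z Qz; rewrite E0 mulr1.
    have P0 := peak_ge0 z.
    have D0 := normr_ge0 (D z).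
    have [Bz|nBz] := pselect (B z).
      have [_ hp hd] := BP _ Bz; rewrite indicE mem_set// mulr1.
      apply: (@le_trans _ _ (e * q2 ^+ n)).
        by rewrite gerBl mulr_ge0// exprn_ge0 ?ltW.
      have pq : q2 ^+ n <= peak z ^+ n.
        by apply: lerXn2r; rewrite ?nnegrE; [exact: ltW|exact: P0|exact: ltW].
      apply: ler_pM => //; [exact: ltW e0|by rewrite exprn_ge0// ltW|exact: ltW hd].
    rewrite indicE memNset// mulr0 sub0r.
    have [hp|hp] := ltP q1 (peak z).
      have hd := Upos _ Qz hp.
      apply: (@le_trans _ _ 0); first by rewrite oppr_le0 mulr_ge0// exprn_ge0 ?ltW.
      by rewrite mulr_ge0 ?exprn_ge0// ltW// (lt_trans e0).
    rewrite lerNl; apply: (le_trans (ler_norm _)).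
    rewrite normrN normrM mulrC ler_wpM2r// ger0_norm ?exprn_ge0//.
    by apply: lerXn2r; rewrite ?nnegrE; [exact: P0|exact: ltW|exact: hp].
  rewrite hP RintegralB//.
  have iB : leb2.-integrable Q (EFin \o \1_B).
    exact: i1B.
  rewrite (RintegralZl _ _ iB)// (RintegralZl _ _ intaD)// -/M.
  rewrite (_ : \int[leb2]_(z in Q) \1_B z = (2 * ep) ^+ 2) ?subr_le0//.
  rewrite /Rintegral integral_indic//= setIidl ?muB//.
  by move=> z /BP[].
have M0 : 0 <= M by apply: Rintegral_ge0.
pose x := q1 / q2.
have x1 : `|x| < 1 by rewrite ger0_norm ?divr_ge0 ?ltW// ltr_pdivrMr// mul1r.
have c0 : 0 < e * (2 * ep) ^+ 2 / (M + 1).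
  by rewrite divr_gt0 ?ltr_wpDl// mulr_gt0// exprn_gt0// mulr_gt0.
have /cvgrPdist_lt/(_ _ c0)[n _ /(_ n (leqnn _))] := cvg_expr x1.
rewrite /= sub0r normrN normrX ltr_pdivlMr ?ltr_wpDl// => h.
have := key n; have qn : 0 < q2 ^+ n by rewrite exprn_gt0.
have x0 : 0 <= x ^+ n by rewrite exprn_ge0// divr_ge0 ?ltW.
have E : q1 ^+ n = x ^+ n * q2 ^+ n by rewrite -exprMn divfK// gt_eqF.
rewrite E (mulrC e) -2!mulrA [_ * (q2 ^+ n * M)]mulrCA ler_pM2l//.
rewrite ger0_norm ?divr_ge0 ?ltW// in h.
rewrite leNgt => /negP; apply; apply: le_lt_trans h.
by rewrite ler_wpM2l// lerDl.
Qed.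

End ortho.

Definition cont_at (D : R * R -> R) (z0 : R * R) := forall e : R, 0 < e ->
  exists2 del : R, 0 < del & forall z : R * R,
    `|z.1 - z0.1| < del -> `|z.2 - z0.2| < del -> `|D z - D z0| < e.

Lemma orth_eq0 (D : R * R -> R) (z0 : R * R) :
  leb2.-integrable Q (EFin \o D) ->
  (forall j k, \int[leb2]_(z in Q) (D z * cos2 j k z) = 0) ->
  (forall u v, D (- u, v) = D (u, v)) -> (forall u v, D (u, - v) = D (u, v)) ->
  0 < z0.1 < L -> 0 < z0.2 < L -> cont_at D z0 -> D z0 = 0.
Proof.
move=> iD oD e1 e2 z1 z2 cD; apply/eqP; rewrite eq_le (orth_le0 iD)//=.
rewrite -oppr_le0.
have iN : leb2.-integrable Q (EFin \o (fun z => - D z)).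
  rewrite (_ : _ \o _ = (\- (EFin \o D))%E); last exact/funext.
  exact: integrableN.
apply: (orth_le0 iN) => //.
- move=> j k; have i := intQM iD (measurable_cos2 j k) (cos2_max j k).
  under eq_Rintegral do rewrite mulNr -mulN1r.
  by rewrite RintegralZl// oD mulr0.
- by move=> u v; rewrite e1.
- by move=> u v; rewrite e2.
- by move=> e /cD[d d0 h]; exists d => // z h1 h2; rewrite -opprD normrN h.
Qed.

Lemma integral_cos_itv (n : int) :
  \int[mu]_(x in I) cos (n%:~R * a * x) = 2 * L * (n == 0)%:R.
Proof.
have L0 : 0 < L by rewrite divr_gt0 ?pi_gt0.
have aL : a * L = pi by rewrite /L mulrC divfK// gt_eqF.
have [->|n0] := eqVneq n 0.
  under eq_Rintegral do rewrite !mul0r cos0.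
  rewrite Rintegral_cst// mul1r [fine _](_ : _ = 2 * L) ?mulr1//.
  have := lebesgue_measure_itv `[- L, L]; rewrite /= lte_fin => E.
  have LL : - L < L by lra.
  by rewrite LL in E; rewrite [mu I]E -EFinB/=; ring.
have na : n%:~R * a != 0 by rewrite mulf_neq0 ?intr_eq0// gt_eqF.
pose F x : R := (n%:~R * a)^-1 * sin (n%:~R * a * x).
have dF (x : R) : is_derive x (1 : R) F (cos (n%:~R * a * x)).
  have ds := is_derive_sin (n%:~R * a * x).
  have dk : is_derive x (1 : R) (fun x : R => n%:~R * a * x) (n%:~R * a).
    by apply: is_derive_eq; rewrite /GRing.scale/= ?mulr1.
  have dc := is_derive1_comp ds dk.
  have := is_deriveZ (n%:~R * a)^-1 dc.
  by rewrite /GRing.scale/= [cos _ * _]mulrC mulKf.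
have cF : continuous F.
  by move=> x; apply/differentiable_continuous/derivable1_diffP; exact: ex_derive.
have cc : continuous (fun x : R => cos (n%:~R * a * x)).
  by move=> t; apply: continuous_comp; [exact: mulrl_continuous|exact: continuous_cos].
rewrite /Rintegral /I (@continuous_FTC2 _ _ F)//.
- rewrite /F mulrN sinN -mulrA aL sin_intpi oppr0 !mulr0 sube0 /= ; ring.
- by lra.
- exact: continuous_subspaceT.
- split; first by move=> x _; exact: ex_derive.
    by apply: cvg_at_right_filter; exact: cF.
  by apply: cvg_at_left_filter; exact: cF.
- by move=> x _; rewrite derive1E; exact: derive_val.
Qed.

Let icos (n : int) : mu.-integrable I (EFin \o (fun x : R => cos (n%:~R * a * x))).
Proof.
apply: continuous_compact_integrable; first exact: segment_compact.
apply: continuous_subspaceT => t.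
by apply: continuous_comp; [exact: mulrl_continuous|exact: continuous_cos].
Qed.

(** Both indicators fire exactly when [j = k = 0], which accounts for the doubled value [2 * L] of
    the constant mode. *)
Lemma integral_coscos_itv (j k : int) :
  \int[mu]_(x in I) (cos (j%:~R * a * x) * cos (k%:~R * a * x)) =
  L * ((j == k)%:R + (j == - k)%:R).
Proof.
have E x : cos (j%:~R * a * x) * cos (k%:~R * a * x) =
    2^-1 * (cos ((j - k)%:~R * a * x) + cos ((j + k)%:~R * a * x)).
  rewrite intrB intrD.
  have -> : (j%:~R - k%:~R) * a * x = j%:~R * a * x - k%:~R * a * x by ring.
  have -> : (j%:~R + k%:~R) * a * x = j%:~R * a * x + k%:~R * a * x by ring.
  by rewrite cosB cosD; field.
under eq_Rintegral do rewrite E.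
rewrite RintegralZl//; last exact: (integrableD _ (icos _) (icos _)).
by rewrite RintegralD// !integral_cos_itv subr_eq0 addr_eq0; field.
Qed.

Lemma integral_cos2cos2 (j k j' k' : int) :
  \int[leb2]_(z in Q) (cos2 j k z * cos2 j' k' z) =
  L ^+ 2 * (((j == j')%:R + (j == - j')%:R) * ((k == k')%:R + (k == - k')%:R)).
Proof.
pose f n n' := (fun x : R => cos (n%:~R * a * x) * cos (n'%:~R * a * x)) \_ I.
have iF n n' : mu.-integrable setT (EFin \o f n n').
  rewrite (_ : _ \o _ = (EFin \o (fun x : R => cos (n%:~R * a * x) * cos (n'%:~R * a * x))) \_ I).
    refine (proj1 (integrable_mkcond _ _) _); first exact: measurable_itv.
    by apply: (@integrable_mul_bounded _ _ _ _ _ _ _ _ 1) => //; [exact: measurable_cosM|move=> z; exact: cos_max].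
  by apply/funext => x /=; rewrite /f !patchE; case: ifP.
have [_ E] := Rintegral_prodM (iF j j') (iF k k').
rewrite Rintegral_mkcond (_ : \int[leb2]_x _ = \int[leb2]_z (f j j' z.1 * f k k' z.2)).
  rewrite E /f -!Rintegral_mkcond !integral_coscos_itv; ring.
apply: eq_Rintegral => z _; rewrite /f !patchE.
rewrite (_ : (z \in Q) = (z.1 \in I) && (z.2 \in I)).
  by case: (z.1 \in I); case: (z.2 \in I); rewrite /= ?mulr0 ?mul0r// /cos2; ring.
by apply/idP/andP; rewrite !inE /Q/= => -[].
Qed.

(** * Cosine series with absolutely summable coefficients *)

Section cosine_series.
Variables (h : R * R -> R) (ih : leb2.-integrable Q (EFin \o h)).
Hypotheses (h_even1 : forall u v, h (- u, v) = h (u, v))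
  (h_even2 : forall u v, h (u, - v) = h (u, v)).

Definition coef (n : int * int) : R := \int[leb2]_(z in Q) (h z * cos2 n.1 n.2 z).

Variable C : R.
Hypothesis coefC : forall F : set (int * int), finite_set F -> \sum_(n \in F) `|coef n| <= C.

Let term (n : int * int) (z : R * R) : R := coef n * cos2 n.1 n.2 z.

Let ex_sum z : exists l, has_sum setT (fun n => term n z) l.
Proof.
apply: (@has_sum_abs _ _ _ C) => F finF; apply: le_trans (coefC finF).
by apply: ler_fsum => // n _; rewrite /term normrM ler_piMr// cos2_max.
Qed.

Definition cosser (z : R * R) : R := projT1 (cid (ex_sum z)).

Lemma cosserP z : has_sum setT (fun n => term n z) (cosser z).
Proof. exact: (projT2 (cid (ex_sum z))). Qed.

Let unif e : 0 < e -> exists F0, finite_set F0 /\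
    forall F, finite_set F -> F0 `<=` F ->
    forall z, `|cosser z - \sum_(n \in F) term n z| <= e.
Proof.
move=> e0; exact: (has_sum_uniform coefC (fun n z => cos2_max n.1 n.2 z) cosserP e0).
Qed.

Lemma cosser_even1 u v : cosser (- u, v) = cosser (u, v).
Proof.
apply: has_sum_unique (cosserP _) _; apply: eq_has_sum (cosserP (u, v)) => n _.
by rewrite /term /cos2/= mulrN cosN.
Qed.

Lemma cosser_even2 u v : cosser (u, - v) = cosser (u, v).
Proof.
apply: has_sum_unique (cosserP _) _; apply: eq_has_sum (cosserP (u, v)) => n _.
by rewrite /term /cos2/= mulrN cosN.
Qed.

Lemma measurable_cosser : measurable_fun [set: R * R] cosser.
Proof.
have /choice[F hF] : forall n : nat, exists F0 : set (int * int), finite_set F0 /\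
    forall z, `|cosser z - \sum_(n \in F0) term n z| <= n.+1%:R^-1.
  move=> n; have n0 : 0 < n.+1%:R^-1 :> R by rewrite invr_gt0.
  by have [F0 [f0 h0]] := unif n0; exists F0; split => // z; exact: h0.
apply: (@measurable_fun_cvg _ _ _ _ (fun n z => \sum_(k \in F n) term k z)).
  move=> n; rewrite (_ : (fun z => _) = (fun z => \sum_(k <- fset_set (F n)) term k z)); last first.
    by apply/funext => z; rewrite fsbig_finite//; exact: (hF n).1.
  apply: measurable_sum => k; apply: measurable_funM => //; exact: measurable_cos2.
move=> z _; apply/cvgrPdist_le => e e0; near=> n.
apply: le_trans ((hF n).2 z) _.
rewrite -[leRHS]invrK lef_pV2 ?posrE ?invr_gt0//.
apply: (@le_trans _ _ n%:R); last by rewrite ler_nat.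
by near: n; exact: nbhs_infty_ger.
Unshelve. all: by end_near. Qed.

Lemma cosser_max z : `|cosser z| <= C + 1.
Proof.
have [F0 [fin0 h0]] := unif ltr01; have := h0 _ fin0 (@subset_refl _ _) z => h1.
have -> : cosser z = (cosser z - \sum_(n \in F0) term n z) + \sum_(n \in F0) term n z by ring.
rewrite (le_trans (ler_normD _ _))// addrC lerD//.
rewrite (le_trans (ler_norm_fsum _ fin0))// (le_trans _ (coefC fin0))//.
by apply: ler_fsum => // n _; rewrite /term normrM ler_piMr// cos2_max.
Qed.

Lemma integral_cosser j k :
  \int[leb2]_(z in Q) (cosser z * cos2 j k z) = 4 * L ^+ 2 * coef (j, k).
Proof.
apply/eqP; rewrite -subr_eq0 -normr_le0; apply/ler_addgt0Pr => e e0; rewrite add0r.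
pose V := fine (leb2 Q) + 1.
have fQ : leb2 Q \is a fin_num by rewrite ge0_fin_numE.
have V0 : 0 < V by rewrite ltr_wpDl// fine_ge0.
have [F0 [fin0 h0]] := unif (divr_gt0 e0 V0).
(* The modes with indices agreeing up to signs are the same function, so the finite set has to
   contain all four. Each contributes [L ^ 2 * coef (j, k)]; when an index is 0 the coinciding modes
   are made up for by the double indicators. *)
pose S : set (int * int) := [set` [:: (j, k); (- j, k); (j, - k); (- j, - k)]].
have finU : finite_set (F0 `|` S) by rewrite finite_setU; split => //; exact: finite_seq.
have {h0} := h0 _ finU (@subsetUl _ _ _); set F := F0 `|` S => h0.
have mc := measurable_cos2; have mco := measurable_cosser.
have iterm n : leb2.-integrable Q (EFin \o (fun z => coef n * (cos2 n.1 n.2 z * cos2 j k z))).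
  apply: integrableZl_EFin => //; apply: (@intc _ 1); first exact: measurable_funM.
  by move=> z; rewrite normrM -(mulr1 1) ler_pM// cos2_max.
have [isum Esum] := @Rintegral_seq_sum _ _ leb2 Q _ (fset_set F) _ mQ iterm.
have Sz z : (\sum_(n \in F) term n z) * cos2 j k z =
    \sum_(n <- fset_set F) coef n * (cos2 n.1 n.2 z * cos2 j k z).
  rewrite fsbig_finite//= mulr_suml; apply: eq_bigr => n _; rewrite /term; ring.
have E : \sum_(n <- fset_set F) \int[leb2]_(z in Q) (coef n * (cos2 n.1 n.2 z * cos2 j k z)) =
    4 * L ^+ 2 * coef (j, k).
  have E1 n : \int[leb2]_(z in Q) (coef n * (cos2 n.1 n.2 z * cos2 j k z)) =
     L ^+ 2 * (coef n * (n == (j, k))%:R) + L ^+ 2 * (coef n * (n == (- j, k))%:R) +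
     (L ^+ 2 * (coef n * (n == (j, - k))%:R) + L ^+ 2 * (coef n * (n == (- j, - k))%:R)).
    rewrite RintegralZl//; last first.
      apply: (@intc _ 1); first exact: measurable_funM.
      by move=> z; rewrite normrM -(mulr1 1) ler_pM// cos2_max.
    rewrite integral_cos2cos2; case: n => n1 n2 /=; rewrite !xpair_eqE -!mulnb !natrM.
    ring.
  under eq_bigr do rewrite E1.
  rewrite !big_split/= -!mulr_sumr.
  have pick (s : int * int) : s \in [:: (j, k); (- j, k); (j, - k); (- j, - k)] ->
      \sum_(n <- fset_set F) coef n * (n == s)%:R = coef s.
    move=> sS; have sF : s \in fset_set F by rewrite in_fset_set// inE; right.
    rewrite (big_fsetD1 s sF)/= eqxx mulr1 big1_fset ?addr0// => n.
    by rewrite !inE => /andP[/negbTE -> _]; rewrite mulr0.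
  rewrite !pick ?inE ?eqxx ?orbT//.
  have cE s t : coef (- s, t) = coef (s, t).
    by apply: eq_Rintegral => z _; rewrite /cos2/= mulrNz !mulNr cosN.
  have cE' s t : coef (s, - t) = coef (s, t).
    by apply: eq_Rintegral => z _; rewrite /cos2/= mulrNz !mulNr cosN.
  rewrite !(cE, cE'); ring.
have iC : leb2.-integrable Q (EFin \o (fun z => cosser z * cos2 j k z)).
  apply: (@intc _ (C + 1)); first exact: measurable_funM.
  by move=> z; rewrite normrM (le_trans _ (cosser_max z))// ler_piMr// cos2_max.
rewrite -E -Esum -RintegralB//.
have iB := intQB iC isum.
rewrite (le_trans (le_normr_Rintegral _ iB))//.
apply: (@le_trans _ _ (\int[leb2]_(z in Q) (e / V))).
  apply: le_Rintegral => //.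
  - exact: (integrable_abse iB).
  - by apply: (@intc _ (e / V)) => // z; rewrite ger0_norm// ltW// divr_gt0.
  - move=> z _; rewrite -Sz -mulrBl normrM (le_trans _ (h0 z))//.
    by rewrite ler_piMr// cos2_max.
rewrite Rintegral_cst// mulrAC ler_pdivrMr// ler_wpM2l ?ltW//.
by rewrite /V ltrDl.
Qed.

Lemma cosser_cont z0 : cont_at cosser z0.
Proof.
move=> e e0; have e4 : 0 < e / 4 by rewrite divr_gt0.
have [F0 [fin0 h0]] := unif e4; have {}h0 := h0 _ fin0 (@subset_refl _ _).
pose B := \sum_(n \in F0) `|coef n| * ((`|n.1%:~R| + `|n.2%:~R|) * a).
have B0 : 0 <= B by apply: fsumr_ge0 => n _; rewrite !mulr_ge0 ?addr_ge0// ltW.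
exists (e / (4 * (B + 1))); first by rewrite divr_gt0// mulr_gt0// ltr_wpDl.
set del := e / _ => z d1 d2.
have del0 : 0 < del by apply: le_lt_trans d1.
have h1 : `|\sum_(n \in F0) term n z - \sum_(n \in F0) term n z0| <= B * del.
  rewrite !fsbig_finite//= -sumrB (le_trans (ler_norm_sum _ _ _))//.
  rewrite /B fsbig_finite//= mulr_suml; apply: ler_sum => n _.
  rewrite /term -mulrBr normrM -mulrA ler_wpM2l//.
  have -> : cos2 n.1 n.2 z - cos2 n.1 n.2 z0 =
    (cos (n.1%:~R * a * z.1) - cos (n.1%:~R * a * z0.1)) * cos (n.2%:~R * a * z.2) +
    cos (n.1%:~R * a * z0.1) * (cos (n.2%:~R * a * z.2) - cos (n.2%:~R * a * z0.2)).
    rewrite /cos2; ring.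
  rewrite (le_trans (ler_normD _ _))// !normrM mulrDl mulrDl lerD//.
    rewrite (@le_trans _ _ `|cos (n.1%:~R * a * z.1) - cos (n.1%:~R * a * z0.1)|)//.
      by rewrite ler_piMr// cos_max.
    rewrite (le_trans (cos_lip _ _))// -mulrBr !normrM (gtr0_norm a0).
    by rewrite ler_wpM2l ?mulr_ge0// ltW.
  rewrite (@le_trans _ _ `|cos (n.2%:~R * a * z.2) - cos (n.2%:~R * a * z0.2)|)//.
    by rewrite ler_piMl// cos_max.
  rewrite (le_trans (cos_lip _ _))// -mulrBr !normrM (gtr0_norm a0).
  by rewrite ler_wpM2l ?mulr_ge0// ltW.
have h2 : B * del <= e / 4.
  have B1 : 0 < B + 1 by rewrite ltr_wpDl.
  have -> : B * del = e / 4 * (B / (B + 1)) by rewrite /del; field; rewrite gt_eqF.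
  by rewrite ler_piMr ?(ltW e4)// ler_pdivrMr// mul1r lerDl.
have hz := h0 z; have hz0 := h0 z0.
have -> : cosser z - cosser z0 = (cosser z - \sum_(n \in F0) term n z) -
   (cosser z0 - \sum_(n \in F0) term n z0) +
   (\sum_(n \in F0) term n z - \sum_(n \in F0) term n z0) by ring.
rewrite (le_lt_trans (ler_normD _ _))//.
have := ler_normB (cosser z - \sum_(n \in F0) term n z) (cosser z0 - \sum_(n \in F0) term n z0).
lra.
Qed.

(** By [integral_cosser] the rescaled series has the same coefficients as [h], and it is even and
    continuous; the difference falls under [orth_eq0]. *)
Lemma cosine_series_pt (z0 : R * R) : 0 < z0.1 < L -> 0 < z0.2 < L -> cont_at h z0 ->
  h z0 = (4 * L ^+ 2)^-1 * cosser z0.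
Proof.
move=> z1 z2 ch; set kp := (4 * L ^+ 2)^-1.
have L0 : 0 < L by rewrite divr_gt0 ?pi_gt0.
have kp0 : 0 < kp by rewrite invr_gt0 mulr_gt0// exprn_gt0.
have iC : leb2.-integrable Q (EFin \o (fun z => kp * cosser z)).
  apply: integrableZl_EFin => //; exact: (intc measurable_cosser cosser_max).
apply/eqP; rewrite -subr_eq0; apply/eqP.
apply: (@orth_eq0 (fun z => h z - kp * cosser z)) => //.
- exact: integrableB_EFin.
- move=> j k; under eq_Rintegral do rewrite mulrBl -mulrA.
  have i1 := intQM ih (measurable_cos2 j k) (cos2_max j k).
  have i2 : leb2.-integrable Q (EFin \o (fun z => cosser z * cos2 j k z)).
    apply: (@intc _ (C + 1)).
      by apply: measurable_funM; [exact: measurable_cosser|exact: measurable_cos2].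
    by move=> z; rewrite normrM (le_trans _ (cosser_max z))// ler_piMr// cos2_max.
  rewrite RintegralB//; last exact: integrableZl_EFin.
  rewrite RintegralZl// integral_cosser -/(coef (j, k)) mulrA mulVf ?mul1r ?subrr//.
  by rewrite mulf_neq0 ?expf_neq0// gt_eqF.
- by move=> u v; rewrite h_even1 cosser_even1.
- by move=> u v; rewrite h_even2 cosser_even2.
- move=> e e0; have e2 : 0 < e / 2 by rewrite divr_gt0.
  have e3 : 0 < e / 2 / kp by rewrite divr_gt0.
  have [d1 d10 h1] := ch _ e2; have [d2 d20 h2] := cosser_cont z0 e3.
  exists (Num.min d1 d2); first by rewrite lt_min d10.
  move=> z; rewrite !lt_min => /andP[a1 a2] /andP[b1 b2].
  have := h1 z a1 b1; have := h2 z a2 b2.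
  rewrite ltr_pdivlMr// => g2 g1.
  have -> : h z - kp * cosser z - (h z0 - kp * cosser z0) =
    (h z - h z0) - kp * (cosser z - cosser z0) by ring.
  rewrite (le_lt_trans (ler_normB _ _))// normrM (gtr0_norm kp0) mulrC; lra.
Qed.

(** The diagonal shift repairs two defects of [z0] at once: a possible discontinuity of [h], and a
    vanishing coordinate, which the pointwise result excludes. The series is continuous, so both
    sides pass to the limit. *)
Lemma cosine_series (z0 : R * R) : 0 <= z0.1 < L -> 0 <= z0.2 < L ->
  (forall e, 0 < e -> exists2 del : R, 0 < del & forall ep, 0 < ep < del ->
     cont_at h (z0.1 + ep, z0.2 + ep) /\ `|h (z0.1 + ep, z0.2 + ep) - h z0| < e) ->
  has_sum setT (fun n => (4 * L ^+ 2)^-1 * (coef n * cos2 n.1 n.2 z0)) (h z0).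
Proof.
move=> /andP[z1 z1L] /andP[z2 z2L] hz; set kp := (4 * L ^+ 2)^-1.
have L0 : 0 < L by rewrite divr_gt0 ?pi_gt0.
have kp0 : 0 < kp by rewrite invr_gt0 mulr_gt0// exprn_gt0.
suff -> : h z0 = kp * cosser z0 by apply: has_sumZ; exact: cosserP.
apply/eqP; rewrite -subr_eq0 -normr_le0; apply/ler_addgt0Pr => e e0; rewrite add0r.
have e2 : 0 < e / 2 by rewrite divr_gt0.
have e3 : 0 < e / 2 / kp by rewrite divr_gt0.
have [d1 d10 h1] := hz _ e2; have [d2 d20 h2] := cosser_cont z0 e3.
pose d := Num.min (Num.min d1 d2) (Num.min (L - z0.1) (L - z0.2)).
have d0 : 0 < d by rewrite !lt_min d10 d20 !subr_gt0 z1L z2L.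
have dd1 : d <= d1 by rewrite !ge_min lexx.
have dd2 : d <= d2 by rewrite !ge_min lexx !orbT.
have dd3 : d <= L - z0.1 by rewrite !ge_min lexx !orbT.
have dd4 : d <= L - z0.2 by rewrite !ge_min lexx !orbT.
pose ep := d / 2.
have ep0 : 0 < ep < d1 by rewrite /ep; lra.
have [c1 g1] := h1 _ ep0.
have w1 : `|(z0.1 + ep, z0.2 + ep).1 - z0.1| < d2.
  by rewrite /= addrC addKr gtr0_norm /ep; lra.
have w2 : `|(z0.1 + ep, z0.2 + ep).2 - z0.2| < d2.
  by rewrite /= addrC addKr gtr0_norm /ep; lra.
have := h2 _ w1 w2; rewrite ltr_pdivlMr// => g2.
have v1 : 0 < (z0.1 + ep, z0.2 + ep).1 < L by rewrite /= /ep; lra.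
have v2 : 0 < (z0.1 + ep, z0.2 + ep).2 < L by rewrite /= /ep; lra.
have E := cosine_series_pt v1 v2 c1.
have -> : h z0 - kp * cosser z0 = kp * (cosser (z0.1 + ep, z0.2 + ep) - cosser z0) -
   (h (z0.1 + ep, z0.2 + ep) - h z0) by rewrite E -/kp; ring.
rewrite (le_trans (ler_normB _ _))// normrM (gtr0_norm kp0) mulrC; lra.
Qed.

End cosine_series.

End cosine_uniqueness.

End cosine_expansion.

(** * Power weights on the unit p-ball *)

Section weight_integral.
Context {R : realType}.
Local Notation mu := (@lebesgue_measure R).
Local Notation leb2 := (@lebesgue_measure R \x @lebesgue_measure R)%E.

Section dilation.
Local Open Scope ereal_scope.

Lemma ge0_integral_scale2 (c d : R) (F : R * R -> \bar R) : c != 0%R -> d != 0%R ->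
  measurable_fun [set: R * R] F -> (forall z, 0 <= F z) ->
  \int[leb2]_z F (c * z.1, d * z.2)%R = `|c * d|^-1%:E * \int[leb2]_z F z.
Proof.
move=> c0 d0 mF F0.
have mM e : measurable_fun [set: R] (fun x : R => e * x)%R by exact: measurable_funM.
have mcd : measurable_fun [set: R * R] (fun z : R * R => (c * z.1, d * z.2)%R).
  apply: measurable_fun_pair.
    exact: (measurableT_comp (mM c) measurable_fst).
  exact: (measurableT_comp (mM d) measurable_snd).
have mG : measurable_fun [set: R * R] (fun z => F (c * z.1, d * z.2)%R).
  exact: (measurableT_comp mF mcd).
transitivity (\int[mu]_u \int[mu]_v F (c * u, d * v)%R).
  exact: (@fubini_tonelli1 _ _ _ _ _ mu mu (fun z => F (c * z.1, d * z.2)%R)).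
pose I (u : R) : \bar R := \int[mu]_v F (u, v).
have mI : measurable_fun [set: R] I by exact: measurable_fun_partial_integral.
have I0 u : 0 <= I u by exact: integral_ge0.
transitivity (\int[mu]_u (`|d|^-1%:E * I (c * u)%R)).
  apply: eq_integral => u _.
  have mFu : measurable_fun [set: R] (fun v => F ((c * u)%R, v)) by exact: measurableT_comp.
  by rewrite (ge0_integral_scale d0 mFu).
have mIc : measurable_fun [set: R] (fun u => I (c * u)%R) by exact: measurableT_comp.
rewrite ge0_integralZl//.
rewrite (ge0_integral_scale c0 mI)// muleA -EFinM -invfM -normrM mulrC; congr (_ * _).
exact/esym/(@fubini_tonelli1 _ _ _ _ _ mu mu F).
Qed.

End dilation.

Lemma Rintegral_scale2 (c d : R) (F : R * R -> R) : c != 0 -> d != 0 ->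
  leb2.-integrable setT (EFin \o F) ->
  \int[leb2]_z F (c * z.1, d * z.2) = `|c * d|^-1 * \int[leb2]_z F z.
Proof.
move=> c0 d0 intF; rewrite /Rintegral.
have mF : measurable_fun [set: R * R] (EFin \o F) by exact: (measurable_int leb2).
rewrite [in LHS]integralE [in RHS]integralE.
have E1 : (\int[leb2]_z ((fun z => (F (c * z.1, d * z.2))%:E)^\+ z) =
  `|c * d|^-1%:E * \int[leb2]_z ((EFin \o F)^\+ z))%E.
  rewrite -(ge0_integral_scale2 c0 d0 (measurable_funepos mF) (fun z => funepos_ge0 _ z)).
  by apply: eq_integral => z _; rewrite !funeposE.
have E2 : (\int[leb2]_z ((fun z => (F (c * z.1, d * z.2))%:E)^\- z) =
  `|c * d|^-1%:E * \int[leb2]_z ((EFin \o F)^\- z))%E.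
  rewrite -(ge0_integral_scale2 c0 d0 (measurable_funeneg mF) (fun z => funeneg_ge0 _ z)).
  by apply: eq_integral => z _; rewrite !funenegE.
have f1 := integrable_pos_fin_num measurableT intF.
have f2 := integrable_neg_fin_num measurableT intF.
rewrite E1 E2 -muleBr ?fineM//; last exact: fin_num_adde_defr.
by rewrite fin_numB f1 f2.
Qed.

Section weight.
Variables (p b : R) (p0 : 0 < p) (b1 : -1 < b).
Let q := p^-1.
Let q0 : 0 < q. Proof. by rewrite invr_gt0. Qed.
Let N (z : R * R) : R := `|z.1| `^ p + `|z.2| `^ p.

(** The test is strict, so the value on the sphere is 0 for every [b], including [b = 0], in
    agreement with the strict index set of [Dsum]. *)
Definition weight (z : R * R) : R :=
  if `|z.1| `^ p + `|z.2| `^ p < 1 then (1 - (`|z.1| `^ p + `|z.2| `^ p)) `^ b else 0.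

Lemma pnorm_powR (z : R * R) : pnorm p z `^ p = `|z.1| `^ p + `|z.2| `^ p.
Proof.
by rewrite /pnorm -powRrM mulVf ?gt_eqF// powRr1// addr_ge0 ?powR_ge0.
Qed.

Lemma weight_ge0 z : 0 <= weight z.
Proof. by rewrite /weight; case: ifP => // _; exact: powR_ge0. Qed.

Lemma weightN1 u v : weight (- u, v) = weight (u, v).
Proof. by rewrite /weight/= normrN. Qed.

Lemma weightN2 u v : weight (u, - v) = weight (u, v).
Proof. by rewrite /weight/= normrN. Qed.

Lemma weight_supp z : weight z != 0 -> `|z.1| <= 1 /\ `|z.2| <= 1.
Proof.
rewrite /weight; case: ifPn; rewrite ?eqxx// => h _.
have one x y : 0 <= y -> `|x| `^ p + y < 1 -> `|x| <= 1.
  move=> y0 h1; have : `|x| `^ p < 1 by apply: le_lt_trans h1; rewrite lerDl.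
  by rewrite powR_lt1// => /ltW.
split; first exact: one (powR_ge0 _ _) h.
by apply: one (powR_ge0 `|z.1| p) _; rewrite addrC.
Qed.

Lemma measurable_pnormX : measurable_fun [set: R * R] N.
Proof.
have m1 : measurable_fun [set: R] (fun x : R => `|x| `^ p).
  by apply: (measurableT_comp (measurable_powR p)); exact: normr_measurable.
apply: measurable_funD.
  exact: (measurableT_comp m1 measurable_fst).
exact: (measurableT_comp m1 measurable_snd).
Qed.

Lemma measurable_weight : measurable_fun [set: R * R] weight.
Proof.
have -> : weight = (fun z => (1 - N z) `^ b * \1_[set z | N z < 1] z).
  apply/funext => z; rewrite /weight indicE -/(N z).
  case: ifPn => h; first by rewrite mem_set// mulr1.
  by rewrite memNset ?mulr0//; apply/negP.
apply: measurable_funM.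
  apply: (measurableT_comp (measurable_powR b)).
  by apply: measurable_funB => //; exact: measurable_pnormX.
apply: measurable_indic; apply: measurable_set_ltr => //.
exact: measurable_pnormX.
Qed.

Lemma weight_polar r t : 0 < r -> 0 < t < 1 ->
  weight (r * t `^ q, r * (1 - t) `^ q) = if r < 1 then (1 - r `^ p) `^ b else 0.
Proof.
move=> r0 /andP[t0 t1]; have t1' : 0 < 1 - t by rewrite subr_gt0.
rewrite /weight/= !ger0_norm ?mulr_ge0 ?powR_ge0 ?ltW//.
rewrite !powRM ?powR_ge0 ?ltW// -!powRrM mulVf ?gt_eqF// !powRr1 ?ltW//.
by rewrite -mulrDr addrC subrK mulr1 powR_lt1// ltW.
Qed.

(** [T] is the angular Beta density of polar coordinates, and [m] is the radial density multiplied
    by the weight. *)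
Let T (t : R) : R := t `^ (q - 1) * (1 - t) `^ (q - 1).
Let m (r : R) : R := q * r * (1 - r `^ p) `^ b.

Let T0 t : 0 <= T t. Proof. by rewrite mulr_ge0 ?powR_ge0. Qed.
Let m0 r : 0 < r -> 0 <= m r.
Proof. by move=> r0; rewrite !mulr_ge0 ?powR_ge0 ?ltW. Qed.

Let mT : measurable_fun [set: R] T.
Proof.
apply: measurable_funM; first exact: measurable_powR.
by apply: (measurableT_comp (measurable_powR _)); exact: measurable_funB.
Qed.

Let mm : measurable_fun [set: R] m.
Proof.
apply: measurable_funM; first exact: measurable_funM.
by apply: (measurableT_comp (measurable_powR _)); apply: measurable_funB.
Qed.

Lemma ge0_integral_weight (k : R * R -> R) : measurable_fun [set: R * R] k ->
  (forall z, 0 <= k z) -> (forall u v, k (- u, v) = k (u, v)) ->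
  (forall u v, k (u, - v) = k (u, v)) ->
  (\int[leb2]_z (weight z * k z)%:E =
   4%:E * \int[mu]_(r in `]0%R, 1%R[) ((m r)%:E * \int[mu]_(t in `]0%R, 1%R[)
     (T t * k (r * t `^ q, r * (1 - t) `^ q))%:E))%E.
Proof.
move=> mk k0 e1 e2.
have mF : measurable_fun [set: R * R] (fun z => (weight z * k z)%:E).
  by apply/measurable_EFinP/measurable_funM => //; exact: measurable_weight.
rewrite ge0_integral_even2//; last 3 first.
- by move=> z; rewrite lee_fin mulr_ge0// weight_ge0.
- by move=> u v; rewrite weightN1 e1.
- by move=> u v; rewrite weightN2 e2.
congr (_ * _)%E.
have F0 z : (0 <= (weight z * k z)%:E)%E by rewrite lee_fin mulr_ge0// weight_ge0.
etransitivity; first exact: (ge0_integral_polar p0 mF F0).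
rewrite integral_mkcond [in RHS]integral_mkcond; apply: eq_integral => r _.
rewrite !patchE; have [r0|r0] := ltP 0 (r : R); last first.
  by rewrite !memNset//= in_itv/= ltNge r0.
rewrite mem_set/= ?in_itv/= ?r0//; case: ifPn => [|].
  rewrite inE/= in_itv/= => /andP[_ r1].
  have mtk : measurable_fun [set: R] (fun t => (T t * k (r * t `^ q, r * (1 - t) `^ q))%:E).
    apply/measurable_EFinP/measurable_funM => //.
    apply: (measurableT_comp mk); apply: measurable_fun_pair.
      by apply: measurable_funM => //; exact: measurable_powR.
    apply: measurable_funM => //; apply: (measurableT_comp (measurable_powR _)).
    exact: measurable_funB.
  rewrite -ge0_integralZl//; last 3 first.
  - exact: measurable_funTS.
  - by move=> t _; rewrite lee_fin mulr_ge0.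
  - by rewrite lee_fin m0.
  apply: eq_integral => t; rewrite inE/= in_itv/= => tt.
  by rewrite weight_polar// r1 -!EFinM /m /T /q; congr EFin; ring.
rewrite notin_setE/= in_itv/= r0/= => r1.
rewrite integral0_eq// => t; rewrite /= in_itv/= => tt.
by rewrite weight_polar// (negbTE (introN idP r1)) mul0r mul0e.
Qed.

Let Bt : R := \int[mu]_(t in `]0, 1[) T t.

Let T_lty : (\int[mu]_(t in `]0%R, 1%R[) (T t)%:E < +oo)%E.
Proof. exact: beta_integral_lty. Qed.

Let BtE : (\int[mu]_(t in `]0%R, 1%R[) (T t)%:E)%E = Bt%:E.
Proof. by rewrite /Bt /Rintegral fineK// ge0_fin_numE// integral_ge0// => t _; rewrite lee_fin. Qed.

Let intT : mu.-integrable `]0, 1[ (EFin \o T).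
Proof.
apply/integrableP; split; first by apply: measurable_funTS; exact/measurable_EFinP.
rewrite (_ : (\int[mu]_(x in _) _)%E = (\int[mu]_(t in `]0%R, 1%R[) (T t)%:E)%E)//.
by apply: eq_integral => t _ /=; rewrite ger0_norm.
Qed.

(** Substituting [r = t ^ q] turns the radial integral into a Beta integral with parameters [2 * q]
    and [b + 1]; the condition [-1 < b] is what makes the second one positive. *)
Let m_lty : (\int[mu]_(r in `]0%R, 1%R[) (m r)%:E < +oo)%E.
Proof.
pose G := (fun r : R => `|m r|%:E) \_ `]0, 1[.
have mF : measurable_fun [set: R] G.
  apply/(measurable_restrictT _ _).1 => //; apply: measurable_funTS.
  by apply/measurable_EFinP; exact: measurableT_comp.
have F0 r : (0 <= G r)%E.
  by rewrite /G patchE; case: ifP => // _; rewrite lee_fin.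
have := ge0_integral_powR q0 mF F0.
rewrite {1}/G -integral_mkcondr setIidr; last by move=> x /=; rewrite !in_itv/= andbT => /andP[].
rewrite [X in X = _](_ : _ = (\int[mu]_(t in `]0%R, 1%R[) (m t)%:E)%E); last first.
  by apply: eq_integral => r; rewrite inE/= in_itv/= => /andP[r0 _]; rewrite ger0_norm ?m0.
move=> ->.
rewrite (_ : (\int[mu]_(x in _) _)%E = (\int[mu]_(t in `]0%R, 1%R[)
    ((q ^+ 2)%:E * (t `^ (2 * q - 1) * (1 - t) `^ (b + 1 - 1))%:E))%E).
  have mbt : measurable_fun [set: R] (fun t => (t `^ (2 * q - 1) * (1 - t) `^ (b + 1 - 1))%:E).
    apply/measurable_EFinP/measurable_funM; first exact: measurable_powR.
    by apply: (measurableT_comp (measurable_powR _)); exact: measurable_funB.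
  rewrite ge0_integralZl//; last 3 first.
  - exact: measurable_funTS.
  - by move=> t _; rewrite lee_fin mulr_ge0 ?powR_ge0.
  - by rewrite lee_fin sqr_ge0.
  have c0 : 0 < b + 1 by rewrite -ltrBlDr sub0r.
  have d0 : 0 < 2 * q by rewrite mulr_gt0.
  apply: lte_mul_pinfty; [by rewrite lee_fin sqr_ge0|by []|].
  exact: beta_integral_lty.
rewrite integral_mkcond [RHS]integral_mkcond; apply: eq_integral => t _.
rewrite /G !patchE; have [t0|t0] := ltP 0 (t : R); last first.
  by rewrite !memNset//= in_itv/= ltNge t0.
rewrite mem_set/= ?in_itv/= ?t0//.
have tq0 : 0 < t `^ q by rewrite powR_gt0.
have tE : (t `^ q < 1) = (t < 1) by rewrite powR_lt1// ltW.
have [t1|t1] := ltP (t : R) 1.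
  rewrite !mem_set/= ?in_itv/= ?t0 ?tq0 ?tE//.
  rewrite ger0_norm ?m0// /m -powRrM mulVf ?gt_eqF// powRr1 ?ltW// addrK.
  rewrite -!EFinM; congr EFin.
  have -> : t `^ (2 * q - 1) = t `^ q * t `^ (q - 1).
    by rewrite -powRD ?(gt_eqF t0) ?implybT//; congr powR; ring.
  ring.
rewrite memNset; last by rewrite /= in_itv/= tE (ltNge t) t1 andbF.
by rewrite memNset ?mul0e//= in_itv/= (ltNge t) t1 andbF.
Qed.

Lemma integrable_weight : leb2.-integrable setT (EFin \o weight).
Proof.
apply/integrableP; split; first by apply/measurable_EFinP; exact: measurable_weight.
under eq_integral do rewrite /= ger0_norm ?weight_ge0//.
have mc1 : measurable_fun [set: R * R] (cst (1 : R)) by exact: measurable_cst.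
have E := @ge0_integral_weight (cst 1) mc1 (fun=> ler01) (fun _ _ => erefl) (fun _ _ => erefl).
have E' : (\int[leb2]_z (weight z)%:E = \int[leb2]_z (weight z * cst 1 z)%:E)%E.
  by apply: eq_integral => z _; rewrite mulr1.
rewrite E' E (_ : (\int[mu]_(r in _) _)%E = (\int[mu]_(r in `]0%R, 1%R[) ((m r)%:E * Bt%:E))%E); last first.
  apply: eq_integral => r _; congr (_ * _)%E; rewrite -BtE.
  by apply: eq_integral => t _; rewrite mulr1.
have mmE : measurable_fun (`]0, 1[ : set R) (fun r => (m r)%:E).
  by apply: measurable_funTS; exact/measurable_EFinP.
rewrite ge0_integralZr//; last 2 first.
- by move=> r /=; rewrite in_itv/= => /andP[r0 _]; rewrite lee_fin m0.
- by rewrite -BtE integral_ge0// => t _; rewrite lee_fin.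
have fm : (\int[mu]_(r in `]0%R, 1%R[) (m r)%:E)%E \is a fin_num.
  rewrite ge0_fin_numE// integral_ge0// => r /=; rewrite in_itv/= => /andP[r0 _].
  by rewrite lee_fin m0.
by rewrite -(fineK fm) -!EFinM ltry.
Qed.

Let intm : mu.-integrable `]0, 1[ (EFin \o m).
Proof.
apply/integrableP; split; first by apply: measurable_funTS; exact/measurable_EFinP.
rewrite (_ : (\int[mu]_(x in _) _)%E = (\int[mu]_(t in `]0%R, 1%R[) (m t)%:E)%E)//.
by apply: eq_integral => r; rewrite inE/= in_itv/= => /andP[r0 _]; rewrite ger0_norm ?m0.
Qed.

Variable eta : R * R.
Let cc (z : R * R) : R := cos (eta.1 * z.1) * cos (eta.2 * z.2).
Let cct (r t : R) : R := cc (r * t `^ q, r * (1 - t) `^ q).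
Let jj (r : R) : R := \int[mu]_(t in `]0, 1[) (T t * cct r t).

Let cc_max z : `|cc z| <= 1.
Proof. by rewrite /cc normrM -(mulr1 1) ler_pM// cos_max. Qed.

Let mcosM (c : R) : measurable_fun [set: R] (fun t : R => cos (c * t)).
Proof.
apply: continuous_measurable_fun => t; apply: continuous_comp.
  exact: mulrl_continuous.
exact: continuous_cos.
Qed.

Let mcc : measurable_fun [set: R * R] cc.
Proof.
apply: measurable_funM.
  exact: (measurableT_comp (mcosM eta.1) measurable_fst).
exact: (measurableT_comp (mcosM eta.2) measurable_snd).
Qed.

Let mcct : measurable_fun [set: R * R] (fun z => cct z.1 z.2).
Proof.
apply: (measurableT_comp mcc); apply: measurable_fun_pair.
  apply: measurable_funM => //.
  exact: (measurableT_comp (measurable_powR _) measurable_snd).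
apply: measurable_funM => //; apply: (measurableT_comp (measurable_powR _)).
exact: measurable_funB.
Qed.

Let mcctr r : measurable_fun [set: R] (cct r).
Proof. exact: (measurableT_comp mcct (measurable_pair1 r)). Qed.

Let intTcc r : mu.-integrable `]0, 1[ (EFin \o (fun t => T t * cct r t)).
Proof.
apply: (le_integrable _ _ _ intT) => //.
  have mg : measurable_fun [set: R] (fun t => T t * cct r t) by exact: measurable_funM.
  by apply: measurable_funTS; exact/measurable_EFinP.
by move=> t _ /=; rewrite lee_fin normrM ler_piMr// cc_max.
Qed.

Let jjE r : (\int[mu]_(t in `]0%R, 1%R[) (T t * (1 + cct r t))%:E)%E = (Bt + jj r)%:E.
Proof.
rewrite /Bt /jj -RintegralD// /Rintegral fineK; last first.
  by apply: integrable_fin_num => //; exact: (integrableD _ intT (intTcc r)).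
by apply: eq_integral => t _; rewrite mulrDr mulr1.
Qed.

Let mjj : measurable_fun [set: R] jj.
Proof.
have m1 : measurable_fun [set: R] (fun r => (\int[mu]_(t in `]0%R, 1%R[) (T t * (1 + cct r t))%:E)%E).
  apply: (@measurable_fun_partial_integral _ _ (fun z => (T z.2 * (1 + cct z.1 z.2))%:E)) => //.
    apply/measurable_EFinP/measurable_funM.
      exact: (measurableT_comp mT measurable_snd).
    exact: measurable_funD.
  move=> z; rewrite lee_fin mulr_ge0//.
  by have := cc_max (z.1 * z.2 `^ q, z.1 * (1 - z.2) `^ q); rewrite ler_norml /cct; lra.
have -> : jj = (fun r => (Bt + jj r) - Bt) by apply/funext => r; ring.
apply: measurable_funB => //; apply/measurable_EFinP.
by rewrite (_ : _ \o _ = (fun r => (\int[mu]_(t in `]0%R, 1%R[) (T t * (1 + cct r t))%:E)%E))//; apply/funext => r; rewrite jjE.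
Qed.

Let jj_le r : `|jj r| <= Bt.
Proof.
rewrite /jj (le_trans (le_normr_Rintegral _ _))//.
apply: le_Rintegral => //.
  exact: (integrable_abse (intTcc r)).
by move=> t _; rewrite normrM (ger0_norm (T0 t)) ler_piMr// cc_max.
Qed.

Let intmj : mu.-integrable `]0, 1[ (EFin \o (fun r => m r * jj r)).
Proof.
apply: (@le_integrable _ _ _ mu _ _ _ (EFin \o (fun r => Bt * m r))) => //.
- by apply: measurable_funTS; apply/measurable_EFinP/measurable_funM.
- move=> r _ /=; rewrite lee_fin !normrM mulrC ler_wpM2r//.
  by rewrite (le_trans (jj_le r))// ler_norm.
- exact: integrableZl_EFin.
Qed.

(** The polar formula is stated for nonnegative functions. It is applied to the constant 1 and to
    [1 + cc], both nonnegative, and the results are subtracted. *)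
Lemma integral_weight_cos :
  \int[leb2]_z (weight z * cc z) = 4 * \int[mu]_(r in `]0, 1[) (m r * jj r).
Proof.
have iwc : leb2.-integrable setT (EFin \o (fun z => weight z * cc z)).
  apply: (le_integrable _ _ _ integrable_weight) => //.
    by apply/measurable_EFinP/measurable_funM => //; exact: measurable_weight.
  by move=> z _ /=; rewrite lee_fin normrM ler_piMr.
have ccN1 u v : cc (- u, v) = cc (u, v) by rewrite /cc/= mulrN cosN.
have ccN2 u v : cc (u, - v) = cc (u, v) by rewrite /cc/= mulrN cosN.
have mc1 : measurable_fun [set: R * R] (cst (1 : R)) by exact: measurable_cst.
have E1 := @ge0_integral_weight (cst 1) mc1 (fun=> ler01) (fun _ _ => erefl) (fun _ _ => erefl).
have c1 z : 0 <= 1 + cc z by have := cc_max z; rewrite ler_norml; lra.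
have m1 : measurable_fun [set: R * R] (fun z => 1 + cc z) by exact: measurable_funD.
have e1 u v : 1 + cc (- u, v) = 1 + cc (u, v) by rewrite ccN1.
have e2 u v : 1 + cc (u, - v) = 1 + cc (u, v) by rewrite ccN2.
have E2 := @ge0_integral_weight (fun z => 1 + cc z) m1 c1 e1 e2.
have iB : mu.-integrable `]0, 1[ (EFin \o (fun r => m r * Bt)).
  rewrite (_ : (fun r => _) = (fun r => Bt * m r)); last by apply/funext => r; rewrite mulrC.
  exact: integrableZl_EFin.
have iBj : mu.-integrable `]0, 1[ (EFin \o (fun r => m r * (Bt + jj r))).
  rewrite (_ : (fun r => _) = (fun r => m r * Bt + m r * jj r)); last by apply/funext => r; rewrite mulrDr.
  exact: integrableD_EFin.
have F1 : \int[leb2]_z weight z = 4 * \int[mu]_(r in `]0, 1[) (m r * Bt).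
  rewrite /Rintegral (_ : (\int[leb2]_z (weight z)%:E)%E = (4%:E * \int[mu]_(r in `]0%R, 1%R[) (m r * Bt)%:E)%E).
    by rewrite fineM//; exact: (integrable_fin_num _ iB).
  under eq_integral do rewrite -[weight _]mulr1.
  rewrite E1; congr (_ * _)%E; apply: eq_integral => r _.
  rewrite [RHS]EFinM -BtE; congr (_ * _)%E.
  by apply: eq_integral => t _; rewrite mulr1.
have F2 : \int[leb2]_z (weight z * (1 + cc z)) = 4 * \int[mu]_(r in `]0, 1[) (m r * (Bt + jj r)).
  rewrite /Rintegral E2 (_ : (\int[mu]_(r in _) _)%E = (\int[mu]_(r in `]0%R, 1%R[) (m r * (Bt + jj r))%:E)%E).
    by rewrite fineM//; exact: (integrable_fin_num _ iBj).
  by apply: eq_integral => r _; rewrite [RHS]EFinM -jjE.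
have E3 : \int[leb2]_z (weight z * (1 + cc z)) = \int[leb2]_z weight z + \int[leb2]_z (weight z * cc z).
  rewrite -RintegralD//; last exact: integrable_weight.
  by apply: eq_Rintegral => z _; ring.
have E4 : \int[mu]_(r in `]0, 1[) (m r * (Bt + jj r)) =
    \int[mu]_(r in `]0, 1[) (m r * Bt) + \int[mu]_(r in `]0, 1[) (m r * jj r).
  by rewrite -RintegralD//; apply: eq_Rintegral => z _; ring.
apply: (@addrI _ (\int[leb2]_z weight z)); rewrite -E3 F2 E4 F1; ring.
Qed.

Let itv01 (f : R -> R) : measurable_fun [set: R] f ->
  \int[mu]_(t in `[0, 1]) f t = \int[mu]_(t in `]0, 1[) f t.
Proof.
move=> mf; have mE : measurable_fun [set: R] (EFin \o f) by exact/measurable_EFinP.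
rewrite /Rintegral -integral_itv_obnd_cbnd; last exact: measurable_funTS.
by rewrite integral_itv_bndo_bndc//; exact: measurable_funTS.
Qed.

(** The inner integral of [J0] is the angular integral [jj], and the outer one supplies the radial
    density. The factor [p / 4] undoes the four quadrants and the [1 / p] contained in [m]. *)
Lemma integral_J0 :
  \int[mu]_(t in `[0, 1]) (J0 p (t *: eta) * t * (1 - t `^ p) `^ (b + 1 - 1)) =
  (Gamma q ^+ 2)^-1 * (2 / p) ^+ 2 * (p / 4) * \int[leb2]_z (weight z * cc z).
Proof.
have Gq0 : 0 < Gamma p^-1 by apply: Gamma_gt0.
have J0E r : J0 p (r *: eta) = (Gamma q ^+ 2)^-1 * (2 / p) ^+ 2 * jj r.
  rewrite /J0 -/q /jj; congr (_ * _).
  have mg : measurable_fun [set: R] (fun t => T t * cct r t) by exact: measurable_funM.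
  rewrite -itv01//; apply: eq_Rintegral => t _; rewrite /cct /cc /T /=.
  rewrite -[r *: eta.1]/(r * eta.1) -[r *: eta.2]/(r * eta.2).
  have -> : r * eta.1 * t `^ q = eta.1 * (r * t `^ q) by ring.
  have -> : r * eta.2 * (1 - t) `^ q = eta.2 * (r * (1 - t) `^ q) by ring.
  by ring.
have -> : \int[mu]_(t in `[0, 1]) (J0 p (t *: eta) * t * (1 - t `^ p) `^ (b + 1 - 1)) =
    \int[mu]_(t in `]0, 1[) ((Gamma q ^+ 2)^-1 * (2 / p) ^+ 2 * p * (m t * jj t)).
  rewrite -itv01; last by apply: measurable_funM => //; exact: measurable_funM.
  apply: eq_Rintegral => t _; rewrite J0E /m addrK /q; field.
  by rewrite (gt_eqF p0) (gt_eqF Gq0).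
rewrite RintegralZl// integral_weight_cos /q; field.
by rewrite (gt_eqF p0) (gt_eqF Gq0).
Qed.

End weight.

End weight_integral.

(** * Continuity of the weight; both kernels as values of its transform *)

Section dirichlet_kernel.
Context {R : realType}.
Local Notation mu := (@lebesgue_measure R).
Local Notation leb2 := (@lebesgue_measure R \x @lebesgue_measure R)%E.

Section continuity.

Lemma powR_continuous_gt0 (b y : R) : 0 < y -> {for y, continuous (fun u : R => u `^ b)}.
Proof.
move=> y0; apply/differentiable_continuous/derivable1_diffP; apply: derivable_powR.
by rewrite in_itv/= andbT.
Qed.

Lemma continuous_norm_powR (p : R) : 0 < p -> continuous (fun x : R => `|x| `^ p).
Proof.
move=> p0 x; have [->|x0] := eqVneq x 0.
  rewrite /continuous_at normr0 powR0 ?gt_eqF//; apply/cvgrPdist_lt => e e0.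
  have d0 : 0 < e `^ p^-1 by rewrite powR_gt0.
  apply/nbhs_ballP; exists (e `^ p^-1) => //= t; rewrite /ball/= sub0r normrN => tl.
  rewrite sub0r normrN ger0_norm ?powR_ge0//.
  have := @gt0_ltr_powR _ p p0 `|t| (e `^ p^-1).
  rewrite !nnegrE normr_ge0 powR_ge0 => /(_ isT isT tl).
  by rewrite -powRrM mulVf ?gt_eqF// powRr1 ?ltW.
apply: (@continuous_comp _ _ _ (fun x : R => `|x|) (fun u : R => u `^ p)).
  exact: norm_continuous.
by apply: powR_continuous_gt0; rewrite normr_gt0.
Qed.

Lemma cont_at_continuous (D : R * R -> R) z0 : {for z0, continuous D} -> cont_at D z0.
Proof.
move=> /cvgrPdist_lt h e e0; have /nbhs_ballP[del /= del0 hb] := h e e0.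
exists del => // z h1 h2; rewrite distrC; apply: hb.
by split; rewrite /ball/= distrC.
Qed.

Variables (p b : R) (p0 : 0 < p).
Let N (z : R * R) : R := `|z.1| `^ p + `|z.2| `^ p.

Lemma continuous_pnormX : continuous N.
Proof.
move=> z; apply: cvgD.
  apply: (@continuous_comp _ _ _ (@fst R R) (fun x : R => `|x| `^ p)); first exact: cvg_fst.
  exact: continuous_norm_powR.
apply: (@continuous_comp _ _ _ (@snd R R) (fun x : R => `|x| `^ p)); first exact: cvg_snd.
exact: continuous_norm_powR.
Qed.

Lemma weight_continuous z : N z != 1 -> {for z, continuous (weight p b)}.
Proof.
rewrite neq_lt => /orP[Nz|Nz].
  rewrite /prop_for /continuous_at {2}/weight -/(N z) Nz.
  apply: (@cvg_trans _ ((fun t => (1 - N t) `^ b) @ z)).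
    have hN : \forall t \near nbhs z, N t < 1 by apply: (@cvgr_lt _ _ (nbhs z) _ N (N z)) => //; exact: continuous_pnormX.
    by apply: near_eq_cvg; apply: filterS hN => t Nt; rewrite /weight -/(N t) Nt.
  apply: (@continuous_comp _ _ _ (fun t => 1 - N t) (fun u : R => u `^ b)).
    by apply: cvgB; [exact: cvg_cst|exact: continuous_pnormX].
  by apply: powR_continuous_gt0; rewrite subr_gt0.
rewrite /prop_for /continuous_at {2}/weight -/(N z) ltNge (ltW Nz)/=.
have hN : \forall t \near nbhs z, 1 < N t by apply: (@cvgr_gt _ _ (nbhs z) _ N (N z)) => //; exact: continuous_pnormX.
apply/cvgrPdist_lt => e e0; apply: filterS hN => t Nt.
by rewrite /weight -/(N t) (ltNge (N t)) (ltW Nt)/= subrr normr0.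
Qed.

(* Moving outwards along the diagonal leaves the p-sphere at once, so the
   boundary jump (or pole) of the weight is never met. *)
Lemma weight_outward (c : R * R -> R) z0 : continuous c -> 0 <= z0.1 -> 0 <= z0.2 ->
  let h z := weight p b z * c z in
  forall e : R, 0 < e -> exists2 del : R, 0 < del & forall ep, 0 < ep < del ->
    cont_at h (z0.1 + ep, z0.2 + ep) /\ `|h (z0.1 + ep, z0.2 + ep) - h z0| < e.
Proof.
move=> cc z1 z2 h e e0.
have ch z : N z != 1 -> cont_at h z.
  move=> Nz; apply: cont_at_continuous.
  by apply: cvgM; [exact: weight_continuous|exact: cc].
have [Nz|Nz] := ltP (N z0) 1.
  have e1 : 0 < 1 - N z0 by rewrite subr_gt0.
  have Nz1 : N z0 != 1 by rewrite lt_eqF.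
  have [d1 d10 H1] := ch _ Nz1 _ e0.
  have [d2 d20 H2] := cont_at_continuous (continuous_pnormX (x:=z0)) e1.
  exists (Num.min d1 d2); first by rewrite lt_min d10.
  move=> ep /andP[ep0]; rewrite lt_min => /andP[ep1 ep2].
  have dE (x : R) : `|x + ep - x| = ep by rewrite addrAC subrr add0r gtr0_norm.
  split; last by apply: H1; rewrite /= dE.
  apply: ch; rewrite lt_eqF//.
  have := H2 (z0.1 + ep, z0.2 + ep); rewrite /= !dE => /(_ ep2 ep2).
  by rewrite ltr_norml => /andP[_]; rewrite ltrD2r.
exists 1 => // ep /andP[ep0 _].
have lt1 (x : R) : 0 <= x -> `|x| `^ p < `|x + ep| `^ p.
  move=> x0; rewrite ger0_norm// ger0_norm; last by rewrite addr_ge0// ltW.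
  by apply: gt0_ltr_powR => //; rewrite ?nnegrE ?ltrDl// addr_ge0// ltW.
have Ne : 1 < N (z0.1 + ep, z0.2 + ep).
  by apply: le_lt_trans Nz _; rewrite /N/= ltrD ?lt1.
split; first by apply: ch; rewrite gt_eqF.
rewrite /h /weight/= -/(N z0) -/(N (z0.1 + ep, z0.2 + ep)).
by rewrite (ltNge (N z0)) Nz (ltNge (N _)) (ltW Ne)/= !mul0r subrr normr0.
Qed.

End continuity.

Lemma Rintegral_odd1 (F : R * R -> R) : leb2.-integrable setT (EFin \o F) ->
  (forall u v, F (- u, v) = - F (u, v)) -> \int[leb2]_z F z = 0.
Proof.
move=> iF oF; have m1 : -1 != 0 :> R by rewrite oppr_eq0 oner_eq0.
have := Rintegral_scale2 m1 (oner_neq0 R) iF.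
rewrite mulr1 normrN1 invr1 mul1r => E.
have : \int[leb2]_z F z = - \int[leb2]_z F z.
  rewrite -{1}E -[in RHS]mulN1r -RintegralZl//; apply: eq_Rintegral => z _.
  by rewrite mulN1r mul1r oF mulN1r; case: z.
lra.
Qed.

Lemma Rintegral_odd2 (F : R * R -> R) : leb2.-integrable setT (EFin \o F) ->
  (forall u v, F (u, - v) = - F (u, v)) -> \int[leb2]_z F z = 0.
Proof.
move=> iF oF; have m1 : -1 != 0 :> R by rewrite oppr_eq0 oner_eq0.
have := Rintegral_scale2 (oner_neq0 R) m1 iF.
rewrite mul1r normrN1 invr1 mul1r => E.
have : \int[leb2]_z F z = - \int[leb2]_z F z.
  rewrite -{1}E -[in RHS]mulN1r -RintegralZl//; apply: eq_Rintegral => z _.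
  by rewrite mulN1r mul1r oF mulN1r; case: z.
lra.
Qed.

Lemma pnormZ (p c : R) (y : R * R) : 0 < p -> 0 <= c -> pnorm p (c *: y) = c * pnorm p y.
Proof.
move=> p0 c0; rewrite /pnorm/= -![(_ *: _ : R)]/(_ * _) !normrM (ger0_norm c0) !powRM// -mulrDr.
by rewrite powRM ?powR_ge0 ?addr_ge0 ?powR_ge0// -powRrM mulfV ?gt_eqF// powRr1.
Qed.

Section dirichlet.
Variables (p b : R) (p0 : 0 < p) (b1 : -1 < b).
Let w := weight p b.
Let intw : leb2.-integrable setT (EFin \o w).
Proof. exact: integrable_weight. Qed.

Let mcos2 (c d : R) : measurable_fun [set: R * R] (fun z : R * R => cos (c * z.1) * cos (d * z.2)).
Proof.
apply: measurable_funM.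
  exact: (measurableT_comp (measurable_cosM c) measurable_fst).
exact: (measurableT_comp (measurable_cosM d) measurable_snd).
Qed.

Section scaled.
Variables (s : R) (s0 : 0 < s).
Let lam := s `^ p^-1.
Let lam0 : 0 < lam. Proof. by rewrite powR_gt0. Qed.
Let lamp : lam `^ p = s.
Proof. by rewrite -powRrM mulVf ?gt_eqF// powRr1// ltW. Qed.

Lemma weight_scale (z : R * R) : s `^ b * w (lam^-1 * z.1, lam^-1 * z.2) =
  if `|z.1| `^ p + `|z.2| `^ p < s then (s - (`|z.1| `^ p + `|z.2| `^ p)) `^ b else 0.
Proof.
have E (x : R) : `|lam^-1 * x| `^ p = `|x| `^ p / s.
  have il : `|lam^-1| = lam^-1 by rewrite gtr0_norm// invr_gt0.
  rewrite normrM il powRM//; last by rewrite invr_ge0 ltW.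
  rewrite mulrC; congr (_ * _).
  by rewrite -powR_inv1 ?(ltW lam0)// -powRrM mulrC powRrM lamp powR_inv1// ltW.
rewrite /w /weight/= !E -mulrDl ltr_pdivrMr// mul1r.
case: ifP => h; last by rewrite mulr0.
rewrite -powRM ?(ltW s0)//; last by rewrite subr_ge0 ler_pdivrMr// mul1r ltW.
by congr (_ `^ _); rewrite mulrBr mulr1 mulrC divfK// gt_eqF.
Qed.

Lemma powR_lam2 : s `^ (b + 2 / p) = s `^ b * lam ^+ 2.
Proof.
rewrite powRD ?(gt_eqF s0) ?implybT//; congr (_ * _).
by rewrite -powR_mulrn ?ltW// -powRrM mulrC.
Qed.

Lemma integral_ball_scale (k : R -> R) (x : R * R) : measurable_fun [set: R] k ->
  (forall t, `|k t| <= 1) ->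
  \int[leb2]_(z in [set z | pnorm p z `^ p < s]) ((s - pnorm p z `^ p) `^ b * k (2 * pi * dot x z)) =
  s `^ (b + 2 / p) *
  \int[leb2]_z (w z * k (2 * pi * (lam * x.1) * z.1 + 2 * pi * (lam * x.2) * z.2)).
Proof.
move=> mk k1.
pose c (z : R * R) := k (2 * pi * (lam * x.1) * z.1 + 2 * pi * (lam * x.2) * z.2).
have mc : measurable_fun [set: R * R] c.
  apply: (measurableT_comp mk); apply: measurable_funD.
    by apply: measurable_funM.
  by apply: measurable_funM.
have iF : leb2.-integrable setT (EFin \o (fun z => w z * c z)).
  exact: (integrable_mul_bounded measurableT intw mc (fun z => k1 _)).
have iF' : leb2.-integrable setT (EFin \o (fun z => s `^ b * (w z * c z))).
  exact: integrableZl_EFin.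
have l0 : lam^-1 != 0 by rewrite invr_eq0 gt_eqF.
have := Rintegral_scale2 l0 l0 iF'.
rewrite [X in _ = _ * X]RintegralZl// => E.
rewrite powR_lam2 Rintegral_mkcond.
transitivity (`|lam^-1 * lam^-1|^-1 * (s `^ b * \int[leb2]_x0 (w x0 * c x0))).
  rewrite -E; apply: eq_Rintegral => z _; rewrite mulrA weight_scale patchE.
  rewrite (_ : (z \in _) = (`|z.1| `^ p + `|z.2| `^ p < s)); last first.
    by apply/idP/idP; rewrite inE/= pnorm_powR.
  case: ifP => _; last by rewrite mul0r.
  rewrite pnorm_powR// /c; congr (_ * k _); rewrite /dot/=; field.
  by rewrite gt_eqF.
rewrite ger0_norm; last by rewrite mulr_ge0 ?invr_ge0 ?ltW.
by rewrite -invfM invrK -expr2 mulrCA mulrA.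
Qed.

End scaled.

Lemma integrable_weight_cos (c d : R) : leb2.-integrable setT (EFin \o (fun z : R * R => w z * (cos (c * z.1) * cos (d * z.2)))).
Proof.
apply: (integrable_mul_bounded measurableT intw (mcos2 c d) (M := 1)) => z.
by rewrite normrM -(mulr1 1) ler_pM// cos_max.
Qed.

Let msinM (c : R) : measurable_fun [set: R] (fun t : R => sin (c * t)).
Proof.
apply: continuous_measurable_fun => t; apply: continuous_comp.
  exact: mulrl_continuous.
exact: continuous_sin.
Qed.

Let iss (k1 k2 : R -> R) : measurable_fun [set: R] k1 -> measurable_fun [set: R] k2 ->
  (forall t, `|k1 t| <= 1) -> (forall t, `|k2 t| <= 1) ->
  leb2.-integrable setT (EFin \o (fun z : R * R => w z * (k1 z.1 * k2 z.2))).
Proof.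
move=> m1 m2 h1 h2.
have mk : measurable_fun [set: R * R] (fun z : R * R => k1 z.1 * k2 z.2).
  apply: measurable_funM.
    exact: (measurableT_comp m1 measurable_fst).
  exact: (measurableT_comp m2 measurable_snd).
apply: (integrable_mul_bounded measurableT intw mk (M := 1)) => z.
by rewrite normrM -(mulr1 1) ler_pM.
Qed.

Lemma integral_weight_cosD (c d : R) : \int[leb2]_z (w z * cos (c * z.1 + d * z.2)) =
  \int[leb2]_z (w z * (cos (c * z.1) * cos (d * z.2))).
Proof.
have i1 := integrable_weight_cos c d.
have i2 := iss (msinM c) (msinM d) (fun=> sin_max _) (fun=> sin_max _).
under eq_Rintegral do rewrite cosD mulrBr.
rewrite RintegralB// (Rintegral_odd1 i2) ?subr0// => u v.
by rewrite /w weightN1/= mulrN sinN mulNr mulrN.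
Qed.

Lemma integral_weight_sinD (c d : R) : \int[leb2]_z (w z * sin (c * z.1 + d * z.2)) = 0.
Proof.
have i1 := iss (msinM c) (measurable_cosM d) (fun=> sin_max _) (fun=> cos_max _).
have i2 := iss (measurable_cosM c) (msinM d) (fun=> cos_max _) (fun=> sin_max _).
under eq_Rintegral do rewrite sinD mulrDr.
rewrite RintegralD// (Rintegral_odd1 i1) ?(Rintegral_odd2 i2) ?addr0// => u v.
  by rewrite /w weightN2/= mulrN sinN !mulrN.
by rewrite /w weightN1/= mulrN sinN mulNr mulrN.
Qed.

(** The imaginary part and the product of sines in the real part vanish because the weight is even
    in each coordinate. *)
Lemma DintE s x : 0 < s -> Dint p b s x = ((Gamma (b + 1))^-1 *
  (s `^ (b + 2 / p) * cosft w (s `^ p^-1 * x.1, s `^ p^-1 * x.2)))%:C%C.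
Proof.
move=> s0; rewrite /Dint /Cintegral.
have ReE (r t : R) : complex.Re (r%:C%C * expi t) = r * cos t.
  by rewrite /expi/= mul0r subr0.
have ImE (r t : R) : complex.Im (r%:C%C * expi t) = r * sin t.
  by rewrite /expi/= mul0r addr0.
under eq_Rintegral do rewrite ReE.
under [X in (_ +i* X)%C]eq_Rintegral do rewrite ImE.
have mcos : measurable_fun [set: R] (@cos R) by exact: (continuous_measurable_fun (@continuous_cos R)).
have msin : measurable_fun [set: R] (@sin R) by exact: (continuous_measurable_fun (@continuous_sin R)).
rewrite (integral_ball_scale s0 _ mcos (@cos_max R)).
rewrite (integral_ball_scale s0 _ msin (@sin_max R)).
rewrite integral_weight_cosD integral_weight_sinD mulr0 /cosft/=.
by apply/eqP; rewrite eq_complex/= !mul0r mulr0 subr0 addr0 !eqxx.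
Qed.

(** Off [x = n] the power of the p-norm in [J] cancels the denominator. At [x = n] the constant
    [J0 p 0] is [J0] along the degenerate ray through 0, so both branches reduce to
    [integral_J0]. *)
Lemma Jterm_cosft s x n : 0 < s -> p `^ (b + 1) * Gamma p^-1 ^+ 2 * Jterm p b s x n =
  (Gamma (b + 1))^-1 *
  cosft w (s `^ p^-1 * (x.1 - n.1%:~R), s `^ p^-1 * (x.2 - n.2%:~R)).
Proof.
move=> s0; set lam := s `^ p^-1; have lam0 : 0 < lam by rewrite powR_gt0.
have Gq : 0 < Gamma p^-1 by apply: Gamma_gt0; rewrite invr_gt0.
have Gb : 0 < Gamma (b + 1) by apply: Gamma_gt0; rewrite -ltrBlDr sub0r.
have pb : 0 < p `^ b by rewrite powR_gt0.
have pE : p `^ (b + 1) = p `^ b * p.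
  by rewrite powRD ?(gt_eqF p0) ?implybT// powRr1// ltW.
pose y := x - lattice_pt n; pose c := 2 * pi * lam.
have c0 : 0 < c by rewrite !mulr_gt0// pi_gt0.
have gE : cosft w (lam * (x.1 - n.1%:~R), lam * (x.2 - n.2%:~R)) =
    \int[leb2]_z (weight p b z * (cos ((c *: y).1 * z.1) * cos ((c *: y).2 * z.2))).
  apply: eq_Rintegral => z _; rewrite /w /y /c /=.
  rewrite -![(_ *: _ : R)]/(_ * _).
  by congr (_ * (cos _ * cos _)); ring.
have := integral_J0 p0 b1 (c *: y); rewrite -gE => E.
rewrite /Jterm -/lam -/c -/y; case: ifP => [/eqP y0|y0].
  rewrite /Jquot0.
  have -> : \int[mu]_(t in `[0, 1]) (J0 p 0 * t * (1 - t `^ p) `^ (b + 1 - 1)) =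
     \int[mu]_(t in `[0, 1]) (J0 p (t *: (c *: y)) * t * (1 - t `^ p) `^ (b + 1 - 1)).
    by apply: eq_Rintegral => t _; rewrite y0 !scaler0.
  rewrite E addrK pE; field.
  by rewrite (gt_eqF p0) (gt_eqF Gq) (gt_eqF Gb) (gt_eqF pb).
have ny : 0 < c * pnorm p y.
  rewrite mulr_gt0// /pnorm powR_gt0// lt_neqAle addr_ge0 ?powR_ge0// andbT eq_sym.
  rewrite paddr_eq0 ?powR_ge0// !powR_eq0 !normr_eq0 (gt_eqF p0)/= !andbT.
  apply/negP => /andP[/eqP y1 /eqP y2].
  have yE : (y.1, y.2) = (0, 0) :> R * R by congr pair; [exact: y1|exact: y2].
  have /eqP : y = 0 by rewrite (surjective_pairing y); exact: yE.
  by rewrite y0.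
have nE := pnormZ y p0 (ltW c0).
have np : 0 < (c * pnorm p y) `^ (b + 1) by rewrite powR_gt0.
rewrite /J nE E addrK pE; field.
by rewrite (gt_eqF p0) (gt_eqF Gq) (gt_eqF Gb) (gt_eqF pb) (gt_eqF np).
Qed.

Lemma integrable_cosft : Cintegrable setT (fun x : R * R => Dint p b 1 x) ->
  leb2.-integrable setT (EFin \o cosft w).
Proof.
move=> [iD _]; have Gb : 0 < Gamma (b + 1) by apply: Gamma_gt0; rewrite -ltrBlDr sub0r.
have := integrableZl_EFin measurableT (Gamma (b + 1)) iD.
have E (x : R * R) : Gamma (b + 1) * complex.Re (Dint p b 1 x) = cosft w x.
  rewrite DintE// [complex.Re _]/= !powR1 !mul1r mulrA divff ?gt_eqF// mul1r.
  by case: x.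
by congr (leb2.-integrable setT _); apply/funext => x; exact: (congr1 EFin (E x)).
Qed.

End dirichlet.

End dirichlet_kernel.

(** * Poisson summation *)

Section poisson_formula.
Context {R : realType}.
Local Notation leb2 := (@lebesgue_measure R \x @lebesgue_measure R)%E.

Lemma has_sum_seq (T : choiceType) (I : eqType) (r : seq I) (f : I -> T -> R) (l : I -> R) :
  (forall i, i \in r -> has_sum setT (f i) (l i)) ->
  has_sum setT (fun t => \sum_(i <- r) f i t) (\sum_(i <- r) l i).
Proof.
elim: r => [_|i r ih h].
  move=> e e0; exists set0; split => // F _ _ _.
  by rewrite big_nil subr0 fsbig1 ?normr0// => t _; rewrite big_nil.
rewrite big_cons; apply: (@eq_has_sum _ _ _ (fun t => f i t + \sum_(j <- r) f j t)).
  by move=> t _; rewrite big_cons.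
apply: has_sumD; first by apply: h; rewrite mem_head.
by apply: ih => j jr; apply: h; rewrite in_cons jr orbT.
Qed.

(** * Orthogonality of characters on a centred grid *)

Section discrete_orthogonality.

Let sinpi0 (n : int) : sin (n%:~R * pi) = 0 :> R. Proof. exact: sin_intpi. Qed.

Let cos2_intpi (n : int) : cos (n%:~R * pi) ^+ 2 = 1 :> R.
Proof. by rewrite cos2sin2 sinpi0 expr0n/= subr0. Qed.

Lemma cos_2intpi (n : int) : cos (2 * pi * n%:~R) = 1 :> R.
Proof.
have -> : 2 * pi * n%:~R = (n%:~R * pi) *+ 2 :> R by rewrite mulr2n; ring.
by rewrite cos_mulr2n cos2_intpi mulr2n addrK.
Qed.

(** Removing multiples of [K] from [n] changes the sine only by a sign, and the remainder puts the
    angle strictly between 0 and [pi]. *)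
Lemma sin_intdiv_neq0 (n : int) (K : nat) : (0 < K)%N -> ~~ (K%:Z %| n)%Z ->
  sin (pi * n%:~R / K%:R) != 0 :> R.
Proof.
move=> K0 nK; have K0' : (0 : R) < K%:R by rewrite ltr0n.
have r0 : 0 < (n %% K%:Z)%Z.
  rewrite lt_neqAle modz_ge0 ?andbT ?eqz_nat -?lt0n// eq_sym.
  by apply: contra nK => /eqP h; apply/dvdz_mod0P.
have rK : (n %% K%:Z)%Z < K%:Z by rewrite ltz_pmod.
have nE : pi * n%:~R / K%:R = (n %/ K%:Z)%Z%:~R * pi + pi * (n %% K%:Z)%Z%:~R / K%:R :> R.
  rewrite {1}(divz_eq n K%:Z) intrD intrM -pmulrn; field.
  by rewrite gt_eqF.
rewrite nE sinD sinpi0 mul0r add0r mulf_neq0//.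
  by rewrite -sqrf_eq0 cos2_intpi oner_eq0.
rewrite gt_eqF// sin_gt0_pi//; apply/andP; split.
  by rewrite divr_gt0 ?mulr_gt0 ?pi_gt0// ltr0z.
by rewrite ltr_pdivrMr// ltr_pM2l ?pi_gt0// pmulrn ltr_int.
Qed.

(** Multiplied by [2 * sin (th / 2)] the sum telescopes. The range is centred and of odd length, so
    the end angles are exactly [n * pi] and [- n * pi], where the sine vanishes. *)
Lemma sum_cos_centered (M : nat) (n : int) :
  \sum_(0 <= i < M.*2.+1) cos (2 * pi * n%:~R / M.*2.+1%:R * (i%:Z - M%:Z)%:~R) =
  M.*2.+1%:R * ((M.*2.+1)%:Z %| n)%Z%:R :> R.
Proof.
set K := M.*2.+1; have K0 : (0 : R) < K%:R by rewrite ltr0n.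
have KE : K%:R = 2 * M%:R + 1 :> R by rewrite /K -natr1 -muln2 natrM mulrC.
have [/dvdzP[q ->]|nK] := boolP (K%:Z %| n)%Z.
  rewrite mulr1.
  rewrite (eq_bigr (fun=> 1)) => [|i _]; first by rewrite sumr_const_nat subn0.
  rewrite -[RHS](cos_2intpi (q * (i%:Z - M%:Z))); congr cos.
  by rewrite !intrM -[K%:Z%:~R]pmulrn; field; rewrite gt_eqF.
set th := 2 * pi * n%:~R / K%:R.
have s0 : sin (th / 2) != 0.
  have -> : th / 2 = pi * n%:~R / K%:R by rewrite /th; field; rewrite gt_eqF.
  exact: sin_intdiv_neq0.
have tel k : 2 * sin (th / 2) * \sum_(0 <= i < k) cos (th * (i%:Z - M%:Z)%:~R) =
    sin (th * (k%:R - M%:R) - th / 2) - sin (th * (0 - M%:R) - th / 2).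
  elim: k => [|k ih]; first by rewrite big_geq// mulr0 subrr.
  rewrite big_nat_recr//= mulrDr ih intrB -!pmulrn -[k.+1%:R]natr1.
  have -> : th * (k%:R + 1 - M%:R) - th / 2 = th * (k%:R - M%:R) + th / 2 by field.
  rewrite (sinB (th * (k%:R - M%:R))) (sinD (th * (k%:R - M%:R)) (th / 2)); ring.
have s2 : 2 * sin (th / 2) != 0 by rewrite mulf_neq0// pnatr_eq0.
rewrite mulr0; apply: (mulfI s2); rewrite mulr0 tel.
have -> : th * (0 - M%:R) - th / 2 = - (n%:~R * pi).
  by rewrite /th KE; field; rewrite -KE gt_eqF.
have -> : th * (K%:R - M%:R) - th / 2 = n%:~R * pi.
  by rewrite /th KE; field; rewrite -KE gt_eqF.
by rewrite sinN sinpi0 oppr0 subrr.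
Qed.

Lemma sum_grid_cos (M : nat) (n : int * int) :
  \sum_(m <- grid M) cos (2 * pi * n.1%:~R / M.*2.+1%:R * m.1%:~R) *
    cos (2 * pi * n.2%:~R / M.*2.+1%:R * m.2%:~R) =
  M.*2.+1%:R ^+ 2 * (((M.*2.+1)%:Z %| n.1)%Z && ((M.*2.+1)%:Z %| n.2)%Z)%:R :> R.
Proof.
rewrite big_grid.
transitivity (\sum_(0 <= i < M.*2.+1) \sum_(0 <= j < M.*2.+1)
    cos (2 * pi * n.1%:~R / M.*2.+1%:R * (i%:Z - M%:Z)%:~R) *
    cos (2 * pi * n.2%:~R / M.*2.+1%:R * (j%:Z - M%:Z)%:~R) : R); first by [].
under eq_bigr do rewrite -mulr_sumr sum_cos_centered.
by rewrite -mulr_suml sum_cos_centered -mulnb natrM; ring.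
Qed.

End discrete_orthogonality.

Section grid_symmetry.

Lemma big_grid_perm (M : nat) (f : int * int -> R) (sg : int * int -> int * int) :
  involutive sg -> (forall n, (sg n \in grid M) = (n \in grid M)) ->
  \sum_(n <- grid M) f (sg n) = \sum_(n <- grid M) f n.
Proof.
move=> sgK sgM; have sgI := inv_inj sgK.
rewrite -(big_map sg xpredT f); apply: perm_big; apply: uniq_perm.
- by rewrite map_inj_uniq// grid_uniq.
- exact: grid_uniq.
- by move=> n; rewrite -[n]sgK mem_map// sgM.
Qed.

Lemma big_grid_odd1 (M : nat) (f : int * int -> R) :
  (forall n, f (- n.1, n.2) = - f n) -> \sum_(n <- grid M) f n = 0.
Proof.
move=> odd; have := @big_grid_perm M f (fun n => (- n.1, n.2)).
have -> : \sum_(n <- grid M) f (- n.1, n.2) = - \sum_(n <- grid M) f n.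
  by rewrite -sumrN; apply: eq_bigr => n _.
move=> H; suff : - \sum_(n <- grid M) f n = \sum_(n <- grid M) f n by lra.
apply: H => [[n1 n2]|n]; first by rewrite /= opprK.
by rewrite !mem_grid/= abszN.
Qed.

Lemma big_grid_odd2 (M : nat) (f : int * int -> R) :
  (forall n, f (n.1, - n.2) = - f n) -> \sum_(n <- grid M) f n = 0.
Proof.
move=> odd; have := @big_grid_perm M f (fun n => (n.1, - n.2)).
have -> : \sum_(n <- grid M) f (n.1, - n.2) = - \sum_(n <- grid M) f n.
  by rewrite -sumrN; apply: eq_bigr => n _.
move=> H; suff : - \sum_(n <- grid M) f n = \sum_(n <- grid M) f n by lra.
apply: H => [[n1 n2]|n]; first by rewrite /= opprK.
by rewrite !mem_grid/= abszN.
Qed.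

End grid_symmetry.

(** * Poisson summation for the modulated weight *)

Section poisson.
Variables (p b : R) (p0 : 0 < p) (b1 : -1 < b).
Let w := weight p b.
Let intw : leb2.-integrable setT (EFin \o w).
Proof. exact: integrable_weight. Qed.
Hypothesis (intg : leb2.-integrable setT (EFin \o cosft w)).
Let suppw z : w z != 0 -> `|z.1| <= 1 /\ `|z.2| <= 1.
Proof. exact: weight_supp. Qed.
Let g := cosft w.

Lemma cosftN1 u v : g (- u, v) = g (u, v).
Proof. by apply: eq_Rintegral => z _; rewrite /= mulrN mulNr cosN. Qed.

Lemma cosftN2 u v : g (u, - v) = g (u, v).
Proof. by apply: eq_Rintegral => z _; rewrite /= mulrN !mulNr cosN. Qed.

Variables (lam : R) (lam0 : 0 < lam) (x : R * R).

(** The four sign choices arise when the modulating cosines are multiplied by a cosine mode and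
    expanded by product-to-sum formulas. *)
Let gs (s1 s2 : bool) (m : R) (n : int * int) : R :=
  g (lam * x.1 + (-1) ^+ s1 * (m * n.1%:~R), lam * x.2 + (-1) ^+ s2 * (m * n.2%:~R)).

Lemma signed_lattice_summable s1 s2 m : 0 < m -> exists C : R,
  forall F : set (int * int), finite_set F -> \sum_(n \in F) `|gs s1 s2 m n| <= C.
Proof.
move=> m0.
pose y : R * R := (if s1 then lam * x.1 else - (lam * x.1), if s2 then lam * x.2 else - (lam * x.2)).
have [C hC] := cosft_lattice_summable intw suppw intg y m0.
exists C => F finF; apply: le_trans (hC F finF); rewrite le_eqVlt; apply/orP; left; apply/eqP.
apply: eq_fsbigr => n _; congr (`|_|); rewrite /gs /y -/g.
have E (c d : R) : c + d = - (- c - d) by ring.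
case: (s1); case: (s2) => /=; rewrite ?expr1 ?expr0 ?mulN1r ?mul1r//.
- by rewrite [lam * x.2 + _]E cosftN2.
- by rewrite [lam * x.1 + _]E cosftN1.
- by rewrite [lam * x.1 + _]E [lam * x.2 + _]E cosftN1 cosftN2.
Qed.

Lemma cosft_has_sum : exists T, has_sum setT
  (fun n : int * int => g (lam * (x.1 - n.1%:~R), lam * (x.2 - n.2%:~R))) T.
Proof.
have [C hC] := signed_lattice_summable true true lam0.
have [T hT] := has_sum_abs hC; exists T; apply: eq_has_sum hT => n _.
by rewrite /gs !expr1 !mulN1r -!mulrBr.
Qed.

Lemma has_sum_signs s1 s2 T : has_sum setT (gs true true lam) T ->
  has_sum setT (gs s1 s2 lam) T.
Proof.
move=> h; pose sg (s : bool) (k : int) := if s then k else - k.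
have sgK s : involutive (sg s) by move=> k; rewrite /sg; case: s; rewrite ?opprK.
pose f (n : int * int) := (sg s1 n.1, sg s2 n.2).
have fK : involutive f by move=> [n1 n2]; rewrite /f/= !sgK.
have := has_sum_inj (inv_inj fK) _ h.
(* An involution is onto, so the condition outside its range is vacuous. *)
move=> /(_ (fun n nf => False_ind _ (nf (ex_intro2 _ _ (f n) I (fK n))))).
apply: eq_has_sum => n _; rewrite /gs /f /sg /=.
by case: (s1); case: (s2); rewrite /= ?expr1 ?expr0 ?mulrNz ?mulrN ?mulN1r ?opprK ?mul1r.
Qed.

(** At [z = lam^-1 * k] the modulation takes the values [cos (2 * pi * x.1 * k.1)] and
    [cos (2 * pi * x.2 * k.2)], where [lam] has disappeared. *)
Let h (z : R * R) : R := w z * (cos (2 * pi * (lam * x.1) * z.1) * cos (2 * pi * (lam * x.2) * z.2)).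

Variables (M : nat) (lamM : lam <= M%:R).
(** On the scale where the ball has radius 1 the lattice has mesh [1 / lam], and the half-side
    [pi / a] of the box equals [(M + 1/2) / lam]. The extra 1/2 keeps the outermost grid points
    strictly inside the box, as the cosine series requires; [lam <= M] makes the box contain the
    ball. *)
Let K : R := M.*2.+1%:R.
Let m := lam / K.
Let a := 2 * pi * m.
Let K0 : 0 < K. Proof. by rewrite ltr0n. Qed.
Let m0 : 0 < m. Proof. by rewrite divr_gt0. Qed.
Let a0 : 0 < a. Proof. by apply: mulr_gt0 m0; apply: mulr_gt0 => //; exact: pi_gt0. Qed.
Let KE : K = 2 * M%:R + 1. Proof. by rewrite /K -natr1 -muln2 natrM mulrC. Qed.
Let K1 : 1 + M.*2%:R != 0 :> R. Proof. by rewrite nat1r pnatr_eq0. Qed.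
Let pi0 : 0 < pi :> R. Proof. exact: pi_gt0. Qed.
Let LE : pi / a = K / (2 * lam).
Proof.
have E (t u v : R) : t != 0 -> u != 0 -> v != 0 -> t / (2 * t * (u / v)) = v / (2 * u).
  by move=> t0 u0 v0; field; rewrite ?t0 ?u0 ?v0.
by apply: E; rewrite gt_eqF.
Qed.
Let L1 : 1 <= pi / a.
Proof. by rewrite LE ler_pdivlMr ?mulr_gt0// mul1r KE; move: lamM; lra. Qed.

Let ih : leb2.-integrable setT (EFin \o h).
Proof. exact: integrable_weight_cos. Qed.

(** The weight vanishes outside the box, so a coefficient is an integral over the whole plane and
    hence a mean of four values of the transform. *)
Lemma coef_cosft n : coef a h n =
  4^-1 * (gs false false m n + gs false true m n + (gs true false m n + gs true true m n)).
Proof.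
rewrite /coef Rintegral_mkcond.
pose f (s1 s2 : bool) (z : R * R) : R :=
  w z * (cos (2 * pi * (lam * x.1 + (-1) ^+ s1 * (m * n.1%:~R)) * z.1) *
         cos (2 * pi * (lam * x.2 + (-1) ^+ s2 * (m * n.2%:~R)) * z.2)).
have fi s1 s2 : leb2.-integrable setT (EFin \o f s1 s2) by exact: integrable_weight_cos.
have i1 := integrableD_EFin measurableT (fi false false) (fi false true).
have i2 := integrableD_EFin measurableT (fi true false) (fi true true).
have i3 := integrableD_EFin measurableT i1 i2.
transitivity (\int[leb2]_z (4^-1 * (f false false z + f false true z + (f true false z + f true true z)))).
  apply: eq_Rintegral => z _; rewrite patchE.
  have [w0|w0] := eqVneq (w z) 0.
    by rewrite /f /h w0 !mul0r !addr0 mulr0; case: ifP.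
  have [z1 z2] := suppw w0.
  rewrite ifT; last first.
    by rewrite inE; split; rewrite /= in_itv/= -ler_norml (le_trans _ L1).
  have E (c d : R) : cos c * cos d = 2^-1 * (cos (c + d) + cos (c - d)).
    by rewrite cosB cosD; field.
  rewrite /h /cos2 /f /= !expr0 !expr1 !mul1r !mulN1r.
  have E1 : cos (2 * pi * (lam * x.1) * z.1) * cos (n.1%:~R * a * z.1) =
     2^-1 * (cos (2 * pi * (lam * x.1 + m * n.1%:~R) * z.1) + cos (2 * pi * (lam * x.1 - m * n.1%:~R) * z.1)).
    by rewrite E; congr (_ * (cos _ + cos _)); rewrite /a; ring.
  have E2 : cos (2 * pi * (lam * x.2) * z.2) * cos (n.2%:~R * a * z.2) =
     2^-1 * (cos (2 * pi * (lam * x.2 + m * n.2%:~R) * z.2) + cos (2 * pi * (lam * x.2 - m * n.2%:~R) * z.2)).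
    by rewrite E; congr (_ * (cos _ + cos _)); rewrite /a; ring.
  rewrite -mulrA mulrACA E1 E2.
  set c1 := cos _; set c2 := cos _; set c3 := cos _; set c4 := cos _.
  by field.
rewrite RintegralZl// RintegralD// !RintegralD//.
Qed.

Lemma coef_summable : exists C : R,
  forall F : set (int * int), finite_set F -> \sum_(n \in F) `|coef a h n| <= C.
Proof.
have [C1 h1] := signed_lattice_summable false false m0.
have [C2 h2] := signed_lattice_summable false true m0.
have [C3 h3] := signed_lattice_summable true false m0.
have [C4 h4] := signed_lattice_summable true true m0.
exists (C1 + C2 + (C3 + C4)) => F finF.
apply: le_trans (lerD (lerD (h1 F finF) (h2 F finF)) (lerD (h3 F finF) (h4 F finF))).
rewrite -!fsbig_split//=; apply: ler_fsum => // n _; rewrite coef_cosft normrM.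
rewrite ger0_norm//.
set A := gs false false m n; set B := gs false true m n.
set A' := gs true false m n; set B' := gs true true m n.
have := ler_normD (A + B) (A' + B'); have := ler_normD A B; have := ler_normD A' B'.
have := normr_ge0 A; have := normr_ge0 B; have := normr_ge0 A'; have := normr_ge0 B'.
lra.
Qed.

Let cos_absz (th : R) (k : R) : cos (th * `|k|) = cos (th * k).
Proof. by case: (ger0P k) => _ //; rewrite mulrN cosN. Qed.

Lemma weight_lattice_series k : k \in grid M -> has_sum setT
  (fun n : int * int => (4 * (pi / a) ^+ 2)^-1 * (coef a h n *
    (cos (2 * pi * n.1%:~R / K * k.1%:~R) * cos (2 * pi * n.2%:~R / K * k.2%:~R))))
  (w (lam^-1 * k.1%:~R, lam^-1 * k.2%:~R) *
   (cos (2 * pi * x.1 * k.1%:~R) * cos (2 * pi * x.2 * k.2%:~R))).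
Proof.
rewrite mem_grid => /andP[k1 k2].
have [C hC] := coef_summable.
(* The cosine series is available in the closed quadrant; by evenness of [h] and of the modes,
   absolute values of the indices may be taken. *)
pose z0 : R * R := (lam^-1 * `|k.1%:~R|, lam^-1 * `|k.2%:~R|).
have nn (j : int) : 0 <= lam^-1 * `|j%:~R| by rewrite mulr_ge0// invr_ge0 ltW.
have zL (j : int) : (`|j| <= M)%N -> 0 <= lam^-1 * `|j%:~R| < pi / a.
  move=> jM; rewrite nn/=.
  have jM' : `|j%:~R| <= M%:R :> R by rewrite -intr_norm -abszE -pmulrn ler_nat.
  rewrite LE invfM mulrA mulrC ltr_pM2r ?invr_gt0//.
  by rewrite ltr_pdivlMr// KE; move: jM'; lra.
have hz0 : h z0 = w (lam^-1 * k.1%:~R, lam^-1 * k.2%:~R) *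
   (cos (2 * pi * x.1 * k.1%:~R) * cos (2 * pi * x.2 * k.2%:~R)).
  have A (c j : R) : cos (2 * pi * (lam * c) * (lam^-1 * `|j|)) = cos (2 * pi * c * j).
    rewrite -[RHS]cos_absz; congr cos; field.
    by rewrite gt_eqF.
  have B (i j : R) : w (lam^-1 * `|i|, lam^-1 * `|j|) = w (lam^-1 * i, lam^-1 * j).
    by rewrite /w /weight/= !normrM !normr_id.
  by rewrite /h /z0 [LHS]/= !A B.
rewrite -hz0.
have cc : continuous (fun z : R * R => cos (2 * pi * (lam * x.1) * z.1) * cos (2 * pi * (lam * x.2) * z.2)).
  have c1 (c : R) : continuous (fun t : R => cos (c * t)).
    by move=> t; apply: continuous_comp; [exact: mulrl_continuous|exact: continuous_cos].
  move=> z; apply: cvgM.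
    by apply: (@continuous_comp _ _ _ (@fst R R) (fun t : R => cos (2 * pi * (lam * x.1) * t))); [exact: cvg_fst|exact: c1].
  by apply: (@continuous_comp _ _ _ (@snd R R) (fun t : R => cos (2 * pi * (lam * x.2) * t))); [exact: cvg_snd|exact: c1].
have iQ : leb2.-integrable (`[- (pi / a), pi / a] `*` `[- (pi / a), pi / a]) (EFin \o h).
  by apply: integrableS ih => //; apply: measurableX; exact: measurable_itv.
have e1 u v : h (- u, v) = h (u, v) by rewrite /h /w weightN1/= mulrN cosN.
have e2 u v : h (u, - v) = h (u, v) by rewrite /h /w weightN2/= mulrN cosN.
have := cosine_series a0 iQ e1 e2 hC (zL _ k1 : 0 <= z0.1 < _) (zL _ k2 : 0 <= z0.2 < _).
move=> /(_ (weight_outward b p0 cc (nn _ : 0 <= z0.1) (nn _ : 0 <= z0.2))).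
apply: eq_has_sum => n _; rewrite /cos2 /z0/=.
have E (j : R) (i : R) : cos (i * a * (lam^-1 * `|j|)) = cos (2 * pi * i / K * j).
  rewrite -[RHS]cos_absz; congr cos; rewrite /a /m; field.
  by rewrite ?(gt_eqF lam0) ?K1.
by rewrite !E.
Qed.

Lemma poisson_summation T :
  has_sum setT (fun n : int * int => g (lam * (x.1 - n.1%:~R), lam * (x.2 - n.2%:~R))) T ->
  \sum_(k <- grid M) w (lam^-1 * k.1%:~R, lam^-1 * k.2%:~R) *
    (cos (2 * pi * x.1 * k.1%:~R) * cos (2 * pi * x.2 * k.2%:~R)) = lam ^+ 2 * T.
Proof.
move=> hT.
have hT' : has_sum setT (gs true true lam) T.
  by apply: eq_has_sum hT => n _; rewrite /gs !expr1 !mulN1r -!mulrBr.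
have H := has_sum_seq weight_lattice_series.
(* Summation over the grid leaves only the indices divisible by [K], the range of [io]; on these the
   fine mesh [m] becomes [m * K = lam]. *)
pose io (k : int * int) : int * int := (M.*2.+1%:Z * k.1, M.*2.+1%:Z * k.2).
have ioI : injective io.
  by move=> [k1 k2] [j1 j2] [] /(mulfI (isT : M.*2.+1%:Z != 0)) -> /(mulfI (isT : M.*2.+1%:Z != 0)) ->.
have SE n : \sum_(k <- grid M) (4 * (pi / a) ^+ 2)^-1 * (coef a h n *
    (cos (2 * pi * n.1%:~R / K * k.1%:~R) * cos (2 * pi * n.2%:~R / K * k.2%:~R))) =
   (4 * (pi / a) ^+ 2)^-1 * (coef a h n * (K ^+ 2 * (((M.*2.+1)%:Z %| n.1)%Z && ((M.*2.+1)%:Z %| n.2)%Z)%:R)).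
  by rewrite -!mulr_sumr sum_grid_cos.
have H0 n : ~ range io n -> \sum_(k <- grid M) (4 * (pi / a) ^+ 2)^-1 * (coef a h n *
    (cos (2 * pi * n.1%:~R / K * k.1%:~R) * cos (2 * pi * n.2%:~R / K * k.2%:~R))) = 0.
  move=> nr; rewrite SE; case: andP => [[/dvdzP[q1 E1] /dvdzP[q2 E2]]|_]; last by rewrite !mulr0.
  exfalso; apply: nr; exists (q1, q2) => //; rewrite /io/= ![_ * q1]mulrC ![_ * q2]mulrC -E1 -E2.
  by case: (n).
have {H H0} H := has_sum_inj ioI H0 H.
apply: has_sum_unique H _.
(* The normalisation of the series is [lam ^ 2 / K ^ 2], and orthogonality returns [K ^ 2]. The
   factor 1/4 of [coef_cosft] averages the four sign choices, each of which sums to [T] on the full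
   lattice. *)
have := has_sumZ (lam ^+ 2 * 4^-1) (has_sumD (has_sumD (has_sum_signs false false hT') (has_sum_signs false true hT'))
   (has_sumD (has_sum_signs true false hT') hT')).
have -> : lam ^+ 2 / 4 * (T + T + (T + T)) = lam ^+ 2 * T by field.
apply: eq_has_sum => n _; rewrite /= SE !dvdz_mulr//= mulr1 coef_cosft.
have mK (j : int) : m * (M.*2.+1%:Z * j)%:~R = lam * j%:~R.
  by rewrite intrM -pmulrn -/K /m mulrA divfK ?gt_eqF.
have gE s1 s2 : gs s1 s2 m (io n) = gs s1 s2 lam n.
  by rewrite /gs /io/= !mK.
rewrite !gE LE; field.
by rewrite ?(gt_eqF lam0) ?K1.
Qed.

End poisson.

(** * The lattice sum as a weighted cosine sum over the grid *)

Section lattice_side.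
Variables (p b : R) (p0 : 0 < p) (s : R) (s0 : 0 < s).
Let w := weight p b.
Let lam := s `^ p^-1.
Let lam0 : 0 < lam. Proof. by rewrite powR_gt0. Qed.

Lemma sum_expi (I : Type) (r : seq I) (c t : I -> R) :
  \sum_(i <- r) ((c i)%:C%C * expi (t i)) =
  ((\sum_(i <- r) c i * cos (t i)) +i* (\sum_(i <- r) c i * sin (t i)))%C.
Proof.
elim: r => [|i r ih]; first by rewrite !big_nil.
by rewrite !big_cons ih; apply/eqP; rewrite eq_complex/= !mul0r subr0 addr0 !eqxx.
Qed.

(** As [lam <= M], the grid contains every lattice point of the open ball, and the points added
    contribute 0 through the weight. The grid is stable under sign changes, which removes the
    sines. *)
Lemma DsumE (M : nat) x : lam <= M%:R -> Dsum p b s x = ((Gamma (b + 1))^-1 *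
  (s `^ b * \sum_(k <- grid M) w (lam^-1 * k.1%:~R, lam^-1 * k.2%:~R) *
    (cos (2 * pi * x.1 * k.1%:~R) * cos (2 * pi * x.2 * k.2%:~R))))%:C%C.
Proof.
move=> lamM; rewrite /Dsum; set S := [set m | _].
pose c (k : int * int) := w (lam^-1 * k.1%:~R, lam^-1 * k.2%:~R).
have SP k : S k <-> `|k.1%:~R| `^ p + `|k.2%:~R| `^ p < s.
  by rewrite /S/= pnorm_powR.
have cE k : s `^ b * c k = if `|k.1%:~R| `^ p + `|k.2%:~R| `^ p < s
    then (s - (`|k.1%:~R| `^ p + `|k.2%:~R| `^ p)) `^ b else 0.
  exact: (weight_scale b p0 s0 (lattice_pt k)).
pose f (k : int * int) : R[i] := ((s `^ b * c k)%:C * expi (2 * pi * dot x (lattice_pt k)))%C.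
have SG : S `<=` [set` grid M].
  move=> k /SP kS; rewrite /= mem_grid.
  have ck : c k != 0.
    have : 0 < s `^ b * c k by rewrite cE kS powR_gt0// subr_gt0.
    by apply: contraTneq => ->; rewrite mulr0 ltxx.
  have [/= c1 c2] := weight_supp p0 ck.
  have kM (j : int) : `|lam^-1 * j%:~R| <= 1 -> (`|j| <= M)%N.
    rewrite normrM gtr0_norm ?invr_gt0// ler_pdivrMl// mulr1 => jl.
    by rewrite -(ler_nat R) pmulrn abszE intr_norm (le_trans jl).
  by rewrite !kM.
have -> : \sum_(k \in S) (((s - pnorm p (lattice_pt k) `^ p) `^ b)%:C%C
     * expi (2 * pi * dot x (lattice_pt k))) = \sum_(k \in S) f k.
  apply: eq_fsbigr => k; rewrite inE => /SP kS.
  by rewrite /f cE kS pnorm_powR.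
rewrite (fsbig_widen S [set` grid M] f SG); last first.
  move=> k [_ kS] /=; rewrite /f cE ifF ?mul0r//.
  by apply/negP => h; apply: kS; apply/SP.
rewrite -fsbig_seq ?grid_uniq// sum_expi.
have dE k : 2 * pi * dot x (lattice_pt k) = 2 * pi * x.1 * k.1%:~R + 2 * pi * x.2 * k.2%:~R :> R.
  by rewrite /dot/=; ring.
have cN1 k : c (- k.1, k.2) = c k by rewrite /c /w/= mulrNz mulrN weightN1.
have cN2 k : c (k.1, - k.2) = c k by rewrite /c /w/= mulrNz mulrN weightN2.
have -> : \sum_(k <- grid M) s `^ b * c k * sin (2 * pi * dot x (lattice_pt k)) = 0.
  under eq_bigr do rewrite dE sinD mulrDr.
  rewrite big_split/= big_grid_odd1 ?big_grid_odd2 ?addr0// => k.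
    by rewrite cN2 /= mulrNz mulrN sinN !mulrN.
  by rewrite cN1 /= mulrNz mulrN sinN mulNr mulrN.
have -> : \sum_(k <- grid M) s `^ b * c k * cos (2 * pi * dot x (lattice_pt k)) =
    s `^ b * \sum_(k <- grid M) c k * (cos (2 * pi * x.1 * k.1%:~R) * cos (2 * pi * x.2 * k.2%:~R)).
  under eq_bigr do rewrite dE cosD mulrBr.
  rewrite sumrB [X in _ - X]big_grid_odd1 ?subr0; last first.
    by move=> k; rewrite cN1 /= mulrNz mulrN sinN mulNr mulrN.
  by rewrite mulr_sumr; apply: eq_bigr => k _; rewrite mulrA.
by apply/eqP; rewrite eq_complex/= !mul0r mulr0 subr0 addr0 !eqxx.
Qed.

End lattice_side.

End poisson_formula.

Theorem theorem2 (R : realType) (p b : R) (hp : 0 < p) (hb : -1 < b)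
  (hint : Cintegrable setT (fun x : R * R => Dint p b 1 x)) :
  (forall (s : R) (x : R * R), 0 < s ->
    exists S : R,
      has_sum [set n : int * int | n != 0] (Jterm p b s x) S /\
      Dsum p b s x - Dint p b s x =
        (s `^ (b + 2 / p) * p `^ (b + 1) * Gamma p^-1 ^+ 2 * S)%:C%C) /\
  (forall (s : R) (x : R * R), 0 < s ->
    x.1 \in `] (- 2^-1), 2^-1 ] -> x.2 \in `] (- 2^-1), 2^-1 ] ->
    summable [set n : int * int | n != 0] (fun n => (Jterm p b s x n)%:E)).
Proof.
have intg := integrable_cosft hp hb hint.
have Gb : 0 < Gamma (b + 1) by apply: Gamma_gt0; rewrite -ltrBlDr sub0r.
pose K := p `^ (b + 1) * Gamma p^-1 ^+ 2.
have K0 : 0 < K by rewrite mulr_gt0 ?powR_gt0// exprn_gt0// Gamma_gt0// invr_gt0.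
pose g := cosft (weight p b).
have JE s x n : 0 < s -> Jterm p b s x n = K^-1 * ((Gamma (b + 1))^-1 *
    g (s `^ p^-1 * (x.1 - n.1%:~R), s `^ p^-1 * (x.2 - n.2%:~R))).
  by move=> s0; rewrite -(Jterm_cosft hp hb x n s0) mulKf ?gt_eqF.
split=> [s x s0|s x s0 _ _]; have lam0 : 0 < s `^ p^-1 by rewrite powR_gt0.
  have [T hT] := cosft_has_sum hp hb intg lam0 x.
  (* This fixes the grid size as the integer part of [lam] plus one. *)
  have lamM := ltW (truncnS_gt (s `^ p^-1)).
  have P := poisson_summation hp hb intg lam0 lamM hT.
  (* The full sum [T] belongs to the lattice sum; the term of [n = 0] taken away from it is, up to
     the common factor, the Dirichlet integral. *)
  exists (K^-1 * ((Gamma (b + 1))^-1 * (T - g (s `^ p^-1 * x.1, s `^ p^-1 * x.2)))); split.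
    have := has_sumZ K^-1 (has_sumZ (Gamma (b + 1))^-1 (has_sum_setD1 0 hT)).
    rewrite /= !subr0 => h; apply: eq_has_sum h => n _.
    by rewrite JE.
  rewrite (DsumE b hp s0 x lamM) (DintE hp hb x s0) P -rmorphB; congr (_%:C)%C.
  have E (A X : R) : A * p `^ (b + 1) * Gamma p^-1 ^+ 2 * (K^-1 * X) = A * X.
    by rewrite -[A * _ * _]mulrA -/K -mulrA mulVKf ?gt_eqF.
  rewrite E (powR_lam2 p b s0) -/g; ring.
(* Plancherel-Polya at mesh [lam] bounds all finite sums of absolute values of [g], and by [JE] the
   Bessel quotients differ from these values by a nonnegative constant factor. *)
have [C hC] := cosft_lattice_summable (integrable_weight hp hb) (fun z => weight_supp hp (z := z))
  intg (s `^ p^-1 * x.1, s `^ p^-1 * x.2) lam0.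
apply: (@summable_bounded _ _ _ _ (K^-1 * (Gamma (b + 1))^-1 * C)) => F finF.
have KG : 0 <= K^-1 * (Gamma (b + 1))^-1 by rewrite mulr_ge0// invr_ge0 ltW.
apply: le_trans (ler_wpM2l KG (hC F finF)); rewrite mulr_fsumr.
rewrite le_eqVlt; apply/orP; left; apply/eqP; apply: eq_fsbigr => n _.
by rewrite JE// mulrA normrM (ger0_norm KG) /= !mulrBr.
Qed.
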